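(* Let $\mathbb K$ be a field of characteristic $0$. There is exactly one element of $\underline{\mathrm{Pent}}_{\mathrm{Lie}}$ (resp., $\underline{\mathrm{Assoc}}_{\mathrm{Lie}}$, $\underline{\mathrm{Assoc}}^0_{\mathrm{Lie}}$) in each orbit of the action of $1+(\widehat{\mathcal T}_2)_0$ on $\underline{\mathrm{Pent}}$ (resp., $\underline{\mathrm{Assoc}}$, $\underline{\mathrm{Assoc}}^0$) by twists. The isotropy group of each element of $\underline{\mathrm{Pent}}$ is $\{e^{\lambda t^{1,2}}\mid\lambda\in\mathbb K\}\subset1+(\widehat{\mathcal T}_2)_0$.
   Context: For $n\ge2$, $\mathcal T_n$ is the $\mathbb K$-algebra with generators $t^{i,j}$ ($1\le i\ne j\le n$) and relations $t^{j,i}=t^{i,j}$, $[t^{i,j}+t^{i,k},t^{j,k}]=0$ for $i,j,k$ distinct, $[t^{i,j},t^{k,l}]=0$ for $i,j,k,l$ distinct. $\mathfrak t_n$ is the Lie algebra with the same generators and relations, so $\mathcal T_n=U(\mathfrak t_n)$. Both are graded with $\deg t^{i,j}=1$; $\widehat{\mathcal T}_n,\widehat{\mathfrak t}_n$ are the degree completions, and $(\widehat{\mathcal T}_n)_0=\mathrm{Ker}(\widehat{\mathcal T}_n\to\mathbb K)$. For $n\le m$ and disjoint subsets $I_1,\dots,I_n$ of $\{1,\dots,m\}$, $x\mapsto x^{I_1,\dots,I_n}$ is the algebra morphism $\mathcal T_n\to\mathcal T_m$ with $t^{i,j}\mapsto\sum_{\alpha\in I_i,\beta\in I_j}t^{\alpha,\beta}$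 (written e.g. $x^{12,3}$ for $I_1=\{1,2\},I_2=\{3\}$); in particular the symmetric group $\mathfrak S_n$ acts on $\mathcal T_n$. $\mathrm{Alt}$ denotes antisymmetrization for the action of $\mathfrak S_3$ on $\widehat{\mathcal T}_3$, $\mathrm{Alt}(x)=\frac16\sum_{\sigma\in\mathfrak S_3}\mathrm{sgn}(\sigma)\,x^{\sigma(1),\sigma(2),\sigma(3)}$. $\underline{\mathrm{Pent}}$ is the set of $\Phi\in1+(\widehat{\mathcal T}_3)_0$ satisfying the pentagon equation $\Phi^{1,2,34}\Phi^{12,3,4}=\Phi^{2,3,4}\Phi^{1,23,4}\Phi^{1,2,3}$. An associator is an element $\Phi\in1+(\widehat{\mathcal T}_3)_0$ satisfying the pentagon equation, the hexagon equations $$e^{(t^{1,3}+t^{2,3})/2}=\Phi^{3,1,2}e^{t^{1,3}/2}(\Phi^{1,3,2})^{-1}e^{t^{2,3}/2}\Phi^{1,2,3},\qquad e^{(t^{1,2}+t^{1,3})/2}=(\Phi^{2,3,1})^{-1}e^{t^{1,3}/2}\Phi^{2,1,3}e^{t^{1,2}/2}(\Phi^{1,2,3})^{-1}$$ and $\mathrm{Alt}(\Phi)=\frac18[t^{1,2},t^{2,3}]+{}$terms of degree $>2$. $\underline{\mathrm{Assoc}}$ is the set of associators, $\underline{\mathrm{Assoc}}^0$ the subset of those satisfying the duality condition $\Phi^{3,2,1}=\Phi^{-1}$. $\underline{\mathrm{Pent}}_{\mathrm{Lie}}$, $\underline{\mathrm{Assoc}}_{\mathrm{Lie}}$, $\underline{\mathrm{Assoc}}^0_{\mathrm{Lie}}$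 are the subsets of all $\Phi$ in $\underline{\mathrm{Pent}}$, $\underline{\mathrm{Assoc}}$, $\underline{\mathrm{Assoc}}^0$ respectively with $\log(\Phi)\in\widehat{\mathfrak t}_3$. The twist of $\Phi\in1+(\widehat{\mathcal T}_3)_0$ by $F\in1+(\widehat{\mathcal T}_2)_0$ is ${}^F\Phi=F^{2,3}F^{1,23}\Phi(F^{1,2}F^{12,3})^{-1}$; this is an action of the group $1+(\widehat{\mathcal T}_2)_0$ on $1+(\widehat{\mathcal T}_3)_0$ which preserves $\underline{\mathrm{Pent}}$, $\underline{\mathrm{Assoc}}$ and $\underline{\mathrm{Assoc}}^0$. *)

(* Defs.v *)
From HB Require Import structures.
From mathcomp Require Import all_boot all_order all_algebra all_fingroup.
From mathcomp Require Import generic_quotient ring_quotient.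
From mathcomp Require Import zify.
From mathcomp Require Import boolp classical_sets.

Set Implicit Arguments.
Unset Strict Implicit.
Unset Printing Implicit Defensive.

Import GRing.Theory.
Local Open Scope ring_scope.

(* Noncommutative formal power series K<<X>>: the degree completion of the   *)
(* free algebra K<X>, a word over X being a [seq X] of degree its size.       *)

Record ncseries (K : fieldType) (X : finType) := NCSeries { nccoef : seq X -> K }.

HB.instance Definition _ (K : fieldType) (X : finType) :=
  gen_eqMixin (ncseries K X).
HB.instance Definition _ (K : fieldType) (X : finType) :=
  gen_choiceMixin (ncseries K X).

Section NCSeries.
Variables (K : fieldType) (X : finType).
Local Notation S := (ncseries K X).
Implicit Types (f g h : S) (w : seq X).

Lemma ncseriesP f g : (forall w, nccoef f w = nccoef g w) -> f = g.
Proof. by case: f g => [f] [g] /= /funext ->. Qed.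

Definition nc_zero : S := NCSeries (fun _ => 0).
Definition nc_opp f : S := NCSeries (fun w => - nccoef f w).
Definition nc_add f g : S := NCSeries (fun w => nccoef f w + nccoef g w).
Definition nc_scale (c : K) f : S := NCSeries (fun w => c * nccoef f w).
Definition ncword w : S := NCSeries (fun v => (v == w)%:R).
Definition nc_mul f g : S := NCSeries (fun w =>
  \sum_(i < (size w).+1) nccoef f (take i w) * nccoef g (drop i w)).

Fact nc_addA : associative nc_add.
Proof. by move=> f g h; apply: ncseriesP => w /=; rewrite addrA. Qed.
Fact nc_addC : commutative nc_add.
Proof. by move=> f g; apply: ncseriesP => w /=; rewrite addrC. Qed.
Fact nc_add0 : left_id nc_zero nc_add.
Proof. by move=> f; apply: ncseriesP => w /=; rewrite add0r. Qed.
Fact nc_addN : left_inverse nc_zero nc_opp nc_add.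
Proof. by move=> f; apply: ncseriesP => w /=; rewrite addNr. Qed.
HB.instance Definition _ :=
  GRing.isZmodule.Build (ncseries K X) nc_addA nc_addC nc_add0 nc_addN.

Definition nc_shift (x : X) f : S := NCSeries (fun w => nccoef f (x :: w)).

Lemma nc_mul_nil f g : nccoef (nc_mul f g) [::] = nccoef f [::] * nccoef g [::].
Proof. by rewrite /= big_ord_recl big_ord0 addr0. Qed.

Lemma nc_mul_cons f g x w : nccoef (nc_mul f g) (x :: w) =
  nccoef f [::] * nccoef g (x :: w) + nccoef (nc_mul (nc_shift x f) g) w.
Proof. by rewrite /= big_ord_recl. Qed.

Fact nc_mulDl : left_distributive nc_mul +%R.
Proof.
move=> f g h; apply: ncseriesP => w /=; rewrite -big_split /=.
by apply: eq_bigr => i _; rewrite mulrDl.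
Qed.
Fact nc_mulDr : right_distributive nc_mul +%R.
Proof.
move=> f g h; apply: ncseriesP => w /=; rewrite -big_split /=.
by apply: eq_bigr => i _; rewrite mulrDr.
Qed.
Lemma nc_scalel c f g : nc_scale c (nc_mul f g) = nc_mul (nc_scale c f) g.
Proof.
apply: ncseriesP => w /=; rewrite mulr_sumr.
by apply: eq_bigr => i _; rewrite mulrA.
Qed.
Lemma nc_scaler c f g : nc_scale c (nc_mul f g) = nc_mul f (nc_scale c g).
Proof.
apply: ncseriesP => w /=; rewrite mulr_sumr.
by apply: eq_bigr => i _; rewrite mulrCA.
Qed.

Fact nc_mulA : associative nc_mul.
Proof.
move=> f g h; apply: ncseriesP => w.
elim: w f => [|x w IHw] f; first by rewrite !nc_mul_nil mulrA.
rewrite !nc_mul_cons {}IHw nc_mul_nil mulrDr mulrA -!addrA; congr (_ + _).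
have -> : nc_shift x (nc_mul f g) =
    nc_scale (nccoef f [::]) (nc_shift x g) + nc_mul (nc_shift x f) g.
  by apply: ncseriesP => v; rewrite /nc_shift [LHS]nc_mul_cons.
by rewrite nc_mulDl -nc_scalel.
Qed.

Fact nc_mul1 : left_id (ncword [::]) nc_mul.
Proof.
move=> f; apply: ncseriesP => -[|x w]; first by rewrite nc_mul_nil /= mul1r.
rewrite nc_mul_cons /= mul1r big1 ?addr0 // => i _.
by rewrite mul0r.
Qed.
Fact nc_mulr1 : right_id (ncword [::]) nc_mul.
Proof.
move=> f; apply: ncseriesP => w; elim: w f => [|x w IHw] f.
  by rewrite nc_mul_nil /= mulr1.
by rewrite nc_mul_cons IHw /= mulr0 add0r.
Qed.
Fact nc_one_neq0 : ncword [::] != 0.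
Proof. by apply/eqP => /(congr1 (fun f : S => nccoef f [::])) /eqP; rewrite /= oner_eq0. Qed.
HB.instance Definition _ := GRing.Zmodule_isNzRing.Build (ncseries K X)
  nc_mulA nc_mul1 nc_mulr1 nc_mulDl nc_mulDr nc_one_neq0.

Fact nc_scaleA a b f : nc_scale a (nc_scale b f) = nc_scale (a * b) f.
Proof. by apply: ncseriesP => w /=; rewrite mulrA. Qed.
Fact nc_scale1 : left_id 1 nc_scale.
Proof. by move=> f; apply: ncseriesP => w /=; rewrite mul1r. Qed.
Fact nc_scaleDr : right_distributive nc_scale +%R.
Proof. by move=> a f g; apply: ncseriesP => w /=; rewrite mulrDr. Qed.
Fact nc_scaleDl f : {morph nc_scale^~ f : a b / a + b}.
Proof. by move=> a b; apply: ncseriesP => w /=; rewrite mulrDl. Qed.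
HB.instance Definition _ := GRing.Zmodule_isLmodule.Build K (ncseries K X)
  nc_scaleA nc_scale1 nc_scaleDr nc_scaleDl.
HB.instance Definition _ :=
  GRing.Lmodule_isLalgebra.Build K (ncseries K X) nc_scalel.
HB.instance Definition _ :=
  GRing.Lalgebra_isAlgebra.Build K (ncseries K X) nc_scaler.

Lemma nccoefD f g w : nccoef (f + g) w = nccoef f w + nccoef g w.
Proof. by []. Qed.
Lemma nccoefN f w : nccoef (- f) w = - nccoef f w.
Proof. by []. Qed.
Lemma nccoefZ c f w : nccoef (c *: f) w = c * nccoef f w.
Proof. by []. Qed.
Lemma nccoefM f g w : nccoef (f * g) w =
  \sum_(i < (size w).+1) nccoef f (take i w) * nccoef g (drop i w).
Proof. by []. Qed.
Lemma nccoef_sum I (r : seq I) (P : pred I) (F : I -> S) w :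
  nccoef (\sum_(i <- r | P i) F i) w = \sum_(i <- r | P i) nccoef (F i) w.
Proof. by elim/big_rec2: _ => // i y1 y2 _ <-. Qed.

Definition nchom (d : nat) f : S :=
  NCSeries (fun w => if size w == d then nccoef f w else 0).

Fact nchom_is_linear d : linear (nchom d).
Proof.
move=> c f g; apply: ncseriesP => w /=.
by case: ifP => // _; rewrite mulr0 addr0.
Qed.
HB.instance Definition _ d :=
  GRing.isLinear.Build K (ncseries K X) (ncseries K X) *:%R (nchom d)
    (nchom_is_linear d).

End NCSeries.

Definition tgen (n : nat) : finType := {p : 'I_n * 'I_n | p.1 != p.2}.

Section Relations.
Variables (K : fieldType) (n : nat).
Local Notation S := (ncseries K (tgen n)).
Implicit Types f g : S.

(* junk value 0 when i = j *)
Definition tser (i j : 'I_n) : S :=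
  if insub (i, j) is Some p then ncword K [:: p] else 0.

Inductive trelator : S -> Prop :=
| trel_sym i j : i != j -> trelator (tser j i - tser i j)
| trel_3 i j k : uniq [:: i; j; k] ->
    trelator ((tser i j + tser i k) * tser j k
              - tser j k * (tser i j + tser i k))
| trel_4 i j k l : uniq [:: i; j; k; l] ->
    trelator (tser i j * tser k l - tser k l * tser i j).

(* the two-sided ideal of K<X> (finitely supported series) generated by the  *)
(* relators                                                                   *)
Inductive tideal : S -> Prop :=
| tideal0 : tideal 0
| tidealD c u r v f : trelator r -> tideal f ->
    tideal (c *: (ncword K u * r * ncword K v) + f).

(* As the relators are homogeneous, the kernel of K<<X>> onto the product of *)
(* the homogeneous components of K<X> / tideal consists of the series all of  *)
(* whose homogeneous components are in tideal.                                *)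
Definition tclosed : pred S := fun f => `[< forall d, tideal (nchom d f) >].

End Relations.

Section NCHom.
Variables (K : fieldType) (X : finType).
Local Notation S := (ncseries K X).
Implicit Types (f g h : S) (u v w : seq X).

Lemma nccoef_hom d f w :
  nccoef (nchom d f) w = if size w == d then nccoef f w else 0.
Proof. by []. Qed.

Lemma nccoefM0 f g : nccoef (f * g) [::] = nccoef f [::] * nccoef g [::].
Proof. exact: nc_mul_nil. Qed.

Lemma nchomP f g : (forall d, nchom d f = nchom d g) -> f = g.
Proof.
move=> e; apply: ncseriesP => w.
by have /(congr1 (fun h => nccoef h w)) := e (size w); rewrite /= eqxx.
Qed.

Lemma nchom_nchom d e f : nchom d (nchom e f) = if d == e then nchom d f else 0.
Proof.
apply: ncseriesP => w /=; case: (eqVneq d e) => [->|de] /=; first by case: eqP.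
by case: (eqVneq (size w) d) => // ->; rewrite (negPf de).
Qed.

Lemma nchomM d f g :
  nchom d (f * g) = \sum_(i < d.+1) nchom i f * nchom (d - i) g.
Proof.
apply: ncseriesP => w; rewrite nccoef_sum nccoef_hom.
case: (eqVneq (size w) d) => [<-|wd].
  rewrite nccoefM; apply: eq_bigr => i _; rewrite nccoefM (bigD1 i) //=.
  rewrite size_takel -1?ltnS // size_drop !eqxx big1 ?addr0 // => j ji.
  by rewrite size_takel -1?ltnS // -val_eqE /= in ji *; rewrite (negPf ji) mul0r.
rewrite big1 // => i _; rewrite nccoefM big1 // => j _ /=.
rewrite size_takel -1?ltnS // size_drop.
case: eqP => [ji|_]; last by rewrite mul0r.
case: eqP => [wi|_]; last by rewrite mulr0.
case/eqP: wd; have := ltn_ord i; have := ltn_ord j; rewrite -ji in wi *.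
rewrite !ltnS => jw jd.
by rewrite -(subnK jw) wi subnK.
Qed.

Lemma nchom_word d w : nchom d (ncword K w) = if size w == d then ncword K w else 0.
Proof.
apply: ncseriesP => v; rewrite nccoef_hom.
case: (eqVneq v w) => [->|vw]; first by case: ifP.
by case: ifP; case: ifP => //=; rewrite (negPf vw).
Qed.

Lemma nchom_sum_word d f :
  nchom d f = \sum_(w : d.-tuple X) nccoef f w *: ncword K w.
Proof.
apply: ncseriesP => v; rewrite nccoef_sum nccoef_hom.
case: (eqVneq (size v) d) => [vd|vd].
  rewrite (bigD1 (tcast vd (in_tuple v))) //= val_tcast eqxx mulr1.
  rewrite big1 ?addr0 // => w; rewrite -val_eqE /= val_tcast /= eq_sym.
  by move=> /negPf ->; rewrite mulr0.
rewrite big1 // => w _ /=; case: eqP => [vw|]; last by rewrite mulr0.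
by move: vd; rewrite vw size_tuple eqxx.
Qed.

Lemma ncwordM u v : ncword K u * ncword K v = ncword K (u ++ v).
Proof.
apply: ncseriesP => w; elim: w u => [|x w IHw] u.
  rewrite [LHS]nc_mul_nil /=; case: u => [|y u]; last by rewrite mul0r.
  by rewrite mul1r.
rewrite [LHS]nc_mul_cons /=; case: u => [|y u] /=.
  rewrite mul1r big1 ?addr0 // => i _.
  by rewrite mul0r.
rewrite mul0r add0r eqseq_cons.
case: (eqVneq x y) => [->|xy] /=.
  by rewrite -[RHS]IHw; apply: eq_bigr => i _ /=; rewrite eqseq_cons eqxx.
by rewrite big1 // => i _; rewrite eqseq_cons (negPf xy) mul0r.
Qed.

End NCHom.

Section Ideal.
Variables (K : fieldType) (n : nat).
Local Notation S := (ncseries K (tgen n)).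
Implicit Types f g h : S.

Lemma tidealDD f g : tideal f -> tideal g -> tideal (f + g).
Proof.
move=> If Ig; elim: If => [|c u r v h rr _ IH]; first by rewrite add0r.
by rewrite -addrA; apply: tidealD.
Qed.

Lemma tidealZ c f : tideal f -> tideal (c *: f).
Proof.
elim=> [|e u r v h rr _ IH]; first by rewrite scaler0; apply: tideal0.
by rewrite scalerDr scalerA; apply: tidealD.
Qed.

Lemma tideal_mulw u f v : tideal f -> tideal (ncword K u * f * ncword K v).
Proof.
elim=> [|e u1 r v1 h rr _ IH]; first by rewrite mulr0 mul0r; apply: tideal0.
rewrite mulrDr mulrDl -scalerAr -scalerAl !mulrA ncwordM -[_ * _ * _ * _]mulrA.
by rewrite ncwordM; apply: tidealD.
Qed.

Lemma tideal_sum I (r : seq I) (P : pred I) (F : I -> S) :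
  (forall i, P i -> tideal (F i)) -> tideal (\sum_(i <- r | P i) F i).
Proof. by move=> H; elim/big_ind: _ => //; [left | apply: tidealDD]. Qed.

Fact tclosed_zmod : zmod_closed (@tclosed K n).
Proof.
split=> [|f g /asboolP If /asboolP Ig]; apply/asboolP => d.
  by rewrite linear0; left.
by rewrite linearB /= -scaleN1r; apply: tidealDD => //; apply: tidealZ.
Qed.
HB.instance Definition _ := GRing.isZmodClosed.Build S (@tclosed K n) tclosed_zmod.

Lemma tclosedM f g h : f \in @tclosed K n -> g * f * h \in @tclosed K n.
Proof.
move=> /asboolP If; apply/asboolP => d; rewrite nchomM.
apply: tideal_sum => i _; rewrite nchomM mulr_suml.
apply: tideal_sum => j _; rewrite (nchom_sum_word j) 2!mulr_suml.
apply: tideal_sum => u _; rewrite (nchom_sum_word (d - i)) mulr_sumr.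
apply: tideal_sum => v _; rewrite -!scalerAl -scalerAr.
by do 2 apply: tidealZ; apply: tideal_mulw.
Qed.

Lemma tclosedZ c f : f \in @tclosed K n -> c *: f \in @tclosed K n.
Proof.
by move=> /asboolP If; apply/asboolP => d; rewrite linearZ /=; exact: tidealZ.
Qed.

Lemma tser_const (i j : 'I_n) : nccoef (tser K i j) [::] = 0.
Proof. by rewrite /tser; case: insubP. Qed.

Lemma tideal_const f : tideal f -> nccoef f [::] = 0.
Proof.
elim=> // c u r v h rr _ IH; rewrite nccoefD IH addr0 nccoefZ.
rewrite !nccoefM0.
suff -> : nccoef r [::] = 0 by rewrite mulr0 mul0r mulr0.
case: rr => *; rewrite nccoefD nccoefN ?nccoefM0 ?nccoefD !tser_const;
  by rewrite ?(mulr0, addr0, mul0r, subr0).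
Qed.

Lemma tclosed_const f : f \in @tclosed K n -> nccoef f [::] = 0.
Proof. by move=> /asboolP /(_ 0%N) /tideal_const. Qed.

End Ideal.

(* The product over d of the homogeneous components of T_n = K<X> / tideal,   *)
(* presented as a quotient of K<<X>>.                                         *)

Definition tker (K : fieldType) (n : nat) : zmodClosed (ncseries K (tgen n)) :=
  GRing.ZmodClosed.clone _ (@tclosed K n) _.

Definition That (K : fieldType) (n : nat) : Type :=
  Quotient.quot (tker K n).

HB.instance Definition _ K n := Choice.on (That K n).
HB.instance Definition _ K n := GRing.Zmodule.on (That K n).

Section ThatRing.
Variables (K : fieldType) (n : nat).
Local Notation S := (ncseries K (tgen n)).
Local Notation T := (That K n).
Implicit Types (f g h : S) (x y z : T).

Definition tpi f : T := \pi_(Quotient.quot (tker K n))%qT f.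
Definition trepr x : S := repr (x : Quotient.quot (tker K n)).

Lemma treprK : cancel trepr tpi.
Proof. exact: reprK. Qed.

Lemma tpi_eq f g : (tpi f = tpi g) <-> f - g \in @tclosed K n.
Proof. by rewrite Quotient.idealrBE; split=> /eqP. Qed.

Fact tpi_is_zmod_morphism : zmod_morphism tpi.
Proof. by move=> f g; rewrite /tpi raddfB. Qed.
HB.instance Definition _ :=
  GRing.isZmodMorphism.Build S T tpi tpi_is_zmod_morphism.

Lemma tpiK f : trepr (tpi f) - f \in @tclosed K n.
Proof. by apply/tpi_eq; rewrite treprK. Qed.

Definition t_one : T := tpi 1.
Definition t_mul x y : T := tpi (trepr x * trepr y).
Definition t_scale (c : K) x : T := tpi (c *: trepr x).

Lemma tpi_mul f g : t_mul (tpi f) (tpi g) = tpi (f * g).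
Proof.
apply/tpi_eq; set f' := trepr _; set g' := trepr _.
have -> : f' * g' - f * g = f' * (g' - g) * 1 + 1 * (f' - f) * g.
  by rewrite mulr1 mul1r mulrBr mulrBl addrA subrK.
by apply: rpredD; apply: tclosedM; apply: tpiK.
Qed.

Lemma tpi_scale c f : t_scale c (tpi f) = tpi (c *: f).
Proof. by apply/tpi_eq; rewrite -scalerBr; apply: tclosedZ; apply: tpiK. Qed.

Fact t_mulA : associative t_mul.
Proof.
move=> x y z; rewrite -[x]treprK -[y]treprK -[z]treprK.
by rewrite !tpi_mul mulrA.
Qed.
Fact t_mul1 : left_id t_one t_mul.
Proof. by move=> x; rewrite -[x]treprK tpi_mul mul1r. Qed.
Fact t_mulr1 : right_id t_one t_mul.
Proof. by move=> x; rewrite -[x]treprK tpi_mul mulr1. Qed.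
Fact t_mulDl : left_distributive t_mul +%R.
Proof.
move=> x y z; rewrite -[x]treprK -[y]treprK -[z]treprK.
by rewrite -raddfD !tpi_mul mulrDl raddfD.
Qed.
Fact t_mulDr : right_distributive t_mul +%R.
Proof.
move=> x y z; rewrite -[x]treprK -[y]treprK -[z]treprK.
by rewrite -raddfD !tpi_mul mulrDr raddfD.
Qed.
Fact t_one_neq0 : t_one != 0.
Proof.
apply/eqP; rewrite /t_one -(raddf0 tpi) => /tpi_eq /tclosed_const /eqP.
by rewrite subr0 oner_eq0.
Qed.
HB.instance Definition _ := GRing.Zmodule_isNzRing.Build T
  t_mulA t_mul1 t_mulr1 t_mulDl t_mulDr t_one_neq0.

Fact t_scaleA a b x : t_scale a (t_scale b x) = t_scale (a * b) x.
Proof. by rewrite -[x]treprK !tpi_scale scalerA. Qed.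
Fact t_scale1 : left_id 1 t_scale.
Proof. by move=> x; rewrite -[x]treprK tpi_scale scale1r. Qed.
Fact t_scaleDr : right_distributive t_scale +%R.
Proof.
move=> a x y; rewrite -[x]treprK -[y]treprK.
by rewrite -raddfD !tpi_scale scalerDr raddfD.
Qed.
Fact t_scaleDl x : {morph t_scale^~ x : a b / a + b}.
Proof. by move=> a b; rewrite -[x]treprK !tpi_scale scalerDl raddfD. Qed.
HB.instance Definition _ := GRing.Zmodule_isLmodule.Build K T
  t_scaleA t_scale1 t_scaleDr t_scaleDl.

Fact t_scaleAl a x y : a *: (x * y) = (a *: x) * y.
Proof.
rewrite -[x]treprK -[y]treprK; move: (trepr x) (trepr y) => f g.
transitivity (t_scale a (t_mul (tpi f) (tpi g))); first by [].
transitivity (t_mul (t_scale a (tpi f)) (tpi g)); last by [].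
by rewrite tpi_mul !tpi_scale tpi_mul scalerAl.
Qed.
HB.instance Definition _ := GRing.Lmodule_isLalgebra.Build K T t_scaleAl.
Fact t_scaleAr a x y : a *: (x * y) = x * (a *: y).
Proof.
rewrite -[x]treprK -[y]treprK; move: (trepr x) (trepr y) => f g.
transitivity (t_scale a (t_mul (tpi f) (tpi g))); first by [].
transitivity (t_mul (tpi f) (t_scale a (tpi g))); last by [].
by rewrite tpi_mul !tpi_scale tpi_mul scalerAr.
Qed.
HB.instance Definition _ := GRing.Lalgebra_isAlgebra.Build K T t_scaleAr.

Fact tpi_is_monoid_morphism : monoid_morphism tpi.
Proof. by split=> // f g; rewrite -tpi_mul. Qed.
HB.instance Definition _ :=
  GRing.isMonoidMorphism.Build S T tpi tpi_is_monoid_morphism.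
Fact tpi_is_scalable : scalable tpi.
Proof. by move=> c f; rewrite -tpi_scale. Qed.
HB.instance Definition _ := GRing.isScalable.Build K S T *:%R tpi tpi_is_scalable.

Definition t_unit : pred T :=
  fun x => `[< exists y, y * x = 1 /\ x * y = 1 >].
(* junk value x when x is not invertible *)
Definition t_inv x : T :=
  if pselect (exists y, y * x = 1 /\ x * y = 1) is left e
  then projT1 (cid e) else x.

Fact t_mulVr : {in t_unit, left_inverse 1 t_inv *%R}.
Proof.
move=> x /asboolP e; rewrite /t_inv; case: pselect => // {}e.
by case: (cid e) => y [].
Qed.
Fact t_mulrV : {in t_unit, right_inverse 1 t_inv *%R}.
Proof.
move=> x /asboolP e; rewrite /t_inv; case: pselect => // {}e.
by case: (cid e) => y [].
Qed.
Fact t_unitP x y : y * x = 1 /\ x * y = 1 -> t_unit x.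
Proof. by move=> e; apply/asboolP; exists y. Qed.
Fact t_inv_out : {in [predC t_unit], t_inv =1 id}.
Proof.
move=> x /negP; rewrite /t_inv; case: pselect => // e [].
by apply/asboolP.
Qed.
HB.instance Definition _ := GRing.NzRing_hasMulInverse.Build T
  t_mulVr t_mulrV t_unitP t_inv_out.

End ThatRing.

Section Graded.
Variables (K : fieldType) (n : nat).
Local Notation T := (That K n).
Implicit Types (x y z : T).

Definition t (i j : 'I_n) : T := tpi (tser K i j).

(* Homogeneous component; independent of the representative by hcomp_pi.      *)
Definition hcomp (d : nat) x : T := tpi (nchom d (trepr x)).

(* The projection onto K; independent of the representative by aug_pi.        *)
Definition aug x : K := nccoef (trepr x) [::].

(* The element whose component of degree d is that of \sum_(k <= d) u k (see  *)
(* hcomp_tsum); it is the sum of the series of the u k as soon as u k has no  *)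
(* component of degree < k.                                                   *)
Definition tsum (u : nat -> T) : T :=
  tpi (NCSeries (fun w => \sum_(k < (size w).+1) nccoef (trepr (u k)) w)).

Lemma hcomp_pi d f : hcomp d (tpi f) = tpi (nchom d f).
Proof.
apply/tpi_eq; rewrite -linearB /=; apply/asboolP => e.
rewrite nchom_nchom; case: eqP => [->|_]; last exact: tideal0.
by have /asboolP := tpiK f.
Qed.

Fact hcomp_is_linear d : linear (hcomp d).
Proof.
move=> c x y; rewrite -[x]treprK -[y]treprK -(linearP (@tpi K n)).
by rewrite !hcomp_pi !linearP.
Qed.
HB.instance Definition _ d :=
  GRing.isLinear.Build K T T *:%R (hcomp d) (hcomp_is_linear d).

Lemma aug_pi f : aug (tpi f) = nccoef f [::].
Proof. by apply/eqP; rewrite -subr_eq0 -nccoefN -nccoefD tclosed_const ?tpiK. Qed.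

Lemma hcompP x y : (forall d, hcomp d x = hcomp d y) -> x = y.
Proof.
move=> e; rewrite -[x]treprK -[y]treprK; apply/tpi_eq/asboolP => d.
have /tpi_eq /asboolP /(_ d) := e d.
by rewrite -(linearB (nchom d)) /= nchom_nchom eqxx.
Qed.

Lemma hcomp_hcomp d e x : hcomp d (hcomp e x) = if d == e then hcomp d x else 0.
Proof.
rewrite -[x]treprK !hcomp_pi nchom_nchom; case: ifP => // _.
by rewrite raddf0.
Qed.

Lemma hcompM d x y :
  hcomp d (x * y) = \sum_(i < d.+1) hcomp i x * hcomp (d - i) y.
Proof.
rewrite -[x]treprK -[y]treprK -rmorphM hcomp_pi nchomM raddf_sum.
by apply: eq_bigr => i _; rewrite !hcomp_pi -rmorphM.
Qed.

Lemma hcomp_tsum u d : hcomp d (tsum u) = \sum_(k < d.+1) hcomp d (u k).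
Proof.
rewrite hcomp_pi.
transitivity (tpi (\sum_(k < d.+1) nchom d (trepr (u k)))); last first.
  by rewrite raddf_sum.
congr tpi; apply: ncseriesP => w.
rewrite nccoef_sum nccoef_hom /=; case: (eqVneq (size w) d) => [<-|wd] /=.
  by [].
by rewrite big1.
Qed.

Definition texp x : T := tsum (fun k => (k`!%:R)^-1 *: x ^+ k).
Definition tlog x : T := tsum (fun k => ((-1) ^+ k / k.+1%:R) *: (x - 1) ^+ k.+1).

Definition one_plus : set T := [set x | aug (x - 1) = 0].

(* The image of t_n in T_n = U(t_n): the Lie subalgebra generated by the t i j. *)
Inductive lie : T -> Prop :=
| lie0 : lie 0
| lie_gen i j : i != j -> lie (t i j)
| lieD x y : lie x -> lie y -> lie (x + y)
| lieZ c x : lie x -> lie (c *: x)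
| lieB x y : lie x -> lie y -> lie (x * y - y * x).

Definition lie_hat : set T := [set x | forall d, lie (hcomp d x)].

End Graded.

Section Cosimplicial.
Variables (K : fieldType) (n m : nat) (I : 'I_n -> {set 'I_m}).

Definition cogen (p : tgen n) : That K m :=
  \sum_(a in I (val p).1) \sum_(b in I (val p).2) t K a b.

Definition coser (f : ncseries K (tgen n)) : That K m :=
  tsum (fun d => \sum_(w : d.-tuple (tgen n)) nccoef f w *: \prod_(p <- w) cogen p).

(* x^{I_1, ..., I_n}. For pairwise disjoint I_i it is independent of the      *)
(* representative and is the continuous algebra morphism prescribed on the    *)
(* generators: coface_pi, coface_is_linear, coface_is_monoid_morphism,        *)
(* coface_t, hcomp_coface.                                                    *)
Definition coface (x : That K n) : That K m := coser (trepr x).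

End Cosimplicial.

Section TRelations.
Variables (K : fieldType) (n : nat).
Local Notation T := (That K n).
Local Notation t := (t K).
Implicit Types (x y : T) (i j k l : 'I_n).

Lemma trelator_eq0 r : @trelator K n r -> tpi r = 0.
Proof.
move=> rr; rewrite -(raddf0 (@tpi K n)); apply/tpi_eq; rewrite subr0.
apply/asboolP => d; suff [->|->] : nchom d r = r \/ nchom d r = 0.
- have := tidealD 1 [::] [::] rr (@tideal0 K n).
  by rewrite scale1r addr0 mulr1 mul1r.
- exact: tideal0.
have h1 i j e : nchom e (tser K i j) = if e == 1%N then tser K i j else 0.
  rewrite /tser; case: insubP => [p _ _|_]; last by rewrite raddf0; case: ifP.
  by rewrite nchom_word eq_sym.
have hM f g : (forall e, nchom e f = if e == 1%N then f else 0) ->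
    (forall e, nchom e g = if e == 1%N then g else 0) ->
    nchom d (f * g) = if d == 2%N then f * g else 0.
  move=> hf hg; rewrite nchomM; case: eqP => [->|d2].
    rewrite !big_ord_recl big_ord0 /= !(hf, hg) /= /bump /=.
    by rewrite !(mul0r, add0r, addr0).
  rewrite big1 // => i _; rewrite hf hg.
  case: eqP => [i1|_]; last by rewrite mul0r.
  case: eqP => [di|_]; last by rewrite mulr0.
  by have := ltn_ord i; rewrite i1 in di * => ?; case: d2; lia.
have hD i j k e : nchom e (tser K i j + tser K i k) =
    if e == 1%N then tser K i j + tser K i k else 0.
  by rewrite raddfD /= !h1; case: ifP; rewrite ?addr0.
case: rr => *; rewrite raddfB /= ?h1 ?hM //; case: ifP => _;
  rewrite ?subr0; by [left | right].
Qed.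

Lemma t_diag i : t i i = 0.
Proof.
rewrite /t /tser; case: insubP => [p|]; last by rewrite raddf0.
by rewrite /= eqxx.
Qed.

Lemma t_sym i j : t j i = t i j.
Proof.
have [->//|ij] := eqVneq i j; apply/eqP; rewrite -subr_eq0.
by rewrite -(raddfB (@tpi K n)) /= trelator_eq0 //; apply: trel_sym.
Qed.

Lemma t_comm3 i j k : uniq [:: i; j; k] ->
  GRing.comm (t i j + t i k) (t j k).
Proof.
move=> u; apply/eqP; rewrite -subr_eq0 -(raddfD (@tpi K n)).
rewrite -!(rmorphM (@tpi K n)) -(raddfB (@tpi K n)) /=.
by rewrite trelator_eq0 //; apply: trel_3.
Qed.

Lemma t_comm4 i j k l : uniq [:: i; j; k; l] -> GRing.comm (t i j) (t k l).
Proof.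
move=> u; apply/eqP; rewrite -subr_eq0.
rewrite -!(rmorphM (@tpi K n)) -(raddfB (@tpi K n)) /=.
by rewrite trelator_eq0 //; apply: trel_4.
Qed.

Definition homog d x := forall e, hcomp e x = if e == d then x else 0.

Lemma homogM d e x y : homog d x -> homog e y -> homog (d + e) (x * y).
Proof.
move=> hx hy c; rewrite hcompM; case: eqP => [->|cde].
  rewrite (bigD1 (inord d : 'I_(d + e).+1)) //= inordK ?ltnS ?leq_addr //.
  rewrite hx hy eqxx addKn eqxx big1 ?addr0 // => i.
  rewrite -val_eqE /= inordK ?ltnS ?leq_addr // => /negPf id.
  by rewrite hx id mul0r.
rewrite big1 // => i _; rewrite hx hy.
case: eqP => [id|_]; last by rewrite mul0r.
case: eqP => [ce|_]; last by rewrite mulr0.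
by have := ltn_ord i; rewrite id in ce * => ?; case: cde; lia.
Qed.

Lemma homogZ d c x : homog d x -> homog d (c *: x).
Proof. by move=> hx e; rewrite linearZ /= hx; case: ifP; rewrite ?scaler0. Qed.

Lemma homog_sum d I (r : seq I) (P : pred I) (F : I -> T) :
  (forall s, P s -> homog d (F s)) -> homog d (\sum_(s <- r | P s) F s).
Proof.
move=> h e; rewrite raddf_sum; case: ifP => ed.
  by apply: eq_bigr => i Pi; rewrite /= h // ed.
by rewrite big1 // => i Pi; rewrite /= h // ed.
Qed.

Lemma homog_t i j : homog 1 (t i j).
Proof.
move=> e; rewrite /t hcomp_pi /tser; case: insubP => [p _ _|_].
  by rewrite nchom_word eq_sym; case: ifP; rewrite ?raddf0.
by rewrite !raddf0; case: ifP.
Qed.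

Lemma homog1 : homog 0 1.
Proof.
move=> e; rewrite -(rmorph1 (@tpi K n)) hcomp_pi.
by rewrite [1 in LHS]/(1 : ncseries _ _) nchom_word eq_sym; case: ifP; rewrite ?raddf0.
Qed.

End TRelations.

Section CofaceMorphism.
Variables (K : fieldType) (n m : nat) (I : 'I_n -> {set 'I_m}).
Hypothesis disjI : forall i j : 'I_n, i != j -> [disjoint I i & I j].
Local Notation cogen := (@cogen K n m I).
Local Notation coser := (@coser K n m I).
Implicit Types (f g : ncseries K (tgen n)) (w : seq (tgen n)).

Lemma homog_prod w : homog (size w) (\prod_(p <- w) cogen p).
Proof.
elim: w => [|p w IHw]; first by rewrite big_nil; apply: homog1.
rewrite big_cons /= -(add1n (size w)); apply: (@homogM _ _ 1%N) => //.
by apply: homog_sum => a _; apply: homog_sum => b _; apply: homog_t.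
Qed.

Lemma hcomp_coser d f : hcomp d (coser f) =
  \sum_(w : d.-tuple (tgen n)) nccoef f w *: \prod_(p <- w) cogen p.
Proof.
have h k : homog k
    (\sum_(w : k.-tuple (tgen n)) nccoef f w *: \prod_(p <- w) cogen p).
  by apply: homog_sum => w _; apply: homogZ; rewrite -{1}(size_tuple w); apply: homog_prod.
rewrite hcomp_tsum big_ord_recr /= h eqxx big1 ?add0r // => k _.
by rewrite h gtn_eqF.
Qed.

Fact coser_is_linear : linear coser.
Proof.
move=> c f g; apply: hcompP => d; rewrite linearP /= !hcomp_coser.
rewrite scaler_sumr -big_split; apply: eq_bigr => w _ /=.
by rewrite scalerDl scalerA.
Qed.
HB.instance Definition _ :=
  GRing.isLinear.Build K (ncseries K (tgen n)) (That K m) *:%R coser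
    coser_is_linear.

Lemma coser_word w : coser (ncword K w) = \prod_(p <- w) cogen p.
Proof.
apply: hcompP => d; rewrite hcomp_coser homog_prod.
case: eqP => [->|dw].
  rewrite (bigD1 (in_tuple w)) //= eqxx scale1r [X in _ + X]big1 ?addr0 // => v.
  by rewrite -val_eqE /= => /negPf ->; rewrite scale0r.
rewrite big1 // => v _ /=; case: eqP => [vw|]; last by rewrite scale0r.
by case: dw; rewrite -vw size_tuple.
Qed.

Lemma coser_nchom d f : coser (nchom d f) = hcomp d (coser f).
Proof.
rewrite hcomp_coser nchom_sum_word linear_sum; apply: eq_bigr => w _.
by rewrite linearZ /= coser_word.
Qed.

Fact coser_is_monoid_morphism : monoid_morphism coser.
Proof.
split; first by rewrite [LHS]coser_word big_nil.
move=> f g; apply: hcompP => d; rewrite hcompM -coser_nchom nchomM raddf_sum.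
apply: eq_bigr => i _ /=; rewrite -!coser_nchom.
rewrite (nchom_sum_word i) (nchom_sum_word (d - i)) !linear_sum /= !mulr_suml.
rewrite linear_sum; apply: eq_bigr => u _ /=.
rewrite !mulr_sumr linear_sum; apply: eq_bigr => v _ /=.
rewrite -scalerAl -scalerAr !linearZ /= ncwordM !coser_word big_cat /=.
by rewrite -scalerAl -scalerAr.
Qed.
HB.instance Definition _ :=
  GRing.isMonoidMorphism.Build (ncseries K (tgen n)) (That K m) coser
    coser_is_monoid_morphism.

Lemma coser_tser i j : i != j ->
  coser (tser K i j) = \sum_(a in I i) \sum_(b in I j) t K a b.
Proof.
move=> ij; rewrite /tser; case: insubP => [p _ ep|]; last by rewrite /= ij.
by rewrite coser_word big_seq1 /cogen ep.
Qed.

Lemma memI i j a b : i != j -> a \in I i -> b \in I j -> a != b.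
Proof.
move=> /disjI; rewrite disjoint_subset => /fintype.subsetP h /h.
by rewrite inE => ai bj; apply: contraNneq ai => ->.
Qed.

Lemma coser_trelator r : trelator r -> coser r = 0.
Proof.
case=> {r} [i j ij | i j k u | i j k l u].
- rewrite raddfB /= !coser_tser // 1?eq_sym // exchange_big /=.
  apply/eqP; rewrite subr_eq0; apply/eqP.
  by apply: eq_bigr => a _; apply: eq_bigr => b _; apply: t_sym.
- have [ij ik jk] : [/\ i != j, i != k & j != k].
    by move: u; rewrite /= !inE negb_or andbT => /andP[/andP[]].
  rewrite raddfB /= !rmorphM raddfD /= !coser_tser //.
  apply/eqP; rewrite subr_eq0; apply/eqP; rewrite -big_split /=.
  apply: commr_sym; apply: commr_sum => a ai; apply: commr_sym.
  apply: commr_sum => b bj; apply: commr_sum => c ck; apply: commr_sym.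
  rewrite (bigD1 b) // [X in _ + X](bigD1 c) //= addrACA.
  have ab := memI ij ai bj; have ac := memI ik ai ck; have bc := memI jk bj ck.
  apply: commrD; last apply: commrD.
  + by apply/commr_sym/t_comm3; rewrite /= !inE negb_or ab ac bc.
  + apply: commr_sum => b' /andP[b'j b'b]; apply/commr_sym/t_comm4.
    rewrite /= !inE !negb_or ab ac bc (memI ij ai b'j) (memI jk b'j ck).
    by rewrite b'b.
  + apply: commr_sum => c' /andP[c'k c'c]; rewrite (t_sym K c b).
    apply/commr_sym/t_comm4.
    rewrite /= !inE !negb_or ab ac (memI ik ai c'k) (eq_sym c b) bc.
    by rewrite c'c eq_sym (memI jk bj c'k).
- have [ij ik il [jk jl kl]] : [/\ i != j, i != k, i != l
      & [/\ j != k, j != l & k != l]].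
    by move: u; rewrite /= !inE !negb_or andbT => /andP[/and3P[-> -> ->] /andP[/andP[-> ->] ->]].
  rewrite raddfB /= !rmorphM /= !coser_tser //.
  apply/eqP; rewrite subr_eq0; apply/eqP.
  apply: commr_sum => c ck; apply: commr_sum => d dl; apply: commr_sym.
  apply: commr_sum => a ai; apply: commr_sum => b bj; apply: commr_sym.
  apply: t_comm4; rewrite /= !inE !negb_or (memI ij ai bj) (memI ik ai ck).
  by rewrite (memI il ai dl) (memI jk bj ck) (memI jl bj dl) (memI kl ck dl).
Qed.

Lemma coser_tideal f : tideal f -> coser f = 0.
Proof.
elim=> [|c u r v g rr _ IH]; first by rewrite raddf0.
by rewrite linearP /= !rmorphM /= (coser_trelator rr) mulr0 mul0r scaler0 add0r.
Qed.

Lemma coser_tclosed f : f \in @tclosed K n -> coser f = 0.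
Proof.
move=> /asboolP If; apply: hcompP => d.
by rewrite raddf0 -coser_nchom coser_tideal.
Qed.

Lemma coface_pi f : coface I (tpi f) = coser f.
Proof.
apply/eqP; rewrite -subr_eq0 -(raddfB coser) /=.
by rewrite coser_tclosed // tpiK.
Qed.

Lemma coface_is_linear : linear (@coface K n m I).
Proof.
move=> c x y; rewrite -[x]treprK -[y]treprK -(linearP (@tpi K n)).
by rewrite !coface_pi linearP.
Qed.

Lemma coface_is_monoid_morphism : monoid_morphism (@coface K n m I).
Proof.
split=> [|x y]; first by rewrite -(rmorph1 (@tpi K n)) coface_pi rmorph1.
by rewrite -[x]treprK -[y]treprK -rmorphM !coface_pi rmorphM.
Qed.

Lemma coface_t i j : i != j ->
  coface I (t K i j) = \sum_(a in I i) \sum_(b in I j) t K a b.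
Proof. by move=> ij; rewrite coface_pi coser_tser. Qed.

Lemma hcomp_coface d (x : That K n) : hcomp d (coface I x) = coface I (hcomp d x).
Proof. by rewrite -[x]treprK hcomp_pi !coface_pi coser_nchom. Qed.

End CofaceMorphism.

(* blocks [:: I_1; ...; I_n] lists subsets of {1, ..., m}: labels are 1-based *)
(* here, whereas 'I_m is 0-based. E.g. x ^[ [:: 1; 2], [:: 3] ] is x^{12,3}.  *)
Definition blocks (n m : nat) (s : seq (seq nat)) : 'I_n -> {set 'I_m} :=
  fun i => [set a | (val a).+1 \in nth [::] s i].

Notation "x ^[ I1 , .. , In ]" :=
  (coface (blocks _ (cons I1%N .. (cons In%N nil) ..)) x)
  (at level 1, format "x ^[ I1 ,  .. ,  In ]") : ring_scope.

(* t^{a,b} with 1-based labels 1 <= a, b <= n + 1 *)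
Definition tij (K : fieldType) (n a b : nat) : That K n.+1 :=
  t K (inord a.-1) (inord b.-1).

Section Associators.
Variable K : fieldType.
Implicit Types (Phi Psi : That K 3) (F : That K 2).
Local Notation t12 := (tij K 2 1 2).
Local Notation t13 := (tij K 2 1 3).
Local Notation t23 := (tij K 2 2 3).

Definition pentagon Phi : Prop :=
  Phi ^[[:: 1], [:: 2], [:: 3; 4]] * Phi ^[[:: 1; 2], [:: 3], [:: 4]]
  = Phi ^[[:: 2], [:: 3], [:: 4]] * Phi ^[[:: 1], [:: 2; 3], [:: 4]]
    * Phi ^[[:: 1], [:: 2], [:: 3]] :> That K 4.

Definition hexagon1 Phi : Prop :=
  texp (2^-1 *: (t13 + t23))
  = Phi ^[[:: 3], [:: 1], [:: 2]] * texp (2^-1 *: t13)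
    * (Phi ^[[:: 1], [:: 3], [:: 2]])^-1 * texp (2^-1 *: t23)
    * Phi ^[[:: 1], [:: 2], [:: 3]].

Definition hexagon2 Phi : Prop :=
  texp (2^-1 *: (t12 + t13))
  = (Phi ^[[:: 2], [:: 3], [:: 1]])^-1 * texp (2^-1 *: t13)
    * Phi ^[[:: 2], [:: 1], [:: 3]] * texp (2^-1 *: t12)
    * (Phi ^[[:: 1], [:: 2], [:: 3]])^-1.

Definition duality Phi : Prop := Phi ^[[:: 3], [:: 2], [:: 1]] = Phi^-1.

Definition Alt Phi : That K 3 :=
  6^-1 *: \sum_(s : 'S_3) (-1) ^+ s *: coface (fun i => [set s i]) Phi.

Definition Pent : set (That K 3) := [set Phi | one_plus Phi /\ pentagon Phi].

(* c is the coefficient of [t12, t23] prescribed in Alt Phi. *)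
Definition associators (c : K) : set (That K 3) :=
  [set Phi | [/\ one_plus Phi, pentagon Phi, hexagon1 Phi, hexagon2 Phi &
    forall d, (d <= 2)%N ->
      hcomp d (Alt Phi) = hcomp d (c *: (t12 * t23 - t23 * t12))]].

Definition Assoc := associators 8^-1.

(* With Alt normalised by 1/6, the degree 2 part of the hexagons forces       *)
(* Alt Phi = 1/24 [t12, t23] + ..., so that Assoc is in fact empty;           *)
(* Assoc_norm is the nonempty set that the hexagons lead to.                  *)
Definition Assoc_norm := associators 24^-1.

Definition dual (X : set (That K 3)) : set (That K 3) :=
  [set Phi | X Phi /\ duality Phi].
Definition Assoc0 := dual Assoc.
Definition Assoc0_norm := dual Assoc_norm.

Definition logLie (X : set (That K 3)) : set (That K 3) :=
  [set Phi | X Phi /\ lie_hat (tlog Phi)].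
Definition Pent_Lie := logLie Pent.
Definition Assoc_Lie := logLie Assoc.
Definition Assoc0_Lie := logLie Assoc0.
Definition Assoc_norm_Lie := logLie Assoc_norm.
Definition Assoc0_norm_Lie := logLie Assoc0_norm.

Definition twist F Phi : That K 3 :=
  F ^[[:: 2], [:: 3]] * F ^[[:: 1], [:: 2; 3]] * Phi
  * (F ^[[:: 1], [:: 2]] * F ^[[:: 1; 2], [:: 3]])^-1.

Definition twist_orbit Phi : set (That K 3) :=
  [set twist F Phi | F in @one_plus K 2].

Definition isotropy Phi : set (That K 2) :=
  [set F | one_plus F /\ twist F Phi = Phi].

End Associators.

(* Main.v *)
(* An element Phi of T_3 is evaluated at a triple (a, b, c) of elements of an  *)
(* arbitrary algebra B satisfying the relations of (t12, t13, t23); this gives *)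
(* a power series P(a, b, c) over B, whose variable h keeps track of degrees.  *)
(*                                                                             *)
(* On commuting triples, the pentagon makes P(0, q, r) a 2-cocycle of the      *)
(* formal additive group. In characteristic 0 it is the coboundary of a power  *)
(* series f, and the twist by F = f(t12) achieves P(0, q, r) = 1. For a        *)
(* pentagon solution normalised in this way, consider triples (a, b, c) and    *)
(* (a', b', c') commuting with each other: the pentagon evaluated at           *)
(*   (t12, t13, t14, t23, t24, t34) = (0, a', b', a, b, c + c')                *)
(* reads                                                                       *)
(*   P(a + a', b + b', c + c') = P(a, b, c + c') P(a', b', b + c + c'),        *)
(* and its instances at (0, t, 0) allow to drop the extra c' and b + c. So Phi *)
(* is group-like, and the Dynkin operator shows that log Phi is Lie.           *)
(*                                                                             *)
(* Conversely a group-like pentagon solution takes the value 1 at (1, 1, 0).   *)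
(* If a twist by f(t12) fixes the value at (1, 1, 0), then f(h)^2 = f(2h), so  *)
(* f is an exponential; as t12 + t13 + t23 is central, the twist is trivial.   *)

Require Import Defs.
From HB Require Import structures.
From mathcomp Require Import all_boot all_order all_algebra all_fingroup.
From mathcomp Require Import boolp classical_sets.
From mathcomp Require Import zify.

Set Implicit Arguments.
Unset Strict Implicit.
Unset Printing Implicit Defensive.

Import GRing.Theory.
Local Open Scope ring_scope.

(** * Power series over an algebra *)

(** The coproduct of $\widehat{\mathcal T}_n$ is replaced by representations in arbitrary algebras:
    the sum of two commuting representations plays its part, so that group-like means [Ev (rep_add
    rho rho') x = Ev rho x * Ev rho' x]. By [lie_grouplike] and [grouplike_lie] this amounts to
    $\log x$ being Lie.

    Existence. Let $P(a,b,c)$ be the value of a pentagon solution at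
    $(t^{1,2},t^{1,3},t^{2,3})=(a,b,c)$. At commuting arguments $P(0,q,r)$ is a 2-cocycle
    ([Ev_rep3_cocycle]). Its part linear in $q$ prescribes the logarithmic derivative of a series
    $f$, and the twist by $f(t^{1,2})$ makes $P(0,q,r)=1$ ([univ_eq1], [exists_normalized]). The
    pentagon at two interleaved commuting triples then says that the solution is group-like
    ([grouplike_of_split]).

    Uniqueness and isotropy. Every twist is by some $f(t^{1,2})$ ([T2_pev]). Two Lie solutions share
    the value 1 at $(1,1,0)$ ([lie_value]), and a solution fixed by a twist keeps its value there;
    either way $f(h)^2=f(2h)$, so $f$ is an exponential ([twisted_exp]). Then both twist factors
    equal $e^{\lambda(t^{1,2}+t^{1,3}+t^{2,3})}$, which is central, and the twist is trivial
    ([twisted_texp]).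

    Associators. Twists preserve the pentagon, the hexagons, duality and the low-degree part of
    [Alt] ([twisted_pentagon], [twisted_hexagon1], [twisted_hexagon2], [twisted_duality],
    [twisted_Alt]), so [unique_lie_in_orbit] applies to each class of solutions. *)

Record pser (B : nzRingType) := Pser { pco :> nat -> B }.

HB.instance Definition _ (B : nzRingType) := gen_eqMixin (pser B).
HB.instance Definition _ (B : nzRingType) := gen_choiceMixin (pser B).

Section PowerSeries.
Variable B : nzRingType.
Implicit Types u v w : pser B.

Lemma pserP u v : u =1 v -> u = v.
Proof. by case: u v => [u] [v] /= /funext ->. Qed.

Definition ps_zero : pser B := Pser (fun=> 0).
Definition ps_one : pser B := Pser (fun d => (d == 0%N)%:R).
Definition ps_opp u : pser B := Pser (fun d => - u d).
Definition ps_add u v : pser B := Pser (fun d => u d + v d).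
Definition ps_mul u v : pser B :=
  Pser (fun d => \sum_(i < d.+1) u i * v (d - i)%N).
Definition ps_shift u : pser B := Pser (fun d => u d.+1).

Fact ps_addA : associative ps_add.
Proof. by move=> u v w; apply: pserP => d /=; rewrite addrA. Qed.
Fact ps_addC : commutative ps_add.
Proof. by move=> u v; apply: pserP => d /=; rewrite addrC. Qed.
Fact ps_add0 : left_id ps_zero ps_add.
Proof. by move=> u; apply: pserP => d /=; rewrite add0r. Qed.
Fact ps_addN : left_inverse ps_zero ps_opp ps_add.
Proof. by move=> u; apply: pserP => d /=; rewrite addNr. Qed.
HB.instance Definition _ :=
  GRing.isZmodule.Build (pser B) ps_addA ps_addC ps_add0 ps_addN.

Lemma ps_mul0 u v : ps_mul u v 0 = u 0 * v 0.
Proof. by rewrite /= big_ord_recl big_ord0 addr0. Qed.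

Lemma ps_mulS u v d :
  ps_mul u v d.+1 = u 0 * v d.+1 + ps_mul (ps_shift u) v d.
Proof. by rewrite /= big_ord_recl. Qed.

Fact ps_mulDl : left_distributive ps_mul +%R.
Proof.
move=> u v w; apply: pserP => d /=; rewrite -big_split /=.
by apply: eq_bigr => i _; rewrite mulrDl.
Qed.
Fact ps_mulDr : right_distributive ps_mul +%R.
Proof.
move=> u v w; apply: pserP => d /=; rewrite -big_split /=.
by apply: eq_bigr => i _; rewrite mulrDr.
Qed.
Fact ps_mulA : associative ps_mul.
Proof.
move=> u v w; apply: pserP => d.
elim: d u => [|d IHd] u; first by rewrite !ps_mul0 mulrA.
rewrite !ps_mulS {}IHd ps_mul0 mulrDr mulrA -!addrA; congr (_ + _).
have -> : ps_shift (ps_mul u v) =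
    Pser (fun e => u 0 * v e.+1) + ps_mul (ps_shift u) v.
  by apply: pserP => e; rewrite [LHS]ps_mulS.
rewrite ps_mulDl /=; congr (_ + _); rewrite mulr_sumr.
by apply: eq_bigr => i _; rewrite mulrA.
Qed.
Fact ps_mul1 : left_id ps_one ps_mul.
Proof.
move=> u; apply: pserP => -[|d]; first by rewrite ps_mul0 mul1r.
rewrite ps_mulS /= mul1r big1 ?addr0 // => i _.
by rewrite mul0r.
Qed.
Fact ps_mulr1 : right_id ps_one ps_mul.
Proof.
move=> u; apply: pserP => d; elim: d u => [|d IHd] u.
  by rewrite ps_mul0 mulr1.
by rewrite ps_mulS IHd mulr0 add0r.
Qed.
Fact ps_one_neq0 : ps_one != 0.
Proof.
apply/eqP => /(congr1 (fun u : pser B => u 0)) /eqP.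
by rewrite /= oner_eq0.
Qed.
HB.instance Definition _ := GRing.Zmodule_isNzRing.Build (pser B)
  ps_mulA ps_mul1 ps_mulr1 ps_mulDl ps_mulDr ps_one_neq0.

Lemma pcoD u v d : (u + v) d = u d + v d. Proof. by []. Qed.
Lemma pcoN u d : (- u) d = - u d. Proof. by []. Qed.
Lemma pco1 d : (1 : pser B) d = (d == 0%N)%:R. Proof. by []. Qed.
Lemma pcoM u v d : (u * v) d = \sum_(i < d.+1) u i * v (d - i)%N.
Proof. by []. Qed.
Lemma pco_sum I (r : seq I) (P : pred I) (F : I -> pser B) d :
  (\sum_(i <- r | P i) F i) d = \sum_(i <- r | P i) F i d.
Proof. by elim/big_rec2: _ => // i y1 y2 _ <-. Qed.

Lemma pser_comm u v : (forall i j, GRing.comm (u i) (v j)) -> GRing.comm u v.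
Proof.
move=> c; apply: pserP => d; rewrite !pcoM (reindex_inj rev_ord_inj) /=.
apply: eq_bigr => i _; rewrite subSS subKn -1?ltnS //; exact: c.
Qed.

Lemma pser_regl u v w : u 0 = 1 -> u * v = u * w -> v = w.
Proof.
move=> u0 e; apply: pserP => d; elim/ltn_ind: d => d IHd.
have /(congr1 (fun x : pser B => x d)) := e.
rewrite !pcoM !big_ord_recl /= u0 !mul1r subn0.
rewrite (eq_bigr (fun i : 'I_d => u (lift ord0 i) * w (d - lift ord0 i)%N)).
  by move/addIr.
move=> i _; congr (_ * _); apply: IHd; rewrite /= /bump /=.
by have := ltn_ord i; lia.
Qed.

Lemma pser_expr_lt u d k : u 0 = 0 -> (d < k)%N -> (u ^+ k) d = 0.
Proof.
move=> u0; elim: k d => // k IHk d dk; rewrite exprS pcoM big_ord_recl u0 mul0r.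
rewrite add0r big1 // => i _; rewrite IHk ?mulr0 //= /bump /=.
by have := ltn_ord i; lia.
Qed.

End PowerSeries.

Section Exponential.
Variables (K : fieldType) (B : algType K).
Implicit Types u v w : pser B.

(** Stopping at [k = d] is exact for series without constant term, where [u ^+ k] starts in degree
    [k]. *)
Definition pexp u : pser B :=
  Pser (fun d => \sum_(k < d.+1) (k`!%:R : K)^-1 *: (u ^+ k) d).

Lemma pexp_widen u d N : u 0 = 0 -> (d <= N)%N ->
  pexp u d = \sum_(k < N.+1) (k`!%:R : K)^-1 *: (u ^+ k) d.
Proof.
move=> u0 dN; rewrite /= (big_ord_widen N.+1 (fun k => (k`!%:R : K)^-1 *: (u ^+ k) d)) //.
rewrite big_mkcond; apply: eq_bigr => k _; case: ifP => // /negbT.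
by rewrite ltnS -ltnNge => dk; rewrite pser_expr_lt // scaler0.
Qed.

Lemma pcoMn u k d : (u *+ k) d = u d *+ k.
Proof. by elim: k => // k IHk; rewrite !mulrS pcoD IHk. Qed.

Lemma triangle_sum (V : nmodType) (a : nat -> nat -> V) N :
  \sum_(k < N) \sum_(i < k.+1) a i (k - i)%N = \sum_(i < N) \sum_(j < N - i) a i j.
Proof.
elim: N => [|N IHN]; first by rewrite !big_ord0.
rewrite big_ord_recr IHN [RHS]big_ord_recr /= subSnn big_ord1 [X in _ + X]big_ord_recr /=.
rewrite subnn addrA -big_split; congr (_ + _); apply: eq_bigr => i _ /=.
by rewrite subSn ?big_ord_recr // ltnW.
Qed.

Lemma pexpD u v : [pchar K] =i pred0 -> u 0 = 0 -> v 0 = 0 ->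
  GRing.comm u v -> pexp (u + v) = pexp u * pexp v.
Proof.
move=> /pcharf0P char0 u0 v0 cuv; apply: pserP => d.
have fact_neq0 k : (k`!%:R : K) != 0 by rewrite char0 -lt0n fact_gt0.
pose a i j := ((i`!%:R : K)^-1 * (j`!%:R)^-1) *: (u ^+ i * v ^+ j) d.
have a0 i j : (d < i + j)%N -> a i j = 0.
  move=> dij; rewrite /a pcoM big1 ?scaler0 // => e _.
  have [ei|] := ltnP e i; first by rewrite pser_expr_lt ?mul0r.
  by move=> ie; rewrite (@pser_expr_lt _ v) ?mulr0 //; have := ltn_ord e; lia.
(* Both sides are compared with the full square of the [a i j]: the product gives it by
   distributivity, while the binomial formula gives the triangle [i + j <= d], outside which [a0]
   applies. *)
transitivity (\sum_(i < d.+1) \sum_(j < d.+1) a i j); last first.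
  rewrite pcoM; under [RHS]eq_bigr => e _.
    rewrite (pexp_widen u0 (ltnSE (ltn_ord e))).
    rewrite (pexp_widen v0 (leq_subr e d)).
    rewrite mulr_suml; under eq_bigr do rewrite mulr_sumr.
    over.
  rewrite [RHS]exchange_big; apply: eq_bigr => i _.
  rewrite [RHS]exchange_big; apply: eq_bigr => j _.
  rewrite /a pcoM scaler_sumr; apply: eq_bigr => e _.
  by rewrite -scalerAl -scalerAr scalerA.
transitivity (\sum_(k < d.+1) \sum_(i < k.+1) a i (k - i)%N).
  apply: eq_bigr => k _; rewrite (exprDn_comm k cuv).
  rewrite pco_sum scaler_sumr (reindex_inj rev_ord_inj) /=.
  apply: eq_bigr => i _; have ik : (i <= k)%N by rewrite -ltnS.
  rewrite subSS subKn // pcoMn -scaler_nat scalerA; congr (_ *: _).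
  rewrite bin_sub // -(bin_fact ik) !natrM !invfM.
  by rewrite mulrAC mulVf ?char0 -?lt0n ?bin_gt0 ?mul1r.
rewrite (triangle_sum a); apply: eq_bigr => i _.
rewrite (big_ord_widen d.+1 (fun j => a i j)) ?leq_subr // [LHS]big_mkcond.
apply: eq_bigr => j _; case: ifP => // /negbT.
by rewrite -leqNgt => dk; rewrite a0 //; have := ltn_ord i; lia.
Qed.

End Exponential.

(** * Evaluation of completed Drinfeld--Kohno algebras at representations *)

Section Evaluation.
Variables (K : fieldType) (n : nat) (B : algType K).
Local Notation S := (ncseries K (tgen n)).
Local Notation T := (That K n).
Implicit Types (f g : S) (x y : T) (rho : 'I_n -> 'I_n -> B) (a b : B).

(** Such a [rho] amounts to an algebra morphism $\mathcal T_n\to B$. *)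
Definition trep rho : Prop :=
  [/\ forall i j, i != j -> rho j i = rho i j,
      forall i j k, uniq [:: i; j; k] -> GRing.comm (rho i j + rho i k) (rho j k) &
      forall i j k l, uniq [:: i; j; k; l] -> GRing.comm (rho i j) (rho k l)].

Definition pmon a : pser B := Pser (fun d => if d == 1%N then a else 0).

Lemma pmonD a b : pmon (a + b) = pmon a + pmon b.
Proof. by apply: pserP => d /=; case: ifP; rewrite ?addr0. Qed.

Lemma pmon_comm a b : GRing.comm a b -> GRing.comm (pmon a) (pmon b).
Proof.
by move=> c; apply: pser_comm => i j /=; do 2 case: ifP => // _;
  rewrite /GRing.comm ?(mul0r, mulr0).
Qed.

Definition wval rho (w : seq (tgen n)) : B :=
  \prod_(p <- w) rho (val p).1 (val p).2.

Definition evcoef rho d f : B :=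
  \sum_(w : d.-tuple (tgen n)) nccoef f w *: wval rho w.

Definition evser rho f : pser B := Pser (fun d => evcoef rho d f).

(* The coefficient of degree d is the value of the degree d component of x. *)
Definition Ev rho x : pser B := evser rho (trepr x).

Section Rho.
Variable rho : 'I_n -> 'I_n -> B.

Fact evcoef_is_linear d : linear (evcoef rho d).
Proof.
move=> c f g; rewrite scaler_sumr -big_split; apply: eq_bigr => w _ /=.
by rewrite scalerDl scalerA.
Qed.
HB.instance Definition _ d :=
  GRing.isLinear.Build K S B *:%R (evcoef rho d) (evcoef_is_linear d).

Lemma evser_sum d I (r : seq I) (P : pred I) (F : I -> S) :
  evser rho (\sum_(i <- r | P i) F i) d = \sum_(i <- r | P i) evser rho (F i) d.
Proof. exact: (raddf_sum (evcoef rho d)). Qed.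

Lemma evserZ d c f : evser rho (c *: f) d = c *: evser rho f d.
Proof. by rewrite /= linearZ. Qed.

Lemma evserD f g : evser rho (f + g) = evser rho f + evser rho g.
Proof. by apply: pserP => d; apply: (raddfD (evcoef rho d)). Qed.

Lemma evserB f g : evser rho (f - g) = evser rho f - evser rho g.
Proof. by apply: pserP => d; apply: (raddfB (evcoef rho d)). Qed.

Lemma evser_word w d :
  evser rho (ncword K w) d = if size w == d then wval rho w else 0.
Proof.
rewrite /= /evcoef; case: eqP => [<-|wd].
  rewrite (bigD1 (in_tuple w)) //= eqxx scale1r big1 ?addr0 // => v.
  by rewrite -val_eqE /= => /negPf ->; rewrite scale0r.
rewrite big1 // => v _ /=; case: eqP => [vw|]; last by rewrite scale0r.
by case: wd; rewrite -vw size_tuple.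
Qed.

Lemma evser_nchom d e f :
  evser rho (nchom e f) d = if d == e then evser rho f d else 0.
Proof.
rewrite /= /evcoef; case: eqP => [<-|de].
  by apply: eq_bigr => w _; rewrite nccoef_hom size_tuple eqxx.
rewrite big1 // => w _; rewrite nccoef_hom size_tuple.
by move/eqP/negPf: de => ->; rewrite scale0r.
Qed.

Lemma evserM f g : evser rho (f * g) = evser rho f * evser rho g.
Proof.
apply: pserP => d; rewrite pcoM.
transitivity (evser rho (nchom d (f * g)) d); first by rewrite evser_nchom eqxx.
rewrite nchomM evser_sum; apply: eq_bigr => i _.
have id : (i + (d - i) = d)%N by rewrite subnKC // -ltnS.
rewrite (nchom_sum_word i) (nchom_sum_word (d - i)) mulr_suml evser_sum.
rewrite [RHS]mulr_suml; apply: eq_bigr => u _.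
rewrite [RHS]mulr_sumr mulr_sumr evser_sum; apply: eq_bigr => v _.
rewrite -scalerAl -scalerAr !evserZ ncwordM evser_word size_cat !size_tuple id.
by rewrite eqxx /wval big_cat -scalerAl -scalerAr.
Qed.

Lemma evser1 : evser rho 1 = 1.
Proof.
by apply: pserP => d; rewrite evser_word /wval big_nil /= eq_sym; case: eqP.
Qed.

Lemma evser_tser i j : i != j -> evser rho (tser K i j) = pmon (rho i j).
Proof.
move=> ij; apply: pserP => d; rewrite /tser; case: insubP => [p _ ep|]; last by rewrite ij.
by rewrite evser_word /wval big_seq1 ep /= eq_sym.
Qed.

Hypothesis rhoP : trep rho.

Lemma evser_trelator r : trelator r -> evser rho r = 0.
Proof.
case: rhoP => r2 r3 r4; case=> {r} [i j ij | i j k u | i j k l u].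
- by rewrite evserB !evser_tser // 1?eq_sym // r2 ?subrr // eq_sym.
- have [ij ik jk] : [/\ i != j, i != k & j != k].
    by move: u; rewrite /= !inE negb_or andbT => /andP[/andP[]].
  rewrite evserB !evserM !evserD !evser_tser // -pmonD.
  by rewrite (pmon_comm (r3 _ _ _ u)) subrr.
- have [ij kl] : i != j /\ k != l.
    by move: u; rewrite /= !inE !negb_or andbT => /andP[/and3P[-> _ _] /andP[_ ->]].
  by rewrite evserB !evserM !evser_tser // (pmon_comm (r4 _ _ _ _ u)) subrr.
Qed.

(** Relators evaluate to 0, hence so does the ideal they generate, degree by degree. This makes [Ev]
    independent of the representative picked by [trepr]. *)
Lemma evser_tclosed f : f \in @tclosed K n -> evser rho f = 0.
Proof.
move=> /asboolP If; apply: pserP => d.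
transitivity (evser rho (nchom d f) d); first by rewrite evser_nchom eqxx.
elim: (If d) => [|c u r v g rr _ IH]; first exact: (raddf0 (evcoef rho d)).
rewrite evserD pcoD IH addr0 evserZ !evserM (evser_trelator rr).
by rewrite mulr0 mul0r scaler0.
Qed.

Lemma Ev_pi f : Ev rho (tpi f) = evser rho f.
Proof.
by apply/eqP; rewrite -subr_eq0 -evserB evser_tclosed // tpiK.
Qed.

Lemma EvD x y : Ev rho (x + y) = Ev rho x + Ev rho y.
Proof. by rewrite -[x]treprK -[y]treprK -raddfD !Ev_pi evserD. Qed.

Lemma EvB x y : Ev rho (x - y) = Ev rho x - Ev rho y.
Proof. by rewrite -[x]treprK -[y]treprK -raddfB !Ev_pi evserB. Qed.

Lemma EvM x y : Ev rho (x * y) = Ev rho x * Ev rho y.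
Proof. by rewrite -[x]treprK -[y]treprK -rmorphM !Ev_pi evserM. Qed.

Lemma Ev1 : Ev rho 1 = 1.
Proof. by rewrite -(rmorph1 (@tpi K n)) Ev_pi evser1. Qed.

Lemma Ev0 : Ev rho 0 = 0.
Proof. by rewrite -(subrr 0) EvB subrr. Qed.

Lemma EvX x k : Ev rho (x ^+ k) = Ev rho x ^+ k.
Proof. by elim: k => [|k IHk]; rewrite ?Ev1 // !exprS EvM IHk. Qed.

Lemma EvZ c x d : Ev rho (c *: x) d = c *: Ev rho x d.
Proof. by rewrite -[x]treprK -linearZ !Ev_pi evserZ. Qed.

Lemma Ev_sum I (r : seq I) (P : pred I) (F : I -> T) :
  Ev rho (\sum_(i <- r | P i) F i) = \sum_(i <- r | P i) Ev rho (F i).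
Proof. by elim/big_rec2: _ => [|i y1 y2 _ <-]; rewrite ?Ev0 ?EvD. Qed.

Lemma Ev_t i j : i != j -> Ev rho (t K i j) = pmon (rho i j).
Proof. by move=> ij; rewrite Ev_pi evser_tser. Qed.

Lemma Ev_hcomp e x d : Ev rho (hcomp e x) d = if d == e then Ev rho x d else 0.
Proof. by rewrite -[x]treprK hcomp_pi !Ev_pi evser_nchom. Qed.

Lemma Ev_const x : Ev rho x 0 = (aug x)%:A.
Proof.
rewrite -[x]treprK Ev_pi aug_pi /= /evcoef (bigD1 [tuple]) //= /wval big_nil big1 ?addr0 //.
by move=> w; rewrite (tuple0 w) => /negP[]; apply: eqxx.
Qed.

Lemma Ev_tsum u d : Ev rho (tsum u) d = \sum_(k < d.+1) Ev rho (u k) d.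
Proof.
transitivity (Ev rho (hcomp d (tsum u)) d); first by rewrite Ev_hcomp eqxx.
rewrite hcomp_tsum Ev_sum pco_sum; apply: eq_bigr => k _.
by rewrite Ev_hcomp eqxx.
Qed.

Lemma Ev_texp x : Ev rho (texp x) = pexp (Ev rho x).
Proof.
apply: pserP => d; rewrite Ev_tsum; apply: eq_bigr => k _.
by rewrite EvZ EvX.
Qed.

End Rho.

Lemma Ev_ext rho rho' x : (forall i j, i != j -> rho i j = rho' i j) ->
  Ev rho x = Ev rho' x.
Proof.
move=> e; apply: pserP => d; apply: eq_bigr => w _; congr (_ *: _).
by apply: eq_bigr => p _; apply: e (valP p).
Qed.

Lemma comm_scalel c a b : GRing.comm a b -> GRing.comm (c *: a) b.
Proof. by move=> h; rewrite /GRing.comm -scalerAl -scalerAr h. Qed.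

Definition comm_reps rho rho' := forall i j k l, i != j -> k != l ->
  GRing.comm (rho i j) (rho' k l).

Lemma comm_repsC rho rho' : comm_reps rho rho' -> comm_reps rho' rho.
Proof. by move=> c i j k l ij kl; apply/commr_sym/c. Qed.

(** For commuting [rho] and [rho'] this is the coproduct $t\mapsto t\otimes1+1\otimes t$ followed by
    [rho] and [rho'] on the two factors and by multiplication in [B]. *)
Definition rep_add rho rho' i j := rho i j + rho' i j.

Lemma Ev_comm rho rho' x y : comm_reps rho rho' -> GRing.comm (Ev rho x) (Ev rho' y).
Proof.
move=> c; apply: pser_comm => d e /=.
apply: commr_sum => v _; apply: commr_sym; apply: commr_sum => w _.
apply/comm_scalel/commr_sym/comm_scalel.
apply: commr_prod => p _; apply/commr_sym/commr_prod => q _.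
apply/commr_sym; exact: c (valP q) (valP p).
Qed.

Lemma trep_add rho rho' : trep rho -> trep rho' -> comm_reps rho rho' ->
  trep (rep_add rho rho').
Proof.
move=> [r2 r3 r4] [s2 s3 s4] c; split=> [i j ij|i j k u|i j k l u].
- by rewrite /rep_add (r2 _ _ ij) (s2 _ _ ij).
- have [ij ik jk] : [/\ i != j, i != k & j != k].
    by move: u; rewrite /= !inE negb_or andbT => /andP[/andP[]].
  rewrite /rep_add addrACA; apply: commrD; apply/commr_sym; apply: commrD.
  + exact/commr_sym/r3.
  + by apply: commrD; apply: c.
  + by apply: commrD; apply/commr_sym; apply: c.
  + exact/commr_sym/s3.
- have [ij kl] : i != j /\ k != l.
    by move: u; rewrite /= !inE !negb_or andbT => /andP[/and3P[-> _ _] /andP[_ ->]].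
  apply: commrD; apply/commr_sym; apply: commrD.
  + exact/commr_sym/r4.
  + exact: c.
  + exact/commr_sym/c.
  + exact/commr_sym/s4.
Qed.

End Evaluation.

Lemma pmon_commP (K : fieldType) (B : algType K) (a b : B) :
  GRing.comm (pmon a) (pmon b) -> GRing.comm a b.
Proof.
move=> /(congr1 (fun u : pser B => u 2)); rewrite !pcoM !big_ord_recl !big_ord0 /=.
by rewrite /bump /= !(mul0r, mulr0, add0r, addr0).
Qed.

Lemma pmon_prod (K : fieldType) (B : algType K) (I : Type) (w : seq I) (F : I -> B) d :
  (\prod_(p <- w) pmon (F p)) d = if size w == d then \prod_(p <- w) F p else 0.
Proof.
elim: w d => [|p w IHw] d; first by rewrite !big_nil pco1 eq_sym; case: eqP.
rewrite !big_cons pcoM; case: d => [|d].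
  by rewrite big_ord_recl big_ord0 /= mul0r addr0.
rewrite 2!big_ord_recl /= mul0r add0r subSS subn0 IHw eqSS [X in _ + X]big1.
  by rewrite addr0; case: ifP; rewrite ?mulr0.
by move=> i _; rewrite mul0r.
Qed.

Lemma pmonX (K : fieldType) (B : algType K) (a : B) k d :
  (pmon a ^+ k) d = if k == d then a ^+ k else 0.
Proof.
have := pmon_prod (nseq k tt) (fun=> a) d.
by rewrite size_nseq !big_nseq !iter_mulr_1.
Qed.

Section CofaceTheory.
Variables (K : fieldType) (n m : nat) (I : 'I_n -> {set 'I_m}).
Hypothesis disjI : forall i j : 'I_n, i != j -> [disjoint I i & I j].
Implicit Types x y : That K n.

Lemma coface1 : coface I (1 : That K n) = 1.
Proof. exact: (coface_is_monoid_morphism K disjI).1. Qed.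

Lemma cofaceM x y : coface I (x * y) = coface I x * coface I y.
Proof. exact: (coface_is_monoid_morphism K disjI).2. Qed.

Lemma cofaceD x y : coface I (x + y) = coface I x + coface I y.
Proof. by rewrite -[x in LHS]scale1r coface_is_linear // scale1r. Qed.

Lemma coface0 : coface I (0 : That K n) = 0.
Proof. by apply: (addrI (coface I (0 : That K n))); rewrite -cofaceD !addr0. Qed.

Lemma cofaceZ c x : coface I (c *: x) = c *: coface I x.
Proof. by rewrite -[c *: x]addr0 coface_is_linear // coface0 addr0. Qed.

Lemma cofaceX x k : coface I (x ^+ k) = coface I x ^+ k.
Proof. by elim: k => [|k IHk]; rewrite ?coface1 // !exprS cofaceM IHk. Qed.

End CofaceTheory.

(** * Representations pulled back along coface maps *)

Section Pull.
Variables (K : fieldType) (B : algType K).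

Definition pull n m (I : 'I_n -> {set 'I_m}) (rho : 'I_m -> 'I_m -> B) i j :=
  \sum_(a in I i) \sum_(b in I j) rho a b.

Lemma trep_comm n (rho : 'I_n -> 'I_n -> B) :
  (forall i j, i != j -> rho j i = rho i j) ->
  (forall i j k l, GRing.comm (rho i j) (rho k l)) -> trep rho.
Proof.
move=> s c; split=> // i j k _.
by apply/commr_sym/commrD; apply: c.
Qed.

Variables (n m : nat) (I : 'I_n -> {set 'I_m}) (rho : 'I_m -> 'I_m -> B).
Hypothesis disjI : forall i j : 'I_n, i != j -> [disjoint I i & I j].
Hypothesis rhoP : trep rho.

Lemma Ev_sum_t i j : i != j ->
  Ev rho (\sum_(a in I i) \sum_(b in I j) t K a b) = pmon (pull I rho i j).
Proof.
move=> ij; rewrite Ev_sum //; apply: pserP => d; rewrite pco_sum.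
transitivity (\sum_(a in I i) \sum_(b in I j) (if d == 1%N then rho a b else 0)).
  apply: eq_bigr => a ai; rewrite Ev_sum // pco_sum; apply: eq_bigr => b bj.
  by rewrite Ev_t // (memI disjI ij ai bj).
by rewrite /=; case: ifP => _ //; rewrite big1 // => a _; rewrite big1.
Qed.

Lemma Ev_coface x : Ev rho (coface I x) = Ev (pull I rho) x.
Proof.
apply: pserP => d.
transitivity (Ev rho (hcomp d (coface I x)) d); first by rewrite Ev_hcomp ?eqxx.
rewrite hcomp_coser Ev_sum // pco_sum; apply: eq_bigr => w _.
rewrite EvZ //; congr (_ *: _).
have -> : Ev rho (\prod_(p <- w) cogen K I p) =
    \prod_(p <- w) pmon (pull I rho (val p).1 (val p).2).
  elim: (tval w) => [|p v IHv]; first by rewrite !big_nil Ev1.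
  by rewrite !big_cons EvM // IHv Ev_sum_t //; apply: (valP p).
by rewrite pmon_prod size_tuple eqxx.
Qed.

(** The commutation relations are not expanded: they hold in [That K n], are carried along by
    [coface] and [Ev], and are read off in degree 2 by [pmon_commP]. *)
Lemma trep_pull : trep (pull I rho).
Proof.
have [r2 _ _] := rhoP.
have cofc x y : GRing.comm x y -> GRing.comm (Ev rho (coface I x)) (Ev rho (coface I y)).
  by move=> c; rewrite /GRing.comm -!EvM // -!cofaceM // c.
split=> [i j ij|i j k u|i j k l u].
- rewrite /pull exchange_big /=; apply: eq_bigr => a ai; apply: eq_bigr => b bj.
  by rewrite r2 // (memI disjI ij ai bj).
- have [ij ik jk] : [/\ i != j, i != k & j != k].
    by move: u; rewrite /= !inE negb_or andbT => /andP[/andP[]].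
  have := cofc _ _ (t_comm3 K u); rewrite cofaceD // EvD // !coface_t // !Ev_sum_t //.
  by rewrite -pmonD => /pmon_commP.
- have [ij kl] : i != j /\ k != l.
    by move: u; rewrite /= !inE !negb_or andbT => /andP[/and3P[-> _ _] /andP[_ ->]].
  have := cofc _ _ (t_comm4 K u); rewrite !coface_t // !Ev_sum_t //.
  by move/pmon_commP.
Qed.

End Pull.

(** * Homogeneous components, units, and power series in a degree-one element *)

Section Degreewise.
Variables (K : fieldType) (n : nat).
Local Notation T := (That K n).
Implicit Types (x y z s u : T) (f : nat -> K).

Lemma trep_t : trep (t K (n := n)).
Proof. by split=> *; [apply: t_sym | apply: t_comm3 | apply: t_comm4]. Qed.

(** The tautological representation: through it, identities in [That K n] can be checked among power
    series. *)
Lemma hcomp_Ev d x : hcomp d x = Ev (t K (n := n)) x d.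
Proof.
rewrite -[x]treprK hcomp_pi Ev_pi; last exact: trep_t.
rewrite nchom_sum_word linear_sum; apply: eq_bigr => w _.
rewrite linearZ /=; congr (_ *: _).
elim: (tval w) => [|p v IHv]; first by rewrite /wval big_nil (rmorph1 (@tpi K n)).
rewrite -cat1s -ncwordM rmorphM /= IHv /wval [RHS]big_cons; congr (_ * _).
rewrite /t /tser; case: insubP => [q _ eq|].
  by congr (tpi (ncword K [:: _])); apply: val_inj; rewrite eq; case: (val p).
by rewrite -surjective_pairing (valP p).
Qed.

Lemma hcomp0 x : hcomp 0 x = (aug x)%:A.
Proof. by rewrite hcomp_Ev Ev_const //; apply: trep_t. Qed.

Lemma augM x y : aug (x * y) = aug x * aug y.
Proof. by rewrite -[x]treprK -[y]treprK -rmorphM !aug_pi nccoefM0. Qed.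
Lemma aug1 : aug (1 : T) = 1.
Proof. by rewrite -(rmorph1 (@tpi K n)) aug_pi. Qed.
Lemma augB x y : aug (x - y) = aug x - aug y.
Proof. by rewrite -[x]treprK -[y]treprK -raddfB !aug_pi. Qed.

Lemma one_plusP x : one_plus x <-> aug x = 1.
Proof.
rewrite /one_plus /= augB aug1; split=> [/eqP|->]; last exact: subrr.
by rewrite subr_eq0 => /eqP.
Qed.

Lemma one_plusM x y : one_plus x -> one_plus y -> one_plus (x * y).
Proof. by rewrite !one_plusP augM => -> ->; rewrite mulr1. Qed.

Lemma hcomp_expr_lt x d k : aug x = 0 -> (d < k)%N -> hcomp d (x ^+ k) = 0.
Proof.
move=> x0 dk; rewrite hcomp_Ev EvX; last exact: trep_t.
by rewrite pser_expr_lt // Ev_const ?x0 ?scale0r //; apply: trep_t.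
Qed.

Lemma hcomp_tsum_widen (F : nat -> T) d N : (forall k, (d < k)%N -> hcomp d (F k) = 0) ->
  (d <= N)%N -> hcomp d (tsum F) = \sum_(k < N.+1) hcomp d (F k) :> T.
Proof.
move=> F0 dN; rewrite hcomp_tsum (big_ord_widen N.+1 (fun k => hcomp d (F k))) //.
rewrite big_mkcond; apply: eq_bigr => k _; case: ifP => // /negbT.
by rewrite ltnS -ltnNge => /F0.
Qed.

(** The inverse is the geometric series in $1-x$, replaced in each degree by a finite partial
    sum. *)
Lemma one_plus_unit x : one_plus x -> x \is a GRing.unit.
Proof.
move=> x1; set u := 1 - x.
have u0 : aug u = 0 by rewrite /u augB aug1 (one_plusP x).1 ?subrr.
have xE : x = 1 - u by rewrite /u subKr.
have gs d N : (d <= N)%N ->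
    hcomp d (tsum (fun k => u ^+ k)) = hcomp d (\sum_(k < N.+1) u ^+ k).
  by move=> dN; rewrite raddf_sum; apply: hcomp_tsum_widen => // k; apply: hcomp_expr_lt.
have xG d : x * (\sum_(k < d.+1) u ^+ k) = 1 - u ^+ d.+1.
  by rewrite -[RHS]opprB subrX1 -mulNr opprB -xE.
have cG d : GRing.comm x (\sum_(k < d.+1) u ^+ k).
  apply: commr_sum => k _; apply: commrX; apply: commrB; first exact: commr1.
  exact: commr_refl.
apply/unitrP; exists (tsum (fun k => u ^+ k)); split; apply: hcompP => d.
  rewrite hcompM (eq_bigr (fun i : 'I_d.+1 =>
    hcomp i (\sum_(k < d.+1) u ^+ k) * hcomp (d - i) x)).
    by rewrite -hcompM -cG xG raddfB /= (hcomp_expr_lt u0) ?subr0.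
  by move=> i _; rewrite (gs _ d) // -ltnS.
rewrite hcompM (eq_bigr (fun i : 'I_d.+1 =>
  hcomp i x * hcomp (d - i) (\sum_(k < d.+1) u ^+ k))).
  by rewrite -hcompM xG raddfB /= (hcomp_expr_lt u0) ?subr0.
by move=> i _; rewrite (gs _ d) // leq_subr.
Qed.

Lemma one_plusV x : one_plus x -> one_plus x^-1.
Proof.
move=> x1; have xu := one_plus_unit x1.
by have := congr1 (@aug K n) (mulrV xu); rewrite augM aug1 (one_plusP x).1 // mul1r one_plusP.
Qed.

Definition pev f s : T := tsum (fun k => f k *: s ^+ k).

Lemma homogX s k : homog 1 s -> homog k (s ^+ k).
Proof.
move=> h; elim: k => [|k IHk]; first exact: homog1.
by rewrite exprS -(add1n k); apply: (@homogM _ _ 1%N k).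
Qed.

Lemma homogD d x y : homog d x -> homog d y -> homog d (x + y).
Proof. by move=> hx hy e; rewrite raddfD /= hx hy; case: ifP; rewrite ?addr0. Qed.

Lemma hcomp_pev f s d : homog 1 s -> hcomp d (pev f s) = f d *: s ^+ d.
Proof.
move=> h; rewrite hcomp_tsum big_ord_recr /= linearZ /= homogX // eqxx big1 ?add0r // => k _.
by rewrite linearZ /= homogX // gtn_eqF ?scaler0.
Qed.

Lemma one_plus_pev f s : homog 1 s -> f 0%N = 1 -> one_plus (pev f s).
Proof.
move=> h f0; rewrite one_plusP; have := hcomp_pev f 0 h; rewrite hcomp0 f0 !scale1r expr0.
move/(congr1 (@aug K n)); rewrite aug1.
by rewrite -(rmorph1 (@tpi K n)) -linearZ aug_pi nccoefZ mulr1.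
Qed.

(** As [s] is homogeneous of degree 1, the relation $su=us$ in degree $d+1$ involves only the
    component of [u] of degree $d$; so [s] commutes with every component of [u]. *)
Lemma comm_pev f s u : homog 1 s -> GRing.comm s u -> GRing.comm (pev f s) u.
Proof.
move=> h c; have cs d : GRing.comm s (hcomp d u).
  have := congr1 (hcomp d.+1) c; rewrite !hcompM.
  rewrite (bigD1 (inord 1 : 'I_d.+2)) //= inordK // h eqxx subSS subn0 big1 ?addr0.
    rewrite (bigD1 (inord d : 'I_d.+2)) //= inordK ?ltnS // h subSnn eqxx.
    rewrite big1 ?addr0 // => i; rewrite -val_eqE /= inordK ?ltnS // => id.
    by rewrite h ifF ?mulr0 //; apply/eqP; have := ltn_ord i; lia.
  by move=> i; rewrite -val_eqE /= inordK // => /negPf id; rewrite h id mul0r.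
apply: hcompP => d; rewrite !hcompM [RHS](reindex_inj rev_ord_inj) /=.
apply: eq_bigr => i _; rewrite subSS subKn -1?ltnS // !hcomp_pev //.
by rewrite -scalerAl -scalerAr; congr (_ *: _); apply/commr_sym/commrX/commr_sym.
Qed.

Lemma Ev_pev (B : algType K) (rho : 'I_n -> 'I_n -> B) f s a d : trep rho ->
  Ev rho s = pmon a -> homog 1 s -> Ev rho (pev f s) d = f d *: a ^+ d.
Proof.
move=> rP sa h; transitivity (Ev rho (hcomp d (pev f s)) d); first by rewrite Ev_hcomp ?eqxx.
by rewrite hcomp_pev // EvZ // EvX // sa pmonX eqxx.
Qed.

End Degreewise.

Lemma coface_pev (K : fieldType) n m (I : 'I_n -> {set 'I_m}) (f : nat -> K) (s : That K n) :
  (forall i j : 'I_n, i != j -> [disjoint I i & I j]) -> homog 1 s ->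
  coface I (pev f s) = pev f (coface I s).
Proof.
move=> dI h; apply: hcompP => d; rewrite hcomp_coface // !hcomp_pev ?cofaceZ ?cofaceX //.
by move=> e; rewrite hcomp_coface // h; case: ifP; rewrite ?coface0.
Qed.

(** * Group-like elements and the Dynkin operator *)

Section Operators.
Variables (K : fieldType) (A : algType K).
Local Notation M := (A * A)%type.

(** A pair $(m_1,m_2)$ is to be read as $m_1+\varepsilon m_2$ in $A[\varepsilon]/(\varepsilon^2)$.
    The linear endomorphisms form the algebra in which the Dynkin operator becomes the value of a
    representation. *)
Record linop := LinOp { lop :> M -> M; lopP : linear lop }.

HB.instance Definition _ := gen_eqMixin linop.
HB.instance Definition _ := gen_choiceMixin linop.

Implicit Types (f g h : linop) (m : M).

Lemma linopP f g : f =1 g -> f = g.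
Proof.
case: f g => [f fP] [g gP] /= /funext e; rewrite {f}e in fP *.
by rewrite (Prop_irrelevance fP gP).
Qed.

Lemma lopD f m m' : f (m + m') = f m + f m'.
Proof. by have := lopP f 1 m m'; rewrite !scale1r. Qed.
Lemma lop0 f : f 0 = 0.
Proof. by apply: (addrI (f 0)); rewrite -lopD !addr0. Qed.
Lemma lopZ f c m : f (c *: m) = c *: f m.
Proof. by rewrite -[c *: m]addr0 lopP lop0 addr0. Qed.

Fact op_zero_linear : linear (fun _ : M => 0 : M).
Proof. by move=> c m m'; rewrite scaler0 addr0. Qed.
Fact op_one_linear : linear (fun m : M => m).
Proof. by []. Qed.
Fact op_opp_linear f : linear (fun m => - f m).
Proof. by move=> c m m'; rewrite lopP opprD scalerN. Qed.
Fact op_add_linear f g : linear (fun m => f m + g m).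
Proof. by move=> c m m'; rewrite !lopP scalerDr addrACA. Qed.
Fact op_mul_linear f g : linear (fun m => f (g m)).
Proof. by move=> c m m'; rewrite !lopP. Qed.
Fact op_scale_linear a f : linear (fun m => a *: f m).
Proof. by move=> c m m'; rewrite !lopP scalerDr !scalerA mulrC. Qed.

Definition op_zero := LinOp op_zero_linear.
Definition op_one := LinOp op_one_linear.
Definition op_opp f := LinOp (op_opp_linear f).
Definition op_add f g := LinOp (op_add_linear f g).
Definition op_mul f g := LinOp (op_mul_linear f g).
Definition op_scale a f := LinOp (op_scale_linear a f).

Fact op_addA : associative op_add.
Proof. by move=> f g h; apply: linopP => m /=; rewrite addrA. Qed.
Fact op_addC : commutative op_add.
Proof. by move=> f g; apply: linopP => m /=; rewrite addrC. Qed.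
Fact op_add0 : left_id op_zero op_add.
Proof. by move=> f; apply: linopP => m /=; rewrite add0r. Qed.
Fact op_addN : left_inverse op_zero op_opp op_add.
Proof. by move=> f; apply: linopP => m /=; rewrite addNr. Qed.
HB.instance Definition _ := GRing.isZmodule.Build linop op_addA op_addC op_add0 op_addN.

Fact op_mulA : associative op_mul. Proof. by move=> f g h; apply: linopP. Qed.
Fact op_mul1 : left_id op_one op_mul. Proof. by move=> f; apply: linopP. Qed.
Fact op_mulr1 : right_id op_one op_mul. Proof. by move=> f; apply: linopP. Qed.
Fact op_mulDl : left_distributive op_mul +%R.
Proof. by move=> f g h; apply: linopP. Qed.
Fact op_mulDr : right_distributive op_mul +%R.
Proof. by move=> f g h; apply: linopP => m /=; rewrite lopD. Qed.
Fact op_one_neq0 : op_one != 0.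
Proof.
apply/eqP => /(congr1 (fun f : linop => (f (1, 0)).1)) /eqP.
by rewrite /= oner_eq0.
Qed.
HB.instance Definition _ := GRing.Zmodule_isNzRing.Build linop
  op_mulA op_mul1 op_mulr1 op_mulDl op_mulDr op_one_neq0.

Fact op_scaleA a b f : op_scale a (op_scale b f) = op_scale (a * b) f.
Proof. by apply: linopP => m /=; rewrite scalerA. Qed.
Fact op_scale1 : left_id 1 op_scale.
Proof. by move=> f; apply: linopP => m /=; rewrite scale1r. Qed.
Fact op_scaleDr : right_distributive op_scale +%R.
Proof. by move=> a f g; apply: linopP => m /=; rewrite scalerDr. Qed.
Fact op_scaleDl f : {morph op_scale^~ f : a b / a + b}.
Proof. by move=> a b; apply: linopP => m /=; rewrite scalerDl. Qed.
HB.instance Definition _ := GRing.Zmodule_isLmodule.Build K linop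
  op_scaleA op_scale1 op_scaleDr op_scaleDl.
Fact op_scaleAl a f g : a *: (f * g) = (a *: f) * g.
Proof. exact: linopP. Qed.
HB.instance Definition _ := GRing.Lmodule_isLalgebra.Build K linop op_scaleAl.
Fact op_scaleAr a f g : a *: (f * g) = f * (a *: g).
Proof. by apply: linopP => m /=; rewrite lopZ. Qed.
HB.instance Definition _ := GRing.Lalgebra_isAlgebra.Build K linop op_scaleAr.

Lemma lopM f g m : (f * g) m = f (g m). Proof. by []. Qed.
Lemma lopDE f g m : (f + g) m = f m + g m. Proof. by []. Qed.

Lemma lop_sum I (r : seq I) (P : pred I) (F : I -> linop) m :
  (\sum_(i <- r | P i) F i) m = \sum_(i <- r | P i) F i m.
Proof. by elim/big_rec2: _ => // i y1 y2 _ <-. Qed.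

(** Left multiplication by $a(1+\varepsilon)$: a word $w$ of length $k$ in such operators sends 1 to
    $w(1+k\varepsilon)$. *)
Fact op_left_linear (a : A) : linear (fun m : M => (a * m.1, a * m.2 + a * m.1)).
Proof.
move=> c [m1 m2] [n1 n2]; congr (_, _); rewrite /= !mulrDr -!scalerAr //.
by rewrite scalerDr addrACA.
Qed.
Definition op_left a := LinOp (op_left_linear a).

Fact op_right_linear (a : A) : linear (fun m : M => (- (m.1 * a), - (m.2 * a))).
Proof.
by move=> c [m1 m2] [n1 n2]; congr (_, _); rewrite /= mulrDl -scalerAl opprD scalerN.
Qed.
Definition op_right a := LinOp (op_right_linear a).

Lemma op_leftD a b : op_left (a + b) = op_left a + op_left b.
Proof.
apply: linopP => -[m n]; congr (_, _); rewrite /= !mulrDl //.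
by rewrite addrACA.
Qed.

Lemma op_rightD a b : op_right (a + b) = op_right a + op_right b.
Proof. by apply: linopP => -[m n]; congr (_, _); rewrite /= mulrDr opprD. Qed.

Lemma op_left_comm a b : GRing.comm a b -> GRing.comm (op_left a) (op_left b).
Proof.
by move=> c; apply: linopP => -[m n]; congr (_, _); rewrite /= ?mulrDr !mulrA c.
Qed.

Lemma op_right_comm a b : GRing.comm a b -> GRing.comm (op_right a) (op_right b).
Proof.
by move=> c; apply: linopP => -[m n]; congr (_, _); rewrite /= !mulNr -!mulrA c.
Qed.

Lemma op_left_right a b : GRing.comm (op_left a) (op_right b).
Proof.
apply: linopP => -[m n]; congr (_, _); rewrite /= ?mulrDl !mulrN !mulrA //.
by rewrite opprD.
Qed.

End Operators.

Lemma lie_bracket_add (R : pzRingType) (x x' y y' : R) :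
  GRing.comm x y' -> GRing.comm x' y ->
  (x + x') * (y + y') - (y + y') * (x + x') = (x * y - y * x) + (x' * y' - y' * x').
Proof.
have dist (a a' b b' : R) : (a + a') * (b + b') = (a * b + a' * b') + (a * b' + a' * b).
  by rewrite mulrDl !mulrDr [a' * b + _]addrC addrACA.
move=> c c'; rewrite !dist c c' [y' * x + _]addrC opprD addrACA subrr addr0.
by rewrite opprD addrACA.
Qed.

Section LieElements.
Variables (K : fieldType) (n : nat).
Local Notation T := (That K n).
Implicit Types (x y l : T).
Local Notation tt := (t K (n := n)).

Definition primitive x := forall (B : algType K) (rho rho' : 'I_n -> 'I_n -> B),
  trep rho -> trep rho' -> comm_reps rho rho' ->
  Ev (rep_add rho rho') x = Ev rho x + Ev rho' x.

Definition grouplike x := forall (B : algType K) (rho rho' : 'I_n -> 'I_n -> B),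
  trep rho -> trep rho' -> comm_reps rho rho' ->
  Ev (rep_add rho rho') x = Ev rho x * Ev rho' x.

Lemma EvZZ (B : algType K) (rho : 'I_n -> 'I_n -> B) c x : trep rho ->
  Ev rho (c *: x) = Pser (fun d => c *: Ev rho x d).
Proof. by move=> rP; apply: pserP => d; rewrite EvZ. Qed.

Lemma lie_primitive x : lie x -> primitive x.
Proof.
move=> lx B rho rho' rP rP' c; have aP := trep_add rP rP' c.
elim: lx => [|i j ij|a b _ IHa _ IHb|e a _ IHa|a b _ IHa _ IHb].
- by rewrite !Ev0 ?addr0.
- by rewrite !Ev_t // pmonD.
- by rewrite !EvD // IHa IHb addrACA.
- rewrite !EvZZ // IHa; apply: pserP => d /=; exact: scalerDr.
- by rewrite !EvB // !EvM // IHa IHb lie_bracket_add //; apply: Ev_comm => //; apply: comm_repsC.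
Qed.

Lemma lie_aug x : lie x -> aug x = 0.
Proof.
elim=> [|i j ij|a b _ IHa _ IHb|e a _ IHa|a b _ _ _ _].
- by rewrite -(raddf0 (@tpi K n)) aug_pi.
- by rewrite aug_pi tser_const.
- by rewrite -[a]treprK -[b]treprK -raddfD aug_pi nccoefD -!aug_pi !treprK IHa IHb addr0.
- by rewrite -[a]treprK -linearZ aug_pi nccoefZ -aug_pi treprK IHa mulr0.
- by rewrite augB !augM mulrC subrr.
Qed.

Lemma aug_hcomp0 x : aug (hcomp 0 x) = aug x.
Proof. by rewrite -[x]treprK hcomp_pi !aug_pi. Qed.

Lemma lie_hat_aug x : lie_hat x -> aug x = 0.
Proof. by move=> /(_ 0%N) /lie_aug; rewrite aug_hcomp0. Qed.

Lemma lie_hat_primitive x : lie_hat x -> primitive x.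
Proof.
move=> lx B rho rho' rP rP' c; apply: pserP => d; have aP := trep_add rP rP' c.
have := congr1 (fun u : pser B => u d) (lie_primitive (lx d) rP rP' c).
by rewrite !pcoD !Ev_hcomp // eqxx.
Qed.

Lemma Ev_aug0 (B : algType K) (rho : 'I_n -> 'I_n -> B) x : trep rho ->
  aug x = 0 -> Ev rho x 0 = 0.
Proof. by move=> rP x0; rewrite Ev_const // x0 scale0r. Qed.

Lemma grouplike_texp l : [pchar K] =i pred0 -> aug l = 0 -> primitive l ->
  grouplike (texp l).
Proof.
move=> char0 l0 lP B rho rho' rP rP' c; have aP := trep_add rP rP' c.
by rewrite !Ev_texp // lP // pexpD ?Ev_aug0 //; apply: Ev_comm.
Qed.

Lemma lie_sum I (r : seq I) (P : pred I) (F : I -> T) :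
  (forall i, P i -> lie (F i)) -> lie (\sum_(i <- r | P i) F i).
Proof. by move=> h; elim/big_ind: _ => //; [exact: lie0 | exact: lieD]. Qed.

Lemma trep_left : trep (fun i j => op_left (tt i j)).
Proof.
have [r2 r3 r4] := trep_t K n; split=> [i j ij|i j k u|i j k l u].
- by rewrite r2.
- by rewrite -op_leftD; apply: op_left_comm; apply: r3.
- by apply: op_left_comm; apply: r4.
Qed.

Lemma trep_right : trep (fun i j => op_right (tt i j)).
Proof.
have [r2 r3 r4] := trep_t K n; split=> [i j ij|i j k u|i j k l u].
- by rewrite r2.
- by rewrite -op_rightD; apply: op_right_comm; apply: r3.
- by apply: op_right_comm; apply: r4.
Qed.

(* The Dynkin--Specht--Wever argument: acting on (1, 0), left multiplications *)
(* (twisted so that the second slot records the degree) give (x, d x), right  *)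
(* multiplications give (_, 0), and their sum acts by iterated brackets.      *)
Lemma primitive_lie d x : [pchar K] =i pred0 -> (0 < d)%N -> homog d x ->
  primitive x -> lie x.
Proof.
move=> /pcharf0P char0 d0 hx px.
pose L i j := op_left (tt i j); pose R i j := op_right (tt i j).
have cLR : comm_reps L R by move=> *; apply: op_left_right.
pose m : T * T := (1, 0).
have EvE (rho : 'I_n -> 'I_n -> linop T) : Ev rho x d m =
    \sum_(w : d.-tuple (tgen n)) nccoef (trepr x) w *: wval rho w m.
  by rewrite /= /evcoef lop_sum.
have snd_sum (F : d.-tuple (tgen n) -> T * T) : (\sum_w F w).2 = \sum_w (F w).2.
  exact: (big_morph snd).
have wL w : wval L w m = (wval tt w, (size w)%:R *: wval tt w).
  elim: w => [|p w IHw]; first by rewrite /wval !big_nil scale0r.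
  rewrite /wval !big_cons lopM -!/(wval _ w) IHw.
  by congr (_, _); rewrite -scalerAr -[X in _ + X]scale1r -scalerDl natr1.
have wR w : (wval R w m).2 = 0.
  elim: w => [|p w IHw]; first by rewrite /wval big_nil.
  by rewrite /wval big_cons lopM -/(wval R w) /= IHw mul0r oppr0.
have wLR p w : (wval (rep_add L R) (p :: w) m).1 = 0 /\
    lie (wval (rep_add L R) (p :: w) m).2.
  elim: w p => [|q w IHw] p.
    rewrite /wval big_seq1 /= !mul1r !mulr1 mulr0 mul0r subrr oppr0 addr0 add0r.
    by split=> //; apply: lie_gen (valP p).
  have [w1 w2] := IHw q; rewrite /wval big_cons lopM -/(wval _ (q :: w)) /= w1.
  rewrite !(mulr0, mul0r) oppr0 !addr0; split=> //.
  by apply: lieB => //; apply: lie_gen (valP p).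
have hxd : hcomp d x = x by rewrite hx eqxx.
have xE : x = \sum_(w : d.-tuple (tgen n)) nccoef (trepr x) w *: wval tt w.
  by rewrite -[LHS]hxd hcomp_Ev.
have dx : d%:R *: x = \sum_(w : d.-tuple (tgen n))
    nccoef (trepr x) w *: (wval (rep_add L R) w m).2.
  have /(congr1 (fun u : pser (linop T) => (u d m).2)) := px _ _ _ trep_left trep_right cLR.
  rewrite EvE snd_sum => ->.
  rewrite pcoD lopDE !EvE [LHS]/= /=.
  rewrite !snd_sum [X in _ + X]big1 ?addr0 => [|w _]; last by rewrite /= wR scaler0.
  rewrite {1}xE scaler_sumr; apply: eq_bigr => w _.
  by rewrite wL /= size_tuple scalerA mulrC -scalerA.
have dn0 : d%:R != 0 :> K by rewrite char0 -lt0n.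
rewrite -[x]scale1r -(mulVf dn0).
rewrite -scalerA; apply: lieZ; rewrite dx; apply: lie_sum => w _; apply: lieZ.
case: w => [[|p w] /= wd]; first by rewrite -(eqP wd) in d0.
exact: (wLR p w).2.
Qed.

(** Without constant term, the degree [d] part of a power of exponent at least 2 involves only
    components of degree below [d]; so the first discrepancy comes from the linear term alone. *)
Lemma hcomp_texp_congr l l' d : aug l = 0 -> aug l' = 0 -> (0 < d)%N ->
  (forall e, (e < d)%N -> hcomp e l = hcomp e l') ->
  hcomp d (texp l) - hcomp d (texp l') = hcomp d l - hcomp d l'.
Proof.
move=> l0 l'0 d0 h.
have hX k e : (e < d)%N -> hcomp e (l ^+ k) = hcomp e (l' ^+ k).
  elim: k e => // k IHk e ed; rewrite !exprS !hcompM; apply: eq_bigr => i _.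
  by rewrite h ?IHk //; have := ltn_ord i; lia.
have hXd k : hcomp d (l ^+ k.+2) = hcomp d (l' ^+ k.+2).
  rewrite ![_ ^+ k.+2]exprS !hcompM; apply: eq_bigr => i _.
  have [->|id] := eqVneq (val i) d.
    by rewrite subnn !hcomp_expr_lt ?mulr0.
  have lid : (i < d)%N by rewrite ltn_neqAle id -ltnS /=.
  rewrite h //; case: (posnP i) => [->|i0].
    by rewrite !hcomp0 l'0 scale0r !mul0r.
  by rewrite hX //; lia.
rewrite !hcomp_tsum -sumrB; case: d d0 h hX hXd => // d _ h hX hXd.
rewrite 2!big_ord_recl !expr0 subrr add0r /bump /= !expr1 invr1 !scale1r big1 ?addr0 //.
move=> k _; rewrite !linearZ /= -scalerDr /bump /=.
by rewrite !add1n hXd subrr scaler0.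
Qed.

Definition log_poly N : {poly K} := \sum_(k < N) ((-1) ^+ k / k.+1%:R) *: 'X^(k.+1).

Lemma log_poly_factor N : exists r, log_poly N = 'X * r.
Proof.
exists (\sum_(k < N) ((-1) ^+ k / k.+1%:R) *: 'X^k); rewrite mulr_sumr.
by apply: eq_bigr => k _; rewrite -scalerAr exprS.
Qed.

(* W = exp(log(1 + X)) solves (1 + X) W' = W up to the truncation order. *)
Lemma exp_log_poly N i : [pchar K] =i pred0 -> (i <= N)%N ->
  (\sum_(k < N.+1) (k`!%:R : K)^-1 *: log_poly N ^+ k)`_i = (1 + 'X)`_i.
Proof.
move=> /pcharf0P char0 iN; set q := log_poly N; set W := \sum_(k < _) _.
have [r] := log_poly_factor N; rewrite -/q => qE.
have dq : (1 + 'X) * q^`() = 1 - (-1) ^+ N *: 'X^N.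
  rewrite /q /log_poly raddf_sum /=.
  rewrite (eq_bigr (fun k : 'I_N => (- 'X) ^+ k)) => [|k _]; last first.
    rewrite derivZ derivXn -scaler_nat scalerA divfK ?char0 //.
    by rewrite [RHS]exprNn -mul_polyC polyC_exp polyCN.
  rewrite -[1 + 'X]opprK opprD addrC mulNr -subrX1 opprB [(- 'X) ^+ N]exprNn.
  by rewrite -mul_polyC polyC_exp polyCN.
have dW : (1 + 'X) * W^`() =
   (W - (N`!%:R : K)^-1 *: q ^+ N) * (1 - (-1) ^+ N *: 'X^N).
  rewrite -dq mulrCA; congr (_ * _).
  rewrite /W raddf_sum big_ord_recl [in RHS]big_ord_recr /= addrK.
  rewrite expr0 linearZ /= derivC scaler0 add0r mulr_suml; apply: eq_bigr => k _.
  rewrite linearZ /= deriv_exp /= -mulrnAl -scaler_nat -scalerAl scalerA.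
  rewrite -[RHS]scalerAl add0n /bump add1n [_ * q^`()]mulrC; congr (_ *: _).
  by rewrite factS natrM invfM mulrC mulVKf ?char0.
have cW j : (j < N)%N -> W`_j.+1 *+ j.+1 + W`_j *+ j = W`_j.
  move=> jN; have := congr1 (fun p : {poly K} => p`_j) dW.
  have -> : (1 + 'X) * W^`() = W^`() + 'X * W^`() by rewrite mulrDl mul1r.
  rewrite coefD coefXM !coef_deriv.
  have -> : (if j == 0%N then 0 else W`_j.-1.+1 *+ j.-1.+1) = W`_j *+ j.
    by case: (j).
  move=> ->; rewrite mulrBr mulr1 coefB -scalerAr coefZ coefMXn jN mulr0 subr0.
  by rewrite coefB coefZ qE exprMn coefXnM jN mulr0 subr0.
have W0 : W`_0 = 1.
  rewrite /W big_ord_recl expr0 coefD coefZ coef1 invr1 mulr1 coef_sum big1 ?addr0 //.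
  by move=> k _; rewrite coefZ qE exprMn coefXnM mulr0.
rewrite coefD coef1 coefX; case: i iN => [|[|i]] iN; first by rewrite W0 addr0.
  by have := cW _ iN; rewrite mulr0n addr0 W0 add0r.
have W2 j : (j.+2 <= N)%N -> W`_j.+2 = 0.
  elim: j => [|j IHj] jN.
    have := cW 1%N jN; rewrite mulr1n => /eqP; rewrite -subr_eq0 addrK.
    by rewrite -mulr_natr mulf_eq0 char0 orbF => /eqP.
  have := cW _ jN; rewrite IHj 1?ltnW // mul0rn addr0 => /eqP.
  by rewrite -mulr_natr mulf_eq0 char0 orbF => /eqP.
by rewrite W2 // addr0.
Qed.

Lemma hcomp_congrX x y d k : (forall e, (e <= d)%N -> hcomp e x = hcomp e y) ->
  hcomp d (x ^+ k) = hcomp d (y ^+ k).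
Proof.
move=> h; elim: k {-2}d (leqnn d) => // k IHk e ed.
rewrite !exprS !hcompM; apply: eq_bigr => i _.
by rewrite h ?IHk //; have := ltn_ord i; lia.
Qed.

Lemma horner_algZ (v : T) c (p : {poly K}) : horner_alg v (c *: p) = c *: horner_alg v p.
Proof. by rewrite -mul_polyC rmorphM /= horner_algC mulr_algl. Qed.

Lemma hcomp_horner_alg (v : T) (p q : {poly K}) d : aug v = 0 -> (forall i, (i <= d)%N -> p`_i = q`_i) ->
  hcomp d (horner_alg v p) = hcomp d (horner_alg v q).
Proof.
move=> v0 pq; have take r : hcomp d (horner_alg v r) = hcomp d (horner_alg v (take_poly d.+1 r)).
  rewrite -{1}(poly_take_drop d.+1 r) rmorphD rmorphM rmorphXn /= horner_algX raddfD /=.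
  rewrite [X in _ + X]hcompM big1 ?addr0 // => i _.
  by rewrite hcomp_expr_lt ?mulr0 //; have := ltn_ord i; lia.
rewrite take [RHS]take; congr (hcomp d (horner_alg v _)); apply/polyP => i.
by rewrite !coef_take_poly ltnS; case: ifP => // /pq.
Qed.

Lemma aug_tlog x : one_plus x -> aug (tlog x) = 0.
Proof.
move=> x1; rewrite -aug_hcomp0 hcomp_tsum big_ord1 aug_hcomp0.
by rewrite expr1 expr0 divr1 scale1r.
Qed.

(** In each degree both series may be truncated, which leaves the polynomial identity [exp_log_poly]
    evaluated at $x-1$. *)
Lemma tlogK x : [pchar K] =i pred0 -> one_plus x -> texp (tlog x) = x.
Proof.
move=> char0 x1; set v := x - 1; have v0 : aug v = 0 by [].
have lE d N : (d <= N)%N -> hcomp d (tlog x) = hcomp d (horner_alg v (log_poly N.+1)).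
  move=> dN; rewrite (@hcomp_tsum_widen _ _ _ _ N) // => [|k dk].
    rewrite /log_poly !linear_sum; apply: eq_bigr => k _ /=.
    by rewrite horner_algZ rmorphXn /= horner_algX.
  by rewrite linearZ /= hcomp_expr_lt ?scaler0 //; lia.
apply: hcompP => d; rewrite (@hcomp_tsum_widen _ _ _ _ d.+1) // => [|k dk]; last first.
  by rewrite linearZ /= hcomp_expr_lt ?scaler0 // aug_tlog.
pose W : {poly K} := \sum_(k < d.+2) (k`!%:R : K)^-1 *: log_poly d.+1 ^+ k.
transitivity (hcomp d (horner_alg v W)).
  rewrite /W !linear_sum; apply: eq_bigr => k _ /=.
  rewrite horner_algZ !linearZ /= rmorphXn /=; congr (_ *: _); apply: hcomp_congrX => e ed.
  exact: lE.
have -> : x = horner_alg v (1 + 'X).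
  by rewrite raddfD /= rmorph1 horner_algX /v addrC subrK.
apply: hcomp_horner_alg => // i id.
by rewrite exp_log_poly // ltnW.
Qed.

Lemma aug_texp x : aug x = 0 -> aug (texp x) = 1.
Proof.
move=> x0; rewrite -aug_hcomp0 hcomp_tsum big_ord1 aug_hcomp0.
by rewrite expr0 invr1 scale1r aug1.
Qed.

Lemma Ev_hcomp_eq (B : algType K) (rho : 'I_n -> 'I_n -> B) x y d : trep rho ->
  hcomp d x = hcomp d y -> Ev rho x d = Ev rho y d.
Proof.
move=> rP e; have := congr1 (fun z => Ev rho z d) e.
by rewrite !Ev_hcomp // eqxx.
Qed.

Lemma lie_grouplike x : [pchar K] =i pred0 -> one_plus x -> lie_hat (tlog x) ->
  grouplike x.
Proof.
move=> char0 x1 lx; rewrite -[x]tlogK //; apply: grouplike_texp => //.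
  exact: aug_tlog.
exact: lie_hat_primitive.
Qed.

(** Induction on the degree. The part [l'] of the logarithm in lower degrees is Lie, so [texp l'] is
    group-like and agrees with [x] there. Group-like elements agreeing in lower degrees differ by a
    primitive element in the next one, and [primitive_lie] applies to it. *)
Lemma grouplike_lie x : [pchar K] =i pred0 -> one_plus x -> grouplike x ->
  lie_hat (tlog x).
Proof.
move=> char0 x1 gx; set l := tlog x; have l0 : aug l = 0 by apply: aug_tlog.
elim/ltn_ind => -[_|d IHd]; first by rewrite hcomp0 l0 scale0r; apply: lie0.
pose l' : T := \sum_(k < d.+1) hcomp k l.
have hl' e : hcomp e l' = if (e < d.+1)%N then hcomp e l else 0.
  rewrite raddf_sum /=; case: ltnP => ed.
    rewrite (bigD1 (Ordinal ed)) //= hcomp_hcomp eqxx big1 ?addr0 // => i.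
    by rewrite hcomp_hcomp -val_eqE /= eq_sym => /negPf ->.
  by rewrite big1 // => i _; rewrite hcomp_hcomp gtn_eqF // (leq_trans _ ed).
have ll' : lie_hat l' by move=> e; rewrite hl'; case: ifP => [/IHd|_] //; apply: lie0.
have l'0 := lie_hat_aug ll'.
have gl' := grouplike_texp char0 l'0 (lie_hat_primitive ll').
have xE : texp l = x by apply: tlogK.
have lo e : (e < d.+1)%N -> hcomp e x = hcomp e (texp l').
  case: e => [|e] ed; first by rewrite -xE !hcomp0 !aug_texp.
  apply/eqP; rewrite -subr_eq0 -xE hcomp_texp_congr // => [|k ke].
    by rewrite hl' ed subrr.
  by rewrite hl' (ltn_trans ke ed).
have top : hcomp d.+1 l = hcomp d.+1 (x - texp l').
  rewrite raddfB /= -xE hcomp_texp_congr // => [|k ke]; last by rewrite hl' ke.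
  by rewrite hl' ltnn subr0.
apply: (@primitive_lie d.+1) => //.
  by move=> e; rewrite hcomp_hcomp; case: eqP => [->|].
move=> B rho rho' rP rP' c; have aP := trep_add rP rP' c.
apply: pserP => e; rewrite pcoD !Ev_hcomp //; case: eqP => [->{e}|_]; last by rewrite addr0.
rewrite !(Ev_hcomp_eq _ top) // !EvB // gx // gl' // !pcoD !pcoN.
(* Only the end terms contain components of degree [d.+1], each next to a constant term 1; the inner
   terms coincide for [x] and [texp l']. *)
have ends (u v : pser B) : (u * v) d.+1 = u 0 * v d.+1 +
    (\sum_(i < d) u i.+1 * v (d.+1 - i.+1)%N + u d.+1 * v 0).
  by rewrite pcoM big_ord_recl subn0 big_ord_recr /= /bump add1n subnn.
rewrite !ends.
have E0 (r : 'I_n -> 'I_n -> B) y : trep r -> one_plus y -> Ev r y 0 = 1.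
  by move=> rr y1; rewrite Ev_const // (one_plusP y).1 // scale1r.
have y1 : one_plus (texp l') by apply/one_plusP/aug_texp.
rewrite !E0 // !mul1r !mulr1.
have -> : \sum_(i < d) Ev rho x i.+1 * Ev rho' x (d.+1 - i.+1)%N =
   \sum_(i < d) Ev rho (texp l') i.+1 * Ev rho' (texp l') (d.+1 - i.+1)%N.
  apply: eq_bigr => i _; have id := ltn_ord i.
  by rewrite (Ev_hcomp_eq rP (lo i.+1 _)) // (Ev_hcomp_eq rP' (lo (d.+1 - i.+1)%N _)) //; lia.
by rewrite opprD addrACA [RHS]addrC; congr (_ + _); rewrite opprD addrACA subrr add0r.
Qed.

End LieElements.

(** * Consequences of the pentagon *)

(** Boolean, so that concrete lists are validated by computation. Empty blocks are allowed: they
    give the value 0 to every generator of that strand. *)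
Definition wf_blocks n m (s : seq (seq nat)) : bool :=
  [&& size s == n, all uniq s, pairwise (fun u v => all (fun a => a \notin v) u) s
    & all (all (fun a => 0 < a <= m)%N) s].

Section Blocks.
Variables (n m : nat) (s : seq (seq nat)).
Hypothesis ws : wf_blocks n m.+1 s.

Lemma disjoint_blocks (i j : 'I_n) : i != j ->
  [disjoint blocks m.+1 s i & blocks m.+1 s j].
Proof.
have /and4P[/eqP sn _ pw _] := ws.
have lt (k l : 'I_n) : (k < l)%N -> [disjoint blocks m.+1 s k & blocks m.+1 s l].
  move=> kl; rewrite disjoint_subset; apply/fintype.subsetP => a; rewrite !inE => ak.
  have kn : (k < size s)%N by rewrite sn.
  have ln : (l < size s)%N by rewrite sn.
  by have /allP/(_ _ ak) := pairwiseP [::] pw _ _ kn ln kl.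
by rewrite neq_ltn => /orP[/lt|/lt] //; rewrite disjoint_sym.
Qed.

Lemma sum_blocks (V : nmodType) (F : 'I_m.+1 -> V) (i : 'I_n) :
  \sum_(a in blocks m.+1 s i) F a = \sum_(a <- nth [::] s i) F (inord a.-1).
Proof.
have /and4P[/eqP sn /allP su _ /allP sr] := ws.
have si : nth [::] s i \in s by rewrite mem_nth ?sn.
have bound a : a \in nth [::] s i -> (0 < a <= m.+1)%N by move: a; apply/allP/sr.
rewrite -(big_map (fun a => inord a.-1 : 'I_m.+1) xpredT F) [RHS]big_uniq /=.
  apply: eq_bigl => a; rewrite inE; apply/idP/mapP => [ai|[b bi ->]].
    by exists a.+1 => //=; rewrite inord_val.
  by have := bound _ bi; case: b bi => // b bi /= ?; rewrite inordK.
rewrite map_inj_in_uniq ?su // => a b /bound ab /bound bb.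
case: a b ab bb => // a [] // b /= ab bb /(congr1 val) /=.
by rewrite !inordK // => ->.
Qed.

End Blocks.

Section Tables.
Variables (K : fieldType) (B : algType K).
Implicit Types a b c : B.

Definition tabrep n (M : seq (seq B)) (i j : 'I_n) : B := (nth [::] M i)`_j.
Definition rep3 a12 a13 a23 : 'I_3 -> 'I_3 -> B :=
  tabrep [:: [:: 0; a12; a13]; [:: a12; 0; a23]; [:: a13; a23; 0]].
Definition rep4 a12 a13 a14 a23 a24 a34 : 'I_4 -> 'I_4 -> B :=
  tabrep [:: [:: 0; a12; a13; a14]; [:: a12; 0; a23; a24];
             [:: a13; a23; 0; a34]; [:: a14; a24; a34; 0]].

Lemma pull_blocks n m s (rho : 'I_m.+1 -> 'I_m.+1 -> B) (i j : 'I_n) :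
  wf_blocks n m.+1 s -> pull (blocks m.+1 s) rho i j =
  \sum_(a <- nth [::] s i) \sum_(b <- nth [::] s j) rho (inord a.-1) (inord b.-1).
Proof.
move=> ws; rewrite /pull (sum_blocks ws); apply: eq_bigr => a _.
exact: sum_blocks.
Qed.

Lemma trep_ext n (rho rho' : 'I_n -> 'I_n -> B) :
  (forall i j, i != j -> rho i j = rho' i j) -> trep rho -> trep rho'.
Proof.
move=> e [r2 r3 r4]; split=> [i j ij|i j k u|i j k l u].
- have ji : j != i by rewrite eq_sym.
  by rewrite -(e _ _ ij) -(e _ _ ji); apply: r2.
- have [ij ik jk] : [/\ i != j, i != k & j != k].
    by move: u; rewrite /= !inE negb_or andbT => /andP[/andP[]].
  by rewrite -(e _ _ ij) -(e _ _ ik) -(e _ _ jk); apply: r3.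
- have [ij kl] : i != j /\ k != l.
    by move: u; rewrite /= !inE !negb_or andbT => /andP[/and3P[-> _ _] /andP[_ ->]].
  by rewrite -(e _ _ ij) -(e _ _ kl); apply: r4.
Qed.

Lemma rep3P (rho : 'I_3 -> 'I_3 -> B) a b c :
  trep rho -> rho ord0 (inord 1) = a -> rho ord0 (inord 2) = b -> rho (inord 1) (inord 2) = c ->
  forall i j, i != j -> rho i j = rep3 a b c i j.
Proof.
have i0 p : Ordinal (p : (0 < 3)%N) = ord0 by apply: val_inj.
have i1 p : Ordinal (p : (1 < 3)%N) = inord 1 by apply: val_inj; rewrite /= inordK.
have i2 p : Ordinal (p : (2 < 3)%N) = inord 2 by apply: val_inj; rewrite /= inordK.
move=> [r2 _ _] <- <- <-.
case=> [[|[|[|//]]] ?] [[|[|[|//]]] ?] // _; rewrite /rep3 /tabrep /= ?(i0, i1, i2) //.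
- by apply: r2; rewrite -val_eqE /= inordK.
- by apply: r2; rewrite -val_eqE /= inordK.
- by apply: r2; rewrite -val_eqE /= !inordK.
Qed.

Lemma trep_rep3 a b c : GRing.comm (a + b) c -> GRing.comm (a + c) b ->
  GRing.comm (b + c) a -> trep (rep3 a b c).
Proof.
move=> h1 h2 h3; split.
- by case=> [[|[|[|//]]] ?] [[|[|[|//]]] ?].
- case=> [[|[|[|//]]] ?] [[|[|[|//]]] ?] [[|[|[|//]]] ?] //= _;
  rewrite /rep3 /tabrep /=; by [|rewrite addrC].
- by case=> [[|[|[|//]]] ?] [[|[|[|//]]] ?] [[|[|[|//]]] ?] [[|[|[|//]]] ?].
Qed.

End Tables.

Section Pentagon.
Variables (K : fieldType) (Phi : That K 3).
Hypothesis pPhi : pentagon Phi.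

Lemma pentagon_rep4 (B : algType K) (a12 a13 a14 a23 a24 a34 : B) :
  trep (rep4 a12 a13 a14 a23 a24 a34) ->
  Ev (rep3 a12 (a13 + a14) (a23 + a24)) Phi * Ev (rep3 (a13 + a23) (a14 + a24) a34) Phi =
  Ev (rep3 a23 a24 a34) Phi * Ev (rep3 (a12 + a13) a14 (a24 + a34)) Phi
  * Ev (rep3 a12 a13 a23) Phi.
Proof.
move=> rP; have := congr1 (Ev (rep4 a12 a13 a14 a23 a24 a34)) pPhi.
rewrite !EvM //.
do 5! [rewrite Ev_coface //; last exact: disjoint_blocks].
by congr (_ * _ = _ * _ * _); apply: Ev_ext;
  case=> [[|[|[|//]]] ?] [[|[|[|//]]] ?] // _; rewrite pull_blocks //;
  rewrite /= !(big_cons, big_nil) ?addr0 /rep3 /rep4 /tabrep ?inordK.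
Qed.

End Pentagon.

(** * From the pentagon to group-likeness *)

Section GroupLike.
Variables (K : fieldType) (Phi : That K 3).
Hypothesis pPhi : pentagon Phi.

Lemma comm_pull (B : algType K) n m m' (I : 'I_n -> {set 'I_m}) (J : 'I_n -> {set 'I_m'})
  (rho : 'I_m -> 'I_m -> B) (rho' : 'I_m' -> 'I_m' -> B) :
  (forall i j : 'I_n, i != j -> [disjoint I i & I j]) ->
  (forall i j : 'I_n, i != j -> [disjoint J i & J j]) ->
  (forall i j k l, i != j -> k != l -> GRing.comm (rho i j) (rho' k l)) ->
  comm_reps (pull I rho) (pull J rho').
Proof.
move=> dI dJ c i j k l ij kl; rewrite /pull.
apply: commr_sum => p pk; apply: commr_sum => q ql; apply: commr_sym.
apply: commr_sum => r ri; apply: commr_sum => s sj; apply/commr_sym/c.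
  exact: (memI dI ij ri sj).
exact: (memI dJ kl pk ql).
Qed.

Section Rep.
Variable B : algType K.
Implicit Types a b c t : B.

Definition comm_seqs (s s' : seq B) := {in s & s', forall x y, GRing.comm x y}.

Lemma rep3_mem a b c i j : i != j -> rep3 a b c i j \in [:: a; b; c].
Proof.
by case: i j => [[|[|[|//]]] ?] [[|[|[|//]]] ?] // _; rewrite !inE eqxx ?orbT.
Qed.

Lemma comm_rep3 a b c a' b' c' : comm_seqs [:: a; b; c] [:: a'; b'; c'] ->
  comm_reps (rep3 a b c) (rep3 a' b' c').
Proof. by move=> h i j k l ij kl; apply: h; apply: rep3_mem. Qed.

Let rem1 := [:: [::]; [:: 1]; [:: 2]; [:: 3]]%N.
Let rem2 := [:: [:: 1]; [::]; [:: 2]; [:: 3]]%N.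

(** The table is the sum of two commuting pull-backs: [(a, b, c)] placed on strands 2, 3, 4 by
    [rem1] and [(a', b', c')] on strands 1, 3, 4 by [rem2]. Only strands 3 and 4 are shared, whence
    [c + c']. *)
Lemma trep_interleave a b c a' b' c' : trep (rep3 a b c) -> trep (rep3 a' b' c') ->
  comm_seqs [:: a; b; c] [:: a'; b'; c'] -> trep (rep4 0 a' b' a b (c + c')).
Proof.
move=> rP rP' /comm_rep3 cc.
have d1 := @disjoint_blocks 4 2 rem1 isT; have d2 := @disjoint_blocks 4 2 rem2 isT.
apply: trep_ext (trep_add (trep_pull d1 rP) (trep_pull d2 rP') (comm_pull d1 d2 cc)).
by case=> [[|[|[|[|//]]]] ?] [[|[|[|[|//]]]] ?] // _; rewrite /rep_add !pull_blocks //=;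
  rewrite !(big_cons, big_nil) ?addr0 ?add0r /rep3 /rep4 /tabrep ?inordK.
Qed.

Hypothesis split : forall b c, GRing.comm b c -> Ev (rep3 0 b c) Phi = 1.

(* The pentagon at (t12, t13, t14, t23, t24, t34) = (0, a', b', a, b, c + c'). *)
Lemma Ev_rep3_add a b c a' b' c' : trep (rep3 a b c) -> trep (rep3 a' b' c') ->
  comm_seqs [:: a; b; c] [:: a'; b'; c'] ->
  Ev (rep3 (a + a') (b + b') (c + c')) Phi =
  Ev (rep3 a b (c + c')) Phi * Ev (rep3 a' b' (b + c + c')) Phi.
Proof.
move=> rP rP' cc; have := pentagon_rep4 pPhi (trep_interleave rP rP' cc).
rewrite split; last first.
  by apply: commrD; apply/commr_sym/commrD; apply: cc; rewrite !inE eqxx ?orbT.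
rewrite [Ev (rep3 0 a' a) _]split; last by apply/commr_sym/cc; rewrite !inE eqxx.
by rewrite mul1r mulr1 add0r addrA [a' + a]addrC [b' + b]addrC.
Qed.

Lemma trep_mid t : trep (rep3 0 t 0).
Proof.
apply: trep_rep3; rewrite ?(add0r, addr0);
  by [apply: commr0 | apply/commr_sym/commr0 | apply/commr_sym/commr0].
Qed.

(** Adding $(0,t,0)$ as second triple produces the extra factor $P(0,t,b+c)$, which is 1 by
    [split]. *)
Lemma Ev_rep3_mid a b c t : trep (rep3 a b c) -> {in [:: a; b; c], forall x, GRing.comm x t} ->
  Ev (rep3 a (b + t) c) Phi = Ev (rep3 a b c) Phi.
Proof.
move=> rP ct; have := Ev_rep3_add rP (trep_mid t); rewrite !addr0 => -> //.
  by rewrite split ?mulr1 //; apply: commrD; apply/commr_sym/ct;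
    rewrite !inE eqxx ?orbT.
move=> x y xs; rewrite !inE => /or3P[]/eqP->; try exact: commr0.
exact: ct.
Qed.

(** With $(0,t,0)$ as first triple one gets $P(a,t+b,c)=P(0,t,c)P(a,b,t+c)$; the factor $P(0,t,c)$
    is 1, and [Ev_rep3_mid] removes $t$ on the left. *)
Lemma Ev_rep3_last a b c t : trep (rep3 a b c) -> {in [:: a; b; c], forall x, GRing.comm x t} ->
  Ev (rep3 a b (c + t)) Phi = Ev (rep3 a b c) Phi.
Proof.
move=> rP ct; have := Ev_rep3_add (trep_mid t) rP; rewrite !add0r => h.
rewrite -(Ev_rep3_mid rP ct) addrC [b + t]addrC h.
  rewrite split ?mul1r ?addr0 //; apply/commr_sym/ct; rewrite !inE eqxx ?orbT //.
move=> x y xs yb; move: xs; rewrite !inE => /or3P[]/eqP->;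
  by apply/commr_sym; [apply: commr0 || apply: ct].
Qed.

End Rep.

Lemma grouplike_of_split :
  (forall (B : algType K) (b c : B), GRing.comm b c -> Ev (rep3 0 b c) Phi = 1) ->
  grouplike Phi.
Proof.
move=> split B rho rho' rP rP' cc.
pose o k : 'I_3 := inord k.
have o01 : ord0 != o 1%N by rewrite -val_eqE /= inordK.
have o02 : ord0 != o 2%N by rewrite -val_eqE /= inordK.
have o12 : o 1%N != o 2%N by rewrite -val_eqE /= !inordK.
have e := rep3P rP erefl erefl erefl; have e' := rep3P rP' erefl erefl erefl.
have ea := rep3P (trep_add rP rP' cc) erefl erefl erefl.
rewrite (Ev_ext _ e) (Ev_ext _ e') (Ev_ext _ ea) /rep_add.
have {}rP := trep_ext e rP; have {}rP' := trep_ext e' rP'.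
have cs : comm_seqs [:: rho ord0 (o 1%N); rho ord0 (o 2%N); rho (o 1%N) (o 2%N)]
    [:: rho' ord0 (o 1%N); rho' ord0 (o 2%N); rho' (o 1%N) (o 2%N)].
  by move=> x y; rewrite !inE => /or3P[]/eqP-> /or3P[]/eqP->; apply: cc.
have sB := split B.
rewrite Ev_rep3_add // Ev_rep3_last //; last first.
  by move=> x xs; apply: cs; rewrite // !inE eqxx ?orbT.
rewrite addrC Ev_rep3_last // => x xs.
by apply: commrD; apply/commr_sym/cs; rewrite // !inE eqxx ?orbT.
Qed.

End GroupLike.

(** * Twists *)

Section Generators.
Variables (K : fieldType).

Lemma tijC n a b : tij K n a b = tij K n b a.
Proof. exact: t_sym. Qed.

Lemma uniq_inord n (s : seq nat) : uniq s -> all (fun a => 0 < a <= n.+1)%N s ->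
  uniq [seq inord a.-1 : 'I_n.+1 | a <- s].
Proof.
move=> us /allP bs; rewrite map_inj_in_uniq // => a b /bs ab /bs bb.
case: a b ab bb => // a [] // b /= ab bb /(congr1 val) /=.
by rewrite !inordK // => ->.
Qed.

Lemma tij_comm3 n a b c : uniq [:: a; b; c] && all (fun a => 0 < a <= n.+1)%N [:: a; b; c] ->
  GRing.comm (tij K n a b + tij K n a c) (tij K n b c).
Proof. by move=> /andP[u v]; apply: t_comm3; apply: (uniq_inord u v). Qed.

Lemma tij_comm3' n a b c : uniq [:: a; b; c] && all (fun a => 0 < a <= n.+1)%N [:: a; b; c] ->
  GRing.comm (tij K n a b + tij K n b c) (tij K n a c).
Proof.
move=> /andP[u v]; rewrite [tij K n a b]tijC; apply: tij_comm3.
apply/andP; split; first by rewrite /= !inE !negb_or in u *; lia.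
by rewrite /= in v *; lia.
Qed.

Lemma tij_comm3'' n a b c : uniq [:: a; b; c] && all (fun a => 0 < a <= n.+1)%N [:: a; b; c] ->
  GRing.comm (tij K n a c + tij K n b c) (tij K n a b).
Proof.
move=> /andP[u v]; rewrite [tij K n a c]tijC [tij K n b c]tijC; apply: tij_comm3.
apply/andP; split; first by rewrite /= !inE !negb_or in u *; lia.
by rewrite /= in v *; lia.
Qed.

Lemma tij_comm4 n a b c d :
  uniq [:: a; b; c; d] && all (fun a => 0 < a <= n.+1)%N [:: a; b; c; d] ->
  GRing.comm (tij K n a b) (tij K n c d).
Proof. by move=> /andP[u v]; apply: t_comm4; apply: (uniq_inord u v). Qed.

Lemma coface_tij n m s a b : wf_blocks n.+1 m.+1 s ->
  uniq [:: a; b] && all (fun a => 0 < a <= n.+1)%N [:: a; b] ->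
  coface (blocks m.+1 s) (tij K n a b) =
  \sum_(i <- nth [::] s a.-1) \sum_(j <- nth [::] s b.-1) tij K m i j.
Proof.
move=> ws /andP[u v]; have := uniq_inord u v; rewrite /= inE andbT => ab.
have /and3P[a1 b1 _] := v.
rewrite coface_t //; last exact: disjoint_blocks.
rewrite (sum_blocks ws) inordK; last by lia.
by apply: eq_bigr => i _; rewrite (sum_blocks ws) inordK //; lia.
Qed.

Lemma comm_coface m (I : 'I_3 -> {set 'I_m}) (s : That K m) (x : That K 3) :
  (forall i j : 'I_3, i != j -> [disjoint I i & I j]) -> homog 1 s ->
  GRing.comm s (coface I (tij K 2 1 2)) -> GRing.comm s (coface I (tij K 2 1 3)) ->
  GRing.comm s (coface I (tij K 2 2 3)) -> GRing.comm s (coface I x).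
Proof.
move=> dI hs c12 c13 c23.
have cg i j : i != j -> GRing.comm s (coface I (t K i j)).
  have i0 p : Ordinal (p : (0 < 3)%N) = inord 0 by apply: val_inj; rewrite /= inordK.
  have i1 p : Ordinal (p : (1 < 3)%N) = inord 1 by apply: val_inj; rewrite /= inordK.
  have i2 p : Ordinal (p : (2 < 3)%N) = inord 2 by apply: val_inj; rewrite /= inordK.
  by case: i j => [[|[|[|//]]] ?] [[|[|[|//]]] ?] // _; rewrite ?(i0, i1, i2) // t_sym.
have tP := trep_t K m.
apply: hcompP => d; rewrite !hcomp_Ev !EvM //; congr (pco _ d).
apply: pser_comm => i j; rewrite -!hcomp_Ev hs; case: ifP => _; last exact/commr_sym/commr0.
rewrite hcomp_coser; apply: commr_sum => w _; apply/commr_sym/comm_scalel/commr_sym.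
apply: commr_prod => p _; rewrite -/(cogen K I p) /cogen -coface_t //; last exact: (valP p).
exact: cg (valP p).
Qed.

(** Both letters become $t^{1,2}$, so a word counts only through its length, and [f d] collects the
    coefficients of all words of length [d]. *)
Lemma T2_pev (F : That K 2) : exists f, F = pev f (tij K 1 1 2).
Proof.
exists (fun d => \sum_(w : d.-tuple (tgen 2)) nccoef (trepr F) w).
apply: hcompP => d; rewrite hcomp_pev; last exact: homog_t.
rewrite hcomp_Ev scaler_suml; apply: eq_bigr => w _; congr (_ *: _).
have wE (p : tgen 2) : t K (val p).1 (val p).2 = tij K 1 1 2 :> That K 2.
  case: p => [[i j] ij] /=; rewrite /= in ij.
  have i0 p : Ordinal (p : (0 < 2)%N) = inord 0 by apply: val_inj; rewrite /= inordK.
  have i1 p : Ordinal (p : (1 < 2)%N) = inord 1 by apply: val_inj; rewrite /= inordK.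
  by case: i j ij => [[|[|//]] ?] [[|[|//]] ?] // _; rewrite ?(i0, i1) // t_sym.
rewrite /wval (eq_bigr (fun=> tij K 1 1 2)) // big_const_seq count_predT size_tuple.
by rewrite iter_mulr_1.
Qed.

Lemma aug_pev n f (s : That K n) : homog 1 s -> aug (pev f s) = f 0%N.
Proof.
move=> h; rewrite -aug_hcomp0 hcomp_pev // expr0 -(rmorph1 (@tpi K n)) -linearZ aug_pi.
by rewrite nccoefZ mulr1.
Qed.

End Generators.

(** * Twists preserve the pentagon, the hexagons and duality *)

Section TwistRelation.
Variables (K : fieldType) (f : nat -> K).
Local Notation e := (pev f).
Local Notation t12 := (tij K 2 1 2).
Local Notation t13 := (tij K 2 1 3).
Local Notation t23 := (tij K 2 2 3).
Implicit Types X Y : That K 3.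

(* X is the twist of Y by f(t^{1,2}), in inverse-free form. *)
Definition twisted X Y := X * (e t12 * e (t13 + t23)) = e t23 * e (t12 + t13) * Y.

Lemma homog_tij n a b : homog 1 (tij K n a b).
Proof. exact: homog_t. Qed.

Lemma twisted_coface m s X Y : wf_blocks 3 m.+1 s -> twisted X Y ->
  let c a b := coface (blocks m.+1 s) (tij K 2 a b) in
  coface (blocks m.+1 s) X * (e (c 1%N 2%N) * e (c 1%N 3%N + c 2%N 3%N)) =
  e (c 2%N 3%N) * e (c 1%N 2%N + c 1%N 3%N) * coface (blocks m.+1 s) Y.
Proof.
move=> ws /(congr1 (coface (blocks m.+1 s))); have dI := disjoint_blocks ws.
have h a b : homog 1 (tij K 2 a b) by apply: homog_t.
by rewrite !cofaceM // !coface_pev // ?cofaceD //; apply: homogD.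
Qed.

Hypothesis f0 : f 0%N = 1.

Lemma unit_pev n (s : That K n) : homog 1 s -> e s \is a GRing.unit.
Proof. by move=> h; apply/one_plus_unit/one_plus_pev. Qed.

Lemma comm_pev2 n (g : nat -> K) (s s' : That K n) : homog 1 s -> homog 1 s' -> GRing.comm s s' ->
  GRing.comm (e s) (pev g s').
Proof. by move=> h h' c; apply: comm_pev => //; apply/commr_sym/comm_pev/commr_sym. Qed.

Ltac eval_coface := rewrite /= ?coface_tij // /= !(big_cons, big_nil) ?addr0.
Ltac homog1 := by repeat first [exact: homog_tij | apply: homogD].

(** The first five hypotheses are the faces of the twist relation. Here [e12], [e23], [e34] are $f$
    at $t^{1,2},t^{2,3},t^{3,4}$, and [eM], [eQ], [eN], [eP], [eS], [eT], [eR] are $f$ at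
    $t^{12,3}$, $t^{12,34}$, $t^{2,34}$, $t^{23,4}$, $t^{1,23}$, $t^{1,234}$, $t^{123,4}$. Each
    factor occurs in two faces; the commutations bring the copies together. *)
Lemma pentagon_transport (R : unitRingType) (x1 x2 x3 x4 x5 y1 y2 y3 y4 y5
    e12 e34 eM eR eQ eS eT eN e23 eP : R) :
  x1 * (e12 * eQ) = eN * eT * y1 -> x2 * (eM * eR) = e34 * eQ * y2 ->
  x3 * (e23 * eP) = e34 * eN * y3 -> x4 * (eS * eR) = eP * eT * y4 ->
  x5 * (e12 * eM) = e23 * eS * y5 ->
  GRing.comm e12 eM -> GRing.comm e12 eR -> GRing.comm e12 eQ ->
  GRing.comm e12 y2 -> GRing.comm e34 x1 -> GRing.comm eR y5 ->
  GRing.comm e23 x4 -> GRing.comm eT y3 ->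
  e12 \is a GRing.unit -> eM \is a GRing.unit -> eR \is a GRing.unit ->
  y1 * y2 = y3 * y4 * y5 -> x1 * x2 = x3 * x4 * x5.
Proof.
move=> A B C D E c1 c2 c3 c4 c5 c6 c7 c8 u1 u2 u3 ye.
have um : e12 * eM * eR \is a GRing.unit by rewrite !unitrMl ?unitrMr.
apply: (mulIr um).
have -> : x1 * x2 * (e12 * eM * eR) = e34 * eN * eT * (y1 * y2).
  transitivity (x1 * (x2 * (eM * eR)) * e12).
    by rewrite c1 -(mulrA eM) c2 !mulrA.
  rewrite B !mulrA -c5 -(mulrA _ y2) -c4 mulrA -(mulrA _ eQ) -c3.
  by rewrite -2!(mulrA e34) A !mulrA.
rewrite ye; transitivity (x3 * x4 * (x5 * (e12 * eM)) * eR); last by rewrite !mulrA.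
transitivity (x3 * (x4 * e23) * eS * (y5 * eR)); last by rewrite E !mulrA.
rewrite -c7 -c6; transitivity (x3 * e23 * (x4 * (eS * eR)) * y5); last by rewrite !mulrA.
rewrite D; transitivity (x3 * (e23 * eP) * eT * y4 * y5); last by rewrite !mulrA.
by rewrite C -(mulrA _ y3) -c8 !mulrA.
Qed.

Lemma twisted_pentagon X Y : twisted X Y -> pentagon Y -> pentagon X.
Proof.
move=> XY pY; rewrite /pentagon in pY *.
have := twisted_coface (isT : wf_blocks 3 4 [:: [:: 1]; [:: 2]; [:: 3; 4]]%N) XY.
eval_coface; rewrite addrACA [_ + (_ + tij K 3 1 4)]addrA => A.
have := twisted_coface (isT : wf_blocks 3 4 [:: [:: 1; 2]; [:: 3]; [:: 4]]%N) XY.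
eval_coface => B.
have := twisted_coface (isT : wf_blocks 3 4 [:: [:: 2]; [:: 3]; [:: 4]]%N) XY.
eval_coface => C.
have := twisted_coface (isT : wf_blocks 3 4 [:: [:: 1]; [:: 2; 3]; [:: 4]]%N) XY.
eval_coface; rewrite [_ + (_ + tij K 3 3 4)]addrA => D.
have := twisted_coface (isT : wf_blocks 3 4 [:: [:: 1]; [:: 2]; [:: 3]]%N) XY.
eval_coface => E.
apply: (pentagon_transport A B C D E _ _ _ _ _ _ _ _ _ _ _ pY);
  try (by apply: unit_pev; homog1).
- apply: comm_pev2; [homog1..|]; exact/commr_sym/tij_comm3''.
- apply: comm_pev2; [homog1..|]; apply: commrD; [exact/commr_sym/tij_comm3''|exact: tij_comm4].
- apply: comm_pev2; [homog1..|]; apply: commrD; exact/commr_sym/tij_comm3''.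
- apply: comm_pev; [homog1|]; apply: comm_coface; [exact: disjoint_blocks|homog1|eval_coface..].
  + exact/commr_sym/tij_comm3''.
  + exact/commr_sym/tij_comm3''.
  + exact: tij_comm4.
- apply: comm_pev; [homog1|]; apply: comm_coface; [exact: disjoint_blocks|homog1|eval_coface..].
  + exact/commr_sym/tij_comm4.
  + exact/commr_sym/tij_comm3.
  + exact/commr_sym/tij_comm3.
- apply: comm_pev; [homog1|]; apply: comm_coface; [exact: disjoint_blocks|homog1|eval_coface..].
  + apply/commr_sym/commrD; [exact/commr_sym/tij_comm3''|exact: tij_comm4].
  + rewrite addrAC; apply/commr_sym/commrD; [exact/commr_sym/tij_comm3''|exact: tij_comm4].
  + rewrite -addrA; apply/commr_sym/commrD; [exact: tij_comm4|exact/commr_sym/tij_comm3''].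
- apply: comm_pev; [homog1|]; apply: comm_coface; [exact: disjoint_blocks|homog1|eval_coface..].
  + exact/commr_sym/tij_comm3.
  + exact/commr_sym/tij_comm4.
  + exact/commr_sym/tij_comm3''.
- apply: comm_pev; [homog1|]; apply: comm_coface; [exact: disjoint_blocks|homog1|eval_coface..].
  + apply/commr_sym/commrD; [exact/commr_sym/tij_comm3|exact/commr_sym/tij_comm4].
  + rewrite addrAC; apply/commr_sym/commrD; [exact/commr_sym/tij_comm3|exact/commr_sym/tij_comm4].
  + rewrite -addrA; apply/commr_sym/commrD; [exact/commr_sym/tij_comm4|exact/commr_sym/tij_comm3].
Qed.

Lemma one_plus_unitl n (s s' : That K n) : homog 1 s -> homog 1 s' ->
  e s * e s' \is a GRing.unit.
Proof. by move=> h h'; rewrite unitrMr; apply: unit_pev. Qed.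

Lemma texpE n (s : That K n) : texp s = pev (fun k => (k`!%:R)^-1) s.
Proof. by []. Qed.

Lemma inv_transport (R : unitRingType) (x y u v : R) : x \is a GRing.unit ->
  y \is a GRing.unit -> x * u = v * y -> x^-1 * v = u * y^-1.
Proof.
move=> xu yu h; apply: (mulrI xu); rewrite mulrA divrr // mul1r mulrA h.
by rewrite -mulrA divrr // mulr1.
Qed.

Lemma comm_scaler n c (s s' : That K n) : GRing.comm s s' -> GRing.comm s (c *: s').
Proof. by move=> h; apply/commr_sym/comm_scalel/commr_sym. Qed.

Lemma coface_unit m s X : wf_blocks 3 m.+1 s -> one_plus X ->
  coface (blocks m.+1 s) X \is a GRing.unit.
Proof.
move=> ws /one_plus_unit /unitrP[x [xX Xx]]; have dI := disjoint_blocks ws.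
by apply/unitrP; exists (coface (blocks m.+1 s) x); rewrite -!cofaceM // xX Xx coface1.
Qed.

Lemma coface_id X : X ^[[:: 1], [:: 2], [:: 3]] = X.
Proof.
apply: hcompP => d; rewrite hcomp_Ev Ev_coface; last first.
- exact: trep_t.
- exact: disjoint_blocks.
rewrite hcomp_Ev; congr (pco _ d); apply: Ev_ext => i j ij.
rewrite pull_blocks //; case: i j ij => [[|[|[|//]]] ?] [[|[|[|//]]] ?] // _;
  rewrite /= !big_seq1; congr (t K _ _); apply: val_inj; by rewrite /= inordK.
Qed.

(** The twist factors move from right to left through the product: each passes the adjacent
    exponential and is the one that the next permuted copy of the relation absorbs. What emerges on
    the left is the initial [u], which commutes with [E]. *)
Lemma hexagon1_transport (R : unitRingType) (x y x312 y312 x132i y132i E13 E23 E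
    u v u312 v312 u132 : R) :
  x * u = v * y -> x312 * u312 = v312 * y312 -> x132i * v = u132 * y132i ->
  u312 = u132 -> v312 = u ->
  GRing.comm E u -> GRing.comm E23 v -> GRing.comm E13 u132 ->
  u \is a GRing.unit ->
  E = y312 * E13 * y132i * E23 * y -> E = x312 * E13 * x132i * E23 * x.
Proof.
move=> A B C e1 e2 c1 c2 c3 uu hE; apply: (mulIr uu).
rewrite -(mulrA _ x) A c1 mulrA -(mulrA _ E23) c2 mulrA -(mulrA _ x132i) C mulrA.
by rewrite -(mulrA x312) c3 mulrA -e1 B hE -e2 !mulrA.
Qed.

Ltac solve_tcomm := first [exact: commr_refl | exact: tij_comm3 | exact: tij_comm3'
  | exact: tij_comm3'' | exact/commr_sym/tij_comm3 | exact/commr_sym/tij_comm3'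
  | exact/commr_sym/tij_comm3''].
Ltac homogz := first [by homog1 | by apply: homogZ; homog1].

Lemma twisted_hexagon1 X Y : one_plus X -> one_plus Y -> twisted X Y ->
  hexagon1 Y -> hexagon1 X.
Proof.
move=> X1 Y1 XY; rewrite /hexagon1 !coface_id !texpE.
have := twisted_coface (isT : wf_blocks 3 3 [:: [:: 3]; [:: 1]; [:: 2]]%N) XY.
eval_coface; rewrite !(tijC K 2 3) => A.
have w : wf_blocks 3 3 [:: [:: 1]; [:: 3]; [:: 2]]%N by [].
have := inv_transport (coface_unit w X1) (coface_unit w Y1) (twisted_coface w XY).
eval_coface; rewrite !(tijC K 2 3) [t13 + t12]addrC => B.
apply: (hexagon1_transport XY A B) => //.
- by rewrite addrC.
- by apply: commrM; apply/commr_sym/comm_pev2; try homogz; apply/comm_scaler; solve_tcomm.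
- by apply: commrM; apply/commr_sym/comm_pev2; try homogz; apply/comm_scaler; solve_tcomm.
- by apply: commrM; apply/commr_sym/comm_pev2; try homogz; apply/comm_scaler; solve_tcomm.
- by apply: one_plus_unitl; homog1.
Qed.

Lemma hexagon2_transport (R : unitRingType) (xi yi x231i y231i x213 y213 E13 E12 E
    u v u231 v231 u213 v213 : R) :
  xi * v = u * yi -> x231i * v231 = u231 * y231i -> x213 * u213 = v213 * y213 ->
  u213 = u -> v213 = v231 -> u231 = v ->
  GRing.comm E v -> GRing.comm E12 u -> GRing.comm E13 v213 ->
  v \is a GRing.unit ->
  E = y231i * E13 * y213 * E12 * yi -> E = x231i * E13 * x213 * E12 * xi.
Proof.
move=> A B C e1 e2 e3 c1 c2 c3 uu hE; apply: (mulIr uu).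
rewrite -(mulrA _ xi) A c1 mulrA -(mulrA _ E12) c2 mulrA -e1 -(mulrA _ x213) C mulrA.
by rewrite -(mulrA x231i) c3 mulrA e2 B hE -e3 !mulrA.
Qed.

Lemma twisted_hexagon2 X Y : one_plus X -> one_plus Y -> twisted X Y ->
  hexagon2 Y -> hexagon2 X.
Proof.
move=> X1 Y1 XY; rewrite /hexagon2 !coface_id !texpE.
have A := inv_transport (one_plus_unit X1) (one_plus_unit Y1) XY.
have w : wf_blocks 3 3 [:: [:: 2]; [:: 3]; [:: 1]]%N by [].
have := inv_transport (coface_unit w X1) (coface_unit w Y1) (twisted_coface w XY).
eval_coface; rewrite !(tijC K 2 3) (tijC K 2 2 1) => B.
have := twisted_coface (isT : wf_blocks 3 3 [:: [:: 2]; [:: 1]; [:: 3]]%N) XY.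
eval_coface; rewrite (tijC K 2 2 1) => C.
apply: (hexagon2_transport A B C) => //.
- by rewrite addrC.
- by rewrite addrC.
- by apply: commrM; apply/commr_sym/comm_pev2; try homogz; apply/comm_scaler; solve_tcomm.
- by apply: commrM; apply/commr_sym/comm_pev2; try homogz; apply/comm_scaler; solve_tcomm.
- by apply: commrM; apply/commr_sym/comm_pev2; try homogz; apply/comm_scaler; solve_tcomm.
- by apply: one_plus_unitl; homog1.
Qed.

(** Reversing the strands exchanges the two twist factors, and so does inverting the twist
    relation. *)
Lemma twisted_duality X Y : one_plus X -> one_plus Y -> twisted X Y ->
  duality Y -> duality X.
Proof.
move=> X1 Y1 XY; rewrite /duality => dY.
have A := inv_transport (one_plus_unit X1) (one_plus_unit Y1) XY.
have := twisted_coface (isT : wf_blocks 3 3 [:: [:: 3]; [:: 2]; [:: 1]]%N) XY.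
eval_coface; rewrite !(tijC K 2 3) (tijC K 2 2 1) => B.
have V : e t23 * e (t12 + t13) \is a GRing.unit by apply: one_plus_unitl; homog1.
by apply: (mulIr V); rewrite A -dY [t12 + _]addrC B [t13 + _]addrC.
Qed.

Lemma tsum_central X : GRing.comm (t12 + t13 + t23) X.
Proof.
rewrite -[X]coface_id; apply: comm_coface; [exact: disjoint_blocks|homog1|eval_coface..].
- rewrite -addrA; apply/commr_sym/commrD; [exact: commr_refl|exact/commr_sym/tij_comm3''].
- rewrite addrAC; apply/commr_sym/commrD; [exact/commr_sym/tij_comm3'|exact: commr_refl].
- apply/commr_sym/commrD; [exact/commr_sym/tij_comm3|exact: commr_refl].
Qed.

Lemma hcomp1M n (x y : That K n) : aug x = 1 -> aug y = 1 ->
  hcomp 1 (x * y) = hcomp 1 y + hcomp 1 x.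
Proof.
move=> x1 y1; rewrite hcompM 2!big_ord_recl big_ord0 addr0.
by rewrite /= /bump /= subnn subn0 !hcomp0 x1 y1 !scale1r mul1r mulr1.
Qed.

Lemma hcomp2M n (x y : That K n) : aug x = 1 -> aug y = 1 ->
  hcomp 2 (x * y) = hcomp 2 y + hcomp 1 x * hcomp 1 y + hcomp 2 x.
Proof.
move=> x1 y1; rewrite hcompM 3!big_ord_recl big_ord0 addr0 addrA.
by rewrite /= /bump /= subnn subn0 !hcomp0 x1 y1 !scale1r mul1r mulr1.
Qed.

Lemma aug_pev2 n (s s' : That K n) : homog 1 s -> homog 1 s' -> aug (e s * e s') = 1.
Proof. by move=> h h'; rewrite augM !aug_pev // f0 mulr1. Qed.

Lemma hcomp1_pev2 n (s s' : That K n) : homog 1 s -> homog 1 s' ->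
  hcomp 1 (e s * e s') = f 1%N *: (s + s').
Proof.
move=> h h'; rewrite hcomp1M ?aug_pev // !hcomp_pev // !expr1 -scalerDr.
by rewrite addrC.
Qed.

(** Both twist factors have the same degree 1 part, a multiple of the central element
    $t^{1,2}+t^{1,3}+t^{2,3}$; so the cross terms of degree 2 cancel. *)
Lemma twisted_low X Y d : one_plus X -> one_plus Y -> twisted X Y -> (d <= 2)%N ->
  hcomp d X - hcomp d Y =
  hcomp d (e t23 * e (t12 + t13)) - hcomp d (e t12 * e (t13 + t23)).
Proof.
move=> /one_plusP X1 /one_plusP Y1 XY d2.
have u1 : aug (e t23 * e (t12 + t13)) = 1 by apply: aug_pev2; homog1.
have v1 : aug (e t12 * e (t13 + t23)) = 1 by apply: aug_pev2; homog1.
have uE : hcomp 1 (e t23 * e (t12 + t13)) = f 1%N *: (t12 + t13 + t23).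
  by rewrite hcomp1_pev2; try homogz; rewrite addrC.
have vE : hcomp 1 (e t12 * e (t13 + t23)) = f 1%N *: (t12 + t13 + t23).
  by rewrite hcomp1_pev2; try homogz; rewrite addrA.
rewrite /twisted in XY; set u := e t23 * _ in XY u1 uE *; set v := e t12 * _ in XY v1 vE *.
clearbody u v; have uv : hcomp 1 u = hcomp 1 v by rewrite uE vE.
have e1 : hcomp 1 X = hcomp 1 Y.
  by have := congr1 (hcomp 1) XY; rewrite !hcomp1M // uv addrC => /addIr.
case: d d2 => [_|[_|[_|//]]]; first by rewrite !hcomp0 X1 Y1 u1 v1 !subrr.
  by rewrite e1 uv !subrr.
have := congr1 (hcomp 2) XY; rewrite !hcomp2M // -uv e1.
have -> : hcomp 1 u * hcomp 1 Y = hcomp 1 Y * hcomp 1 u.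
  by rewrite uE; apply/comm_scalel/tsum_central.
move=> h; have {}h : hcomp 2 v + hcomp 2 X = hcomp 2 Y + hcomp 2 u.
  by apply: (addIr (hcomp 1 Y * hcomp 1 u)); rewrite addrAC h addrAC.
by apply/eqP; rewrite subr_eq addrAC [_ + hcomp 2 Y]addrC -h [_ + hcomp 2 X]addrC addrK.
Qed.

End TwistRelation.

(** * The antisymmetrization condition under twists *)

Section Alternation.
Variable K : fieldType.
Hypothesis char0 : [pchar K] =i pred0.

Definition perm_blocks (s : 'S_3) : 'I_3 -> {set 'I_3} := fun i => [set s i].

Lemma disjoint_perm_blocks s (i j : 'I_3) : i != j -> [disjoint perm_blocks s i & perm_blocks s j].
Proof.
move=> ij; rewrite disjoints1 inE; apply: contra_neq ij => /perm_inj ->.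
by [].
Qed.

Lemma coface_perm s i j : i != j -> coface (perm_blocks s) (t K i j) = t K (s i) (s j).
Proof.
by move=> ij; rewrite coface_t ?big_set1 //; apply: disjoint_perm_blocks.
Qed.

Lemma alternating_sum_eq0 (F : 'S_3 -> That K 3) (x y : 'I_3) : x != y ->
  (forall s, F (tperm x y * s)%g = F s) -> \sum_(s : 'S_3) (-1) ^+ s *: F s = 0.
Proof.
move=> xy FE; set S := \sum_s _.
have : S = - S.
  rewrite -[RHS]sumrN [LHS](reindex_inj (mulgI (tperm x y))) /=.
  apply: eq_bigr => s _; rewrite FE odd_permM odd_tperm xy -scaleNr.
  by case: (odd_perm s); rewrite ?opprK.
move/eqP; rewrite -addr_eq0 -mulr2n -scaler_nat => /eqP /(congr1 (fun z => 2^-1 *: z)).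
by rewrite scalerA mulVf ?scale1r ?scaler0 // (pcharf0P K).1.
Qed.

Definition alternation (X : That K 3) := \sum_(s : 'S_3) (-1) ^+ s *: coface (perm_blocks s) X.

Lemma alternation_is_linear : linear alternation.
Proof.
move=> c X Y; rewrite /alternation scaler_sumr -big_split; apply: eq_bigr => s _ /=.
rewrite coface_is_linear; last exact: disjoint_perm_blocks.
by rewrite scalerDr !scalerA mulrC.
Qed.

Lemma alternation_hcomp d X : hcomp d (alternation X) = alternation (hcomp d X).
Proof.
rewrite linear_sum; apply: eq_bigr => s _; rewrite linearZ /= hcomp_coface //.
exact: disjoint_perm_blocks.
Qed.

Variable f : nat -> K.
Local Notation e := (pev f).
Local Notation t12 := (tij K 2 1 2).
Local Notation t13 := (tij K 2 1 3).
Local Notation t23 := (tij K 2 2 3).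
Let o k : 'I_3 := inord k.

Let o01 : o 0 != o 1. Proof. by rewrite -val_eqE /= !inordK. Qed.
Let o02 : o 0 != o 2. Proof. by rewrite -val_eqE /= !inordK. Qed.
Let o10 : o 1 != o 0. Proof. by rewrite eq_sym. Qed.
Let o20 : o 2 != o 0. Proof. by rewrite eq_sym. Qed.
Let o12 : o 1 != o 2. Proof. by rewrite -val_eqE /= !inordK. Qed.

Lemma coface_perm_pev2 s x y z : homog 1 x -> homog 1 y -> homog 1 z ->
  coface (perm_blocks s) (e x * e (y + z)) =
  e (coface (perm_blocks s) x) * e (coface (perm_blocks s) y + coface (perm_blocks s) z).
Proof.
move=> hx hy hz; have dI := disjoint_perm_blocks s.
by rewrite cofaceM // !coface_pev ?cofaceD //; apply: homogD.
Qed.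

(** The element is fixed by the exchange of 2 and 3, so the terms cancel in pairs. The exchange of 1
    and 2 does the same in [alternation_right]. *)
Lemma alternation_left : alternation (e t23 * e (t12 + t13)) = 0.
Proof.
apply: (alternating_sum_eq0 o12) => s; rewrite !coface_perm_pev2; try exact: homog_tij.
rewrite !coface_perm // !permM tpermL tpermR (tpermD o10 o20) //.
by rewrite [t K (s (o 2)) _]t_sym [X in e _ * e X]addrC.
Qed.

Lemma alternation_right : alternation (e t12 * e (t13 + t23)) = 0.
Proof.
apply: (alternating_sum_eq0 o01) => s; rewrite !coface_perm_pev2; try exact: homog_tij.
rewrite !coface_perm // !permM tpermL tpermR (tpermD o02 o12) //.
by rewrite [t K (s (o 1)) (s (o 0))]t_sym [X in e _ * e X]addrC.
Qed.

Hypothesis f0 : f 0%N = 1.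

Lemma twisted_Alt X Y d : one_plus X -> one_plus Y -> twisted f X Y -> (d <= 2)%N ->
  hcomp d (Alt X) = hcomp d (Alt Y).
Proof.
move=> X1 Y1 XY d2; have lin := alternation_is_linear.
rewrite /Alt -!/(alternation _) !linearZ /=; congr (_ *: _).
apply/eqP; rewrite -subr_eq0 !alternation_hcomp.
have altB x y : alternation (x - y) = alternation x - alternation y.
  by rewrite -scaleN1r addrC lin scaleN1r addrC.
rewrite -altB (twisted_low f0 X1 Y1 XY d2) altB -!alternation_hcomp.
by rewrite alternation_left alternation_right subrr.
Qed.

Lemma twisted_associators c X Y : one_plus X -> twisted f X Y ->
  associators c Y -> associators c X.
Proof.
move=> X1 XY [Y1 pY h1 h2 aY]; split=> //.
- exact: twisted_pentagon XY pY.
- exact: twisted_hexagon1 XY h1.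
- exact: twisted_hexagon2 XY h2.
- by move=> d d2; rewrite (twisted_Alt X1 Y1 XY d2) aY.
Qed.

End Alternation.

(** * The twist as a group action *)

Section Action.
Variable K : fieldType.
Implicit Types (F G : That K 2) (X Y Phi : That K 3).
Local Notation t12 := (tij K 2 1 2).
Local Notation t13 := (tij K 2 1 3).
Local Notation t23 := (tij K 2 2 3).

Definition twist_left F := F ^[[:: 2], [:: 3]] * F ^[[:: 1], [:: 2; 3]] : That K 3.
Definition twist_right F := F ^[[:: 1], [:: 2]] * F ^[[:: 1; 2], [:: 3]] : That K 3.

Let w1 : wf_blocks 2 3 [:: [:: 2]; [:: 3]]%N. Proof. by []. Qed.
Let w2 : wf_blocks 2 3 [:: [:: 1]; [:: 2; 3]]%N. Proof. by []. Qed.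
Let w3 : wf_blocks 2 3 [:: [:: 1]; [:: 2]]%N. Proof. by []. Qed.
Let w4 : wf_blocks 2 3 [:: [:: 1; 2]; [:: 3]]%N. Proof. by []. Qed.

Lemma twist_left_pev f : twist_left (pev f (tij K 1 1 2)) = pev f t23 * pev f (t12 + t13).
Proof.
rewrite /twist_left !coface_pev; try exact: disjoint_blocks; try exact: homog_tij.
by rewrite !coface_tij //= !(big_cons, big_nil) !addr0.
Qed.

Lemma twist_right_pev f : twist_right (pev f (tij K 1 1 2)) = pev f t12 * pev f (t13 + t23).
Proof.
rewrite /twist_right !coface_pev; try exact: disjoint_blocks; try exact: homog_tij.
by rewrite !coface_tij //= !(big_cons, big_nil) !addr0.
Qed.

Lemma twist_leftM F G : twist_left (F * G) = twist_left F * twist_left G.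
Proof.
have [f ->] := T2_pev F; have [g ->] := T2_pev G.
rewrite /twist_left !(cofaceM (disjoint_blocks w1)) !(cofaceM (disjoint_blocks w2)) !mulrA.
congr (_ * _); rewrite -!mulrA; congr (_ * _).
rewrite !coface_pev; try exact: disjoint_blocks; try exact: homog_tij.
rewrite !coface_tij //= !(big_cons, big_nil) !addr0.
apply: comm_pev2; [exact: homog_tij | apply: homogD; exact: homog_tij |].
exact/commr_sym/tij_comm3.
Qed.

Lemma twist_rightM F G : twist_right (F * G) = twist_right F * twist_right G.
Proof.
have [f ->] := T2_pev F; have [g ->] := T2_pev G.
rewrite /twist_right !(cofaceM (disjoint_blocks w3)) !(cofaceM (disjoint_blocks w4)) !mulrA.
congr (_ * _); rewrite -!mulrA; congr (_ * _).
rewrite !coface_pev; try exact: disjoint_blocks; try exact: homog_tij.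
rewrite !coface_tij //= !(big_cons, big_nil) !addr0.
apply: comm_pev2; [exact: homog_tij | apply: homogD; exact: homog_tij |].
exact/commr_sym/tij_comm3''.
Qed.

Lemma one_plus_coface n m s (x : That K n) : wf_blocks n m.+1 s -> one_plus x ->
  one_plus (coface (blocks m.+1 s) x).
Proof.
move=> ws /one_plusP x1; apply/one_plusP; rewrite -aug_hcomp0.
have dI := disjoint_blocks ws.
by rewrite hcomp_coface // hcomp0 x1 scale1r coface1 // aug1.
Qed.

Lemma one_plus_twist_right F : one_plus F -> one_plus (twist_right F).
Proof. by move=> F1; apply: one_plusM; apply: one_plus_coface. Qed.

Lemma one_plus_twist F Phi : one_plus F -> one_plus Phi -> one_plus (twist F Phi).
Proof.
move=> F1 P1; apply: one_plusM; last exact/one_plusV/one_plus_twist_right.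
by apply: one_plusM => //; apply: one_plusM; apply: one_plus_coface.
Qed.

Lemma twistE F X Y : one_plus F ->
  (X = twist F Y) <-> X * twist_right F = twist_left F * Y.
Proof.
move=> F1; have u := one_plus_unit (one_plus_twist_right F1).
split=> [->|h]; first by rewrite /twist -/(twist_right F) divrK.
by apply: (mulIr u); rewrite h /twist -/(twist_right F) divrK.
Qed.

Lemma twist_twisted f X Y : f 0%N = 1 ->
  (X = twist (pev f (tij K 1 1 2)) Y) <-> twisted f X Y.
Proof.
move=> f0; rewrite twistE; first by rewrite twist_left_pev twist_right_pev.
by apply: one_plus_pev f0; apply: homog_tij.
Qed.

Lemma twist_comp F G Phi : one_plus F -> one_plus G ->
  twist (F * G) Phi = twist F (twist G Phi).
Proof.
move=> F1 G1; apply/esym/twistE; first exact: one_plusM.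
rewrite twist_leftM twist_rightM mulrA.
rewrite ((twistE (twist F (twist G Phi)) (twist G Phi) F1).1 erefl).
by rewrite -(mulrA (twist_left F)) ((twistE (twist G Phi) Phi G1).1 erefl) mulrA.
Qed.

Lemma T2_one_plus F : one_plus F -> exists2 f, f 0%N = 1 & F = pev f (tij K 1 1 2).
Proof.
move=> /one_plusP; have [f ->] := T2_pev F; rewrite aug_pev; last exact: homog_tij.
by move=> f0; exists f.
Qed.

End Action.

(** * Commutative values of a pentagon solution *)

Section CommutativeValues.
Variables (K : fieldType) (B : algType K).
Hypothesis cB : forall x y : B, GRing.comm x y.

Lemma pser_commB (u v : pser B) : u * v = v * u.
Proof. by apply: pser_comm. Qed.

Lemma trep_rep3_comm (a b c : B) : trep (rep3 a b c).
Proof. exact: trep_rep3. Qed.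

Lemma trep_rep4_comm (a b c d e g : B) : trep (rep4 a b c d e g).
Proof.
apply: trep_comm => // i j.
by case: i j => [[|[|[|[|//]]]] ?] [[|[|[|[|//]]]] ?].
Qed.

Variable Phi : That K 3.
Hypotheses (Phi1 : one_plus Phi) (pPhi : pentagon Phi).
Local Notation P a b c := (@Ev K 3 B (rep3 a b c) Phi).

Lemma Ev_rep3_const (a b c : B) : P a b c 0 = 1.
Proof. by rewrite Ev_const ?(one_plusP Phi).1 ?scale1r //; apply: trep_rep3_comm. Qed.

Lemma pser_idem1 (u : pser B) : u 0 = 1 -> u * u = u -> u = 1.
Proof. by move=> u0 uu; apply: (pser_regl u0); rewrite mulr1. Qed.

Let pent4 a b c d e g := pentagon_rep4 pPhi (trep_rep4_comm a b c d e g).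

(** With all arguments 0 the pentagon reads $P^2=P^3$. With one nonzero argument it gives $P^2=P$
    for the axis values. *)
Lemma Ev_rep3_000 : P 0 0 0 = 1.
Proof.
apply: pser_idem1; first exact: Ev_rep3_const.
have := pent4 0 0 0 0 0 0; rewrite !addr0 => /esym h.
by apply: (pser_regl (Ev_rep3_const 0 0 0)); rewrite mulrA.
Qed.

Lemma Ev_rep3_axis1 p : P p 0 0 = 1.
Proof.
apply: pser_idem1; first exact: Ev_rep3_const.
by have := pent4 p 0 0 0 0 0; rewrite !addr0 Ev_rep3_000 mulr1 mul1r.
Qed.

Lemma Ev_rep3_axis2 q : P 0 q 0 = 1.
Proof.
apply: pser_idem1; first exact: Ev_rep3_const.
by have := pent4 0 0 q 0 0 0; rewrite !addr0 !add0r Ev_rep3_000 mulr1 mul1r.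
Qed.

Lemma Ev_rep3_axis3 r : P 0 0 r = 1.
Proof.
apply: pser_idem1; first exact: Ev_rep3_const.
by have := pent4 0 0 0 0 0 r; rewrite !addr0 !add0r Ev_rep3_000 mulr1 mul1r.
Qed.

Lemma Ev_rep3_inv b c : P 0 b c * P c b 0 = 1.
Proof.
have := pent4 0 0 b c 0 0; rewrite !addr0 !add0r => ->.
by rewrite Ev_rep3_axis1 Ev_rep3_axis2 Ev_rep3_axis3 !mulr1.
Qed.

(** The pentagon at $(0,0,b,c,d,0)$ reads $P(0,b,c+d)P(c,b+d,0)=P(c,d,0)P(0,b,d)$, and [Ev_rep3_inv]
    trades the values with last argument 0. The result is the 2-cocycle identity at $(b,d,c)$ for
    $(q,r)\mapsto P(0,q,r)$. *)
Lemma Ev_rep3_cocycle b c d :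
  P 0 b (c + d) * P 0 d c = P 0 (b + d) c * P 0 b d.
Proof.
have := pent4 0 0 b c d 0; rewrite !addr0 !add0r Ev_rep3_axis3 mulr1 => h.
apply: (pser_regl (Ev_rep3_const c (b + d) 0)).
rewrite !mulrA [_ * P 0 (b + d) c]pser_commB Ev_rep3_inv mul1r.
by rewrite [P c _ 0 * _]pser_commB h -mulrA pser_commB -mulrA Ev_rep3_inv mulr1.
Qed.

End CommutativeValues.

(** * Universal commutative values *)

Section Universal.
Variable K : fieldType.

(** The alternative and the exponent depend on the word alone, uniformly in the algebra. *)
Lemma wval_rep3_0 (w : seq (tgen 3)) :
  (forall (B : algType K) (q r : B), GRing.comm q r -> wval (rep3 0 q r) w = 0) \/
  exists2 m, (m <= size w)%N & forall (B : algType K) (q r : B), GRing.comm q r ->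
    wval (rep3 0 q r) w = q ^+ m * r ^+ (size w - m).
Proof.
elim: w => [|p w IHw].
  by right; exists 0%N => // B q r _; rewrite /wval big_nil mulr1.
have pE : [\/ forall (B : algType K) (q r : B), rep3 0 q r (val p).1 (val p).2 = 0,
    forall (B : algType K) (q r : B), rep3 0 q r (val p).1 (val p).2 = q |
    forall (B : algType K) (q r : B), rep3 0 q r (val p).1 (val p).2 = r].
  case: (p : {p : 'I_3 * 'I_3 | p.1 != p.2}) => [[i j] ij] /=; rewrite /= in ij.
  by case: i j ij => [[|[|[|//]]] ?] [[|[|[|//]]] ?] // _; rewrite /rep3 /tabrep /=;
    [constructor 1|constructor 2|constructor 1|constructor 3|constructor 2|constructor 3].
case: IHw => [w0|[m mw wm]].
  by left=> B q r c; rewrite /wval big_cons -/(wval _ w) w0 ?mulr0.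
case: pE => h.
- by left=> B q r c; rewrite /wval big_cons h mul0r.
- right; exists m.+1 => // B q r c.
  by rewrite /wval big_cons h -/(wval _ w) wm // mulrA exprS subSS.
- right; exists m => [|B q r c]; first exact: leqW.
  rewrite /wval big_cons h -/(wval _ w) wm // mulrA (commrX m (commr_sym c)) -mulrA.
  by rewrite /= subSn // exprS.
Qed.

(* By Ev_univ, univ x determines all the values of x at commuting triples (0, q, r). *)
Definition univ (x : That K 3) : pser {poly K} := Ev (rep3 0 'X 1) x.

(** In degree [d] the value is a form of degree [d] in [q] and [r], so setting $q=X$, $r=1$ loses no
    coefficient. *)
Lemma Ev_univ (B : algType K) (q r : B) x d : GRing.comm q r ->
  Ev (rep3 0 q r) x d = \sum_(i < d.+1) (univ x d)`_i *: (q ^+ i * r ^+ (d - i)).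
Proof.
move=> c; rewrite /univ /= /evcoef.
under [RHS]eq_bigr do rewrite coef_sum scaler_suml.
rewrite exchange_big; apply: eq_bigr => w _ /=.
case: (wval_rep3_0 w) => [w0|[m mw wm]].
  rewrite !w0 ?scaler0 ?big1 // => [i _|]; first by rewrite coef0 scale0r.
  exact: mulrC.
rewrite size_tuple in mw wm; rewrite !wm //; last exact: mulrC.
rewrite (bigD1 (Ordinal (mw : (m < d.+1)%N))) //= big1 ?addr0 => [|i im].
  by rewrite coefZ expr1n mulr1 coefXn eqxx mulr1.
by rewrite coefZ expr1n mulr1 coefXn [_ == m]negbTE ?mulr0 ?scale0r.
Qed.

Lemma poly_comm (p q : ({poly K} : algType K)) : GRing.comm p q. Proof. exact: mulrC. Qed.
Lemma field_comm (a b : (K^o : algType K)) : GRing.comm a b. Proof. exact: mulrC. Qed.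

(** Jets 0 and 1 are the value and the derivative at $X=0$, that is, reduction modulo $X^2$. *)
Definition jet (k : nat) (u : pser {poly K}) : pser K^o := Pser (fun d => (u d)`_k : K^o).

Lemma jetE k u d : jet k u d = (u d)`_k. Proof. by []. Qed.

Lemma jet0M u v : jet 0 (u * v) = jet 0 u * jet 0 v.
Proof.
apply: pserP => d; rewrite pcoM /= coef_sum; apply: eq_bigr => i _.
exact: coef0M.
Qed.

Lemma jet1M u v : jet 1 (u * v) = jet 1 u * jet 0 v + jet 0 u * jet 1 v.
Proof.
apply: pserP => d; rewrite pcoD !pcoM /= coef_sum -big_split; apply: eq_bigr => i _ /=.
by rewrite coefM !big_ord_recl big_ord0 addr0 /= /bump /= subnn addrC.
Qed.
Lemma pser_commK (u v : pser K^o) : u * v = v * u.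
Proof. by apply: pser_comm => i j; apply: field_comm. Qed.

Lemma univ_split (B : algType K) (q r : B) x : univ x = 1 -> GRing.comm q r ->
  Ev (rep3 0 q r) x = 1.
Proof.
move=> x1 c; apply: pserP => d; rewrite Ev_univ // x1 pco1; case: d => [|d] /=.
  by rewrite big_ord1 coef1 !expr0 mulr1 scale1r.
by rewrite big1 // => i _; rewrite coef0 scale0r.
Qed.

Section Univ.
Variable Phi : That K 3.
Hypotheses (Phi1 : one_plus Phi) (pPhi : pentagon Phi).

Lemma univ_coef0 d : (univ Phi d)`_0 = (d == 0%N)%:R.
Proof.
have := congr1 (fun u : pser K^o => u d) (Ev_rep3_axis3 field_comm Phi1 pPhi 1).
rewrite Ev_univ; last exact: field_comm.
rewrite big_ord_recl big1 => [|i _]; last by rewrite exprS mul0r mul0r scaler0.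
by rewrite addr0 expr1n expr0 mulr1 /GRing.scale /= mulr1.
Qed.

Lemma univ_axis2 d : (univ Phi d.+1)`_d.+1 = 0.
Proof.
have := congr1 (fun u : pser K^o => u d.+1) (Ev_rep3_axis2 field_comm Phi1 pPhi 1).
rewrite Ev_univ; last exact: field_comm.
rewrite big_ord_recr big1 => [|i _] /=.
  by rewrite add0r expr1n subnn expr0 mulr1 /GRing.scale /= mulr1.
by rewrite subSn -1?ltnS // exprS mul0r mulr0 scaler0.
Qed.

Lemma jet0_univ (s : K) : jet 0 (Ev (rep3 0 'X s%:P) Phi) = 1.
Proof.
apply: pserP => d; rewrite jetE (Ev_univ _ _ (poly_comm 'X s%:P)).
rewrite coef_sum big_ord_recl big1 => [|i _].
  rewrite addr0 expr0 mul1r subn0 coefZ -polyC_exp coefC univ_coef0 /=.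
  by case: d => [|d] /=; rewrite ?expr0 ?mulr1 ?mul0r.
by rewrite coefZ exprS -mulrA coefXM mulr0.
Qed.

Lemma jet1_univ (s : K) : jet 1 (univ Phi) = 0 -> jet 1 (Ev (rep3 0 'X s%:P) Phi) = 0.
Proof.
move=> h; apply: pserP => d; rewrite jetE (Ev_univ _ _ (poly_comm 'X s%:P)).
rewrite coef_sum big1 // => -[[|[|i]] id] _ /=.
- by rewrite coefZ mul1r -polyC_exp coefC mulr0.
- have := congr1 (fun u : pser K^o => u d) h; rewrite /= => e1.
  by rewrite coefZ [X in X * _]e1 mul0r.
- by rewrite coefZ 2!exprS -!mulrA !coefXM mulr0.
Qed.

(* The cocycle identity at ('X, m, 1) modulo 'X^2 says that the derivative of *)
(* every coefficient of univ Phi vanishes at m.                               *)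
Lemma univ_eq1 : [pchar K] =i pred0 -> jet 1 (univ Phi) = 0 -> univ Phi = 1.
Proof.
move=> char0 h; have char0' := (pcharf0P K).1 char0.
have dm (m : K) d : (univ Phi d)^`().[m] = 0.
  have := congr1 (jet 1) (Ev_rep3_cocycle poly_comm Phi1 pPhi 'X 1 m%:P).
  have -> : 1 + m%:P = (1 + m)%:P by rewrite polyCD polyC1.
  rewrite [LHS]jet1M [RHS]jet1M (jet0_univ (1 + m)) (jet1_univ (1 + m) h).
  rewrite (jet0_univ m) (jet1_univ m h) mul0r mul1r add0r mulr1 mulr0 addr0 => e.
  have := congr1 (fun u : pser K^o => u d) e; rewrite !jetE.
  rewrite (Ev_univ _ _ (poly_comm m%:P 1)) (Ev_univ _ _ (poly_comm ('X + m%:P) 1)).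
  rewrite (eq_bigr (fun i : 'I_d.+1 => ((univ Phi d)`_i * m ^+ i)%:P)) => [|i _]; last first.
    by rewrite expr1n mulr1 -polyC_exp -mul_polyC -polyCM.
  rewrite -(big_morph _ (@polyCD K) (@polyC0 K)) coefC /= => /esym.
  have sz : (size (univ Phi d) <= d.+1)%N.
    rewrite [univ Phi d](Ev_univ _ _ (poly_comm 'X 1)).
    rewrite (eq_bigr (fun i : 'I_d.+1 => (univ Phi d)`_i *: 'X^i)) => [|i _].
      by rewrite -poly_def size_poly.
    by rewrite expr1n mulr1.
  have -> : \sum_(i < d.+1) (univ Phi d)`_i *: (('X + m%:P) ^+ i * 1 ^+ (d - i)) =
      univ Phi d \Po ('X + m%:P).
    rewrite [RHS]comp_polyE (big_ord_widen d.+1 (fun i => (univ Phi d)`_i *: ('X + m%:P) ^+ i)) //.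
    rewrite [RHS]big_mkcond; apply: eq_bigr => i _; rewrite expr1n mulr1.
    by case: ltnP => // ?; rewrite nth_default // scale0r.
  move=> e1; have : (univ Phi d \Po ('X + m%:P))^`().[0] = 0.
    by rewrite horner_coef0 coef_deriv e1 mul0rn.
  rewrite deriv_comp hornerM horner_comp derivD derivX derivC addr0 hornerC mulr1.
  by rewrite hornerD hornerX hornerC add0r.
have natr_inj : injective (fun i : nat => i%:R : K).
  move=> i j; wlog ij : i j / (i <= j)%N.
    by case: (leqP i j) => [|/ltnW] ij w /=; [exact: w | move=> /esym /(w _ _ ij)].
  move=> /esym /eqP; rewrite -subr_eq0 -natrB // char0' subn_eq0 => ji.
  by apply/eqP; rewrite eqn_leq ij ji.
have d0 d : (univ Phi d)^`() = 0.
  set p := _^`(); apply/eqP; apply: contraT => p0.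
  have := @max_poly_roots _ p [seq i%:R | i <- iota 0 (size p)] p0.
  rewrite size_map size_iota ltnn => -> //; last by rewrite map_inj_uniq ?iota_uniq.
  by apply/allP => x _; rewrite rootE dm.
apply: pserP => d; apply/polyP => -[|i]; first by rewrite univ_coef0 pco1 coefMn coef1 /= mulr1n; case: d.
have := congr1 (fun p : {poly K} => p`_i) (d0 d); rewrite coef_deriv coef0 => /eqP.
rewrite -mulr_natr mulf_eq0 char0' orbF => /eqP ->.
by rewrite pco1; case: eqP; rewrite ?coef1 ?coef0.
Qed.

End Univ.
End Universal.

Section TwistValues.
Variables (K : fieldType) (B : algType K).
Implicit Types (a b c : B) (f : nat -> K).

Definition pgeom f a : pser B := Pser (fun d => f d *: a ^+ d).

Lemma pgeom0 f : f 0%N = 1 -> pgeom f 0 = 1.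
Proof.
by move=> f0; apply: pserP => -[|d]; rewrite pco1 /= ?f0 ?scale1r // exprS mul0r scaler0.
Qed.

Lemma Ev_twisted f (X Y : That K 3) a b c : trep (rep3 a b c) -> twisted f X Y ->
  Ev (rep3 a b c) X * (pgeom f a * pgeom f (b + c)) =
  pgeom f c * pgeom f (a + b) * Ev (rep3 a b c) Y.
Proof.
move=> rP /(congr1 (Ev (rep3 a b c))).
have Et i j : uniq [:: i; j] && all (fun k => 0 < k <= 3)%N [:: i; j] ->
    Ev (rep3 a b c) (tij K 2 i j) = pmon (rep3 a b c (inord i.-1) (inord j.-1)).
  by move=> /andP[u v]; have := uniq_inord u v; rewrite /= inE andbT => ij; apply: Ev_t.
have E12 : Ev (rep3 a b c) (tij K 2 1 2) = pmon a by rewrite Et // /rep3 /tabrep !inordK.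
have E13 : Ev (rep3 a b c) (tij K 2 1 3) = pmon b by rewrite Et // /rep3 /tabrep !inordK.
have E23 : Ev (rep3 a b c) (tij K 2 2 3) = pmon c by rewrite Et // /rep3 /tabrep !inordK.
have Ep s x : Ev (rep3 a b c) s = pmon x -> homog 1 s ->
    Ev (rep3 a b c) (pev f s) = pgeom f x.
  by move=> sx hs; apply: pserP => d; rewrite (Ev_pev _ _ rP sx hs).
rewrite !EvM // (Ep _ _ E12) ?(Ep _ _ E23); try exact: homog_tij.
rewrite (Ep _ (b + c)) ?(Ep _ (a + b)) //; try (apply: homogD; exact: homog_tij).
  by rewrite EvD // E12 E13 pmonD.
by rewrite EvD // E13 E23 pmonD.
Qed.

End TwistValues.

(** * A series with prescribed logarithmic derivative *)

Section Recursion.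
Variables (K : fieldType) (eta : nat -> K).
Hypotheses (char0 : [pchar K] =i pred0) (eta0 : eta 0%N = 0).

(** Each new coefficient uses all earlier ones, hence the list. *)
Fixpoint ode_prefix n : seq K :=
  if n is m.+1 then
    rcons (ode_prefix m)
      (m.+1%:R^-1 * \sum_(i < m.+1) (ode_prefix m)`_i * eta (m.+1 - i)%N)
  else [:: 1].

Definition ode_sol d := (ode_prefix d)`_d.

Lemma size_ode_prefix n : size (ode_prefix n) = n.+1.
Proof. by elim: n => //= n IHn; rewrite size_rcons IHn. Qed.

Lemma ode_prefixE n i : (i <= n)%N -> (ode_prefix n)`_i = ode_sol i.
Proof.
elim: n => [|n IHn]; first by rewrite leqn0 => /eqP ->.
rewrite leq_eqVlt ltnS => /orP[/eqP -> //|i_n].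
by rewrite /= nth_rcons size_ode_prefix ltnS i_n IHn.
Qed.

(** Coefficientwise form of $h f'(h)=f(h)\eta(h)$. *)
Lemma ode_solE d : d%:R * ode_sol d = \sum_(i < d.+1) ode_sol i * eta (d - i)%N.
Proof.
rewrite big_ord_recr /= subnn eta0 mulr0 addr0.
case: d => [|d]; first by rewrite mul0r big_ord0.
rewrite /ode_sol /= nth_rcons size_ode_prefix ltnn eqxx mulVKf ?(pcharf0P K).1 //.
by apply: eq_bigr => i _; rewrite ode_prefixE -1?ltnS.
Qed.

End Recursion.

(** * Existence of a Lie representative *)

Section Existence.
Variable K : fieldType.
Hypothesis char0 : [pchar K] =i pred0.

(** At $(0,X,1)$ the twist relation reads $u_1\,f(hX+h)=f(h)f(hX)\,u_0$, with $u_0$, $u_1$ the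
    universal values of [Phi] and of its twist. If $f$ has no linear term, the part linear in $X$ is
    $\eta_1 f+hf'=f\eta$, where $\eta_1$ and $\eta$ are the linear parts of $u_1$ and $u_0$. Solving
    $hf'=f\eta$ forces $\eta_1=0$, and [univ_eq1] concludes. *)
Lemma exists_normalized (Phi : That K 3) : one_plus Phi -> pentagon Phi ->
  exists2 f : nat -> K, f 0%N = 1 &
    forall X, one_plus X -> pentagon X -> twisted f X Phi -> univ X = 1.
Proof.
move=> P1 pP; pose eta d := jet 1 (univ Phi) d.
have eta0 : eta 0%N = 0.
  rewrite /eta jetE /univ (Ev_rep3_const (@poly_comm K) P1).
  by rewrite coef1.
(* This yields [f 1 = 0], so that $f(hX)$ contributes nothing linear in $X$. *)
have eta1 : eta 1%N = 0 by rewrite /eta jetE univ_axis2.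
pose f := ode_sol eta; have fE := ode_solE char0 eta0; rewrite -/f in fE.
have f0 : f 0%N = 1 by [].
have f1 : f 1%N = 0.
  by have := fE 1%N; rewrite mul1r !big_ord_recl big_ord0 /= /bump /= eta1 eta0 !mulr0 !addr0.
exists f => // X X1 pX XP; apply: univ_eq1 => //.
have := Ev_twisted (trep_rep3_comm (@poly_comm K) 0 'X 1) XP.
rewrite -/(univ X) -/(univ Phi) add0r.
rewrite pgeom0 //.
rewrite mul1r => /(congr1 (jet 1)); rewrite !jet1M.
have j0X1 : jet 0 (@pgeom K {poly K} f ('X + 1)) = @pgeom K K^o f 1.
  apply: pserP => d; rewrite jetE /= coefZ expr1n -horner_coef0 horner_exp.
  by rewrite hornerD hornerX -polyC1 hornerC add0r expr1n.
have j1X1 : jet 1 (@pgeom K {poly K} f ('X + 1)) = Pser (fun d => d%:R * f d : K^o).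
  apply: pserP => d; rewrite jetE /= coefZ.
  have -> : (('X + 1 : {poly K}) ^+ d)`_1 = d%:R.
    rewrite -[LHS]mulr1n -coef_deriv -horner_coef0 deriv_exp derivD derivX -polyC1.
    by rewrite derivC addr0 mul1r hornerMn horner_exp hornerD hornerX hornerC add0r expr1n.
  by rewrite mulrC.
have j01 : jet 0 (@pgeom K {poly K} f 1) = @pgeom K K^o f 1.
  by apply: pserP => d; rewrite jetE /= !expr1n coefZ coef1.
have j11 : jet 1 (@pgeom K {poly K} f 1) = 0.
  by apply: pserP => d; rewrite jetE /= !expr1n coefZ coef1 mulr0.
have j0X : jet 0 (@pgeom K {poly K} f 'X) = 1.
  apply: pserP => -[|d]; rewrite jetE pco1 /= coefZ coefXn ?f0 ?mulr1 //.
  by rewrite mulr0.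
have j1X : jet 1 (@pgeom K {poly K} f 'X) = 0.
  apply: pserP => -[|[|d]]; rewrite jetE /= coefZ coefXn ?mulr0 //.
  by rewrite f1 mul0r.
rewrite !jet0M j0X1 j1X1 j01 j11 j0X j1X mulr0 mul0r addr0 mul0r add0r mulr1.
have j0U Z : one_plus Z -> pentagon Z -> jet 0 (univ Z) = 1.
  by move=> Z1 pZ; have := jet0_univ Z1 pZ 1; rewrite polyC1.
rewrite !j0U // mul1r.
have -> : Pser (fun d => d%:R * f d : K^o) = @pgeom K K^o f 1 * jet 1 (univ Phi).
  apply: pserP => d; rewrite pcoM [LHS]fE; apply: eq_bigr => i _.
  by rewrite /= expr1n /GRing.scale /= mulr1.
move=> h; have {}h : jet 1 (univ X) * @pgeom K K^o f 1 = 0.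
  by apply: (addIr (@pgeom K K^o f 1 * jet 1 (univ Phi))); rewrite h add0r.
apply: (@pser_regl _ (@pgeom K K^o f 1)); first by rewrite /= f0 scale1r.
by rewrite mulr0 pser_commK.
Qed.

Lemma exists_lie_twist (Phi : That K 3) : one_plus Phi -> pentagon Phi ->
  exists f : nat -> K, exists X : That K 3,
  [/\ f 0%N = 1, twisted f X Phi, one_plus X, pentagon X & lie_hat (tlog X)].
Proof.
move=> P1 pP; have [f f0 fX] := exists_normalized P1 pP.
pose F : That K 2 := pev f (tij K 1 1 2); exists f; exists (twist F Phi).
have F1 : one_plus F by apply: one_plus_pev f0; apply: homog_tij.
have tw : twisted f (twist F Phi) Phi by apply/twist_twisted.
have X1 := one_plus_twist F1 P1; have pX := twisted_pentagon f0 tw pP.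
split=> //; apply: grouplike_lie => //; apply: grouplike_of_split => // B b c bc.
by apply: univ_split => //; apply: fX tw.
Qed.

End Existence.

(** * Twists that fix a character value are exponential *)

Section Uniqueness.
Variable K : fieldType.
Hypothesis char0 : [pchar K] =i pred0.

(** $(1,1,0)=(1,0,0)+(0,1,0)$, so group-likeness reduces the value to two axis values. *)
Lemma lie_value (X : That K 3) : one_plus X -> pentagon X -> lie_hat (tlog X) ->
  Ev (rep3 1 1 0) X = 1 :> pser K^o.
Proof.
move=> X1 pX lX; have c := @field_comm K; have tr := trep_rep3_comm c.
have cc : comm_reps (rep3 1 0 0) (rep3 0 1 0 : 'I_3 -> 'I_3 -> K^o) by move=> *; apply: c.
have := lie_grouplike char0 X1 lX (tr 1 0 0) (tr 0 1 0) cc.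
rewrite (Ev_rep3_axis1 c X1 pX) (Ev_rep3_axis2 c X1 pX) mulr1 => <-.
apply: Ev_ext => i j _; rewrite /rep_add.
by case: i j => [[|[|[|//]]] ?] [[|[|[|//]]] ?]; rewrite /rep3 /tabrep /= ?addr0 ?add0r.
Qed.

(* Comparing values at the character (t^{1,2}, t^{1,3}, t^{2,3}) -> (1, 1, 0) *)
(* gives f(h) ^ 2 = f(2 h), whose only solutions are exponentials.            *)
Lemma twisted_exp f (X Y : That K 3) : f 0%N = 1 -> one_plus X -> twisted f X Y ->
  Ev (rep3 1 1 0) X = Ev (rep3 1 1 0) Y :> pser K^o ->
  forall d, f d = f 1%N ^+ d / d`!%:R.
Proof.
move=> f0 X1 XY e; have char0' := (pcharf0P K).1 char0.
have c := @field_comm K; have tr := trep_rep3_comm c 1 1 0.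
have := Ev_twisted tr XY; rewrite -e [RHS]pser_commK.
move/(pser_regl (Ev_rep3_const c X1 _ _ _)).
rewrite pgeom0 //.
rewrite addr0 mul1r => h.
have sq d : \sum_(i < d.+1) f i * f (d - i)%N = 2 ^+ d * f d.
  have := congr1 (fun u : pser K^o => u d) h; rewrite pcoM /= => hd.
  rewrite [RHS]mulrC -[RHS]hd; apply: eq_bigr => i _.
  by rewrite /= !expr1n /GRing.scale /= !mulr1.
pose g d := f 1%N ^+ d / d`!%:R.
have fn0 k : (k`!%:R : K) != 0 by rewrite char0' -lt0n fact_gt0.
have gsq d : \sum_(i < d.+1) g i * g (d - i)%N = 2 ^+ d * g d.
  rewrite -[2]/(1 + 1) exprDn mulr_suml; apply: eq_bigr => i _.
  have id : (i <= d)%N by rewrite -ltnS.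
  rewrite !expr1n mul1r /g -(bin_fact id) !natrM !invfM mulrACA -exprD subnKC //.
  rewrite [RHS]mulrCA; congr (_ * _).
  by rewrite mulVKf // char0' -lt0n bin_gt0.
elim/ltn_ind => -[|[|d]] IHd; first by rewrite f0 expr0 fact0 divr1.
  by rewrite expr1 divr1.
rewrite -/(g d.+2); have := sq d.+2; have := gsq d.+2.
have ends (u : nat -> K) : u 0%N = 1 -> \sum_(i < d.+3) u i * u (d.+2 - i)%N =
    \sum_(i < d.+1) u i.+1 * u (d.+2 - i.+1)%N + u d.+2 *+ 2.
  move=> u0; rewrite big_ord_recl subn0 big_ord_recr /= /bump add1n subnn u0.
  by rewrite mul1r mulr1 [LHS]addrC -addrA -mulr2n.
rewrite !ends //; last by rewrite /g expr0 fact0 divr1.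
have -> : \sum_(i < d.+1) f i.+1 * f (d.+2 - i.+1)%N = \sum_(i < d.+1) g i.+1 * g (d.+2 - i.+1)%N.
  by apply: eq_bigr => i _; congr (_ * _); apply: IHd; have := ltn_ord i; lia.
(* The end terms contribute twice the top coefficient, so the equation determines it up to the
   factor $2^{d+2}-2$, nonzero in characteristic 0. *)
move=> gE fE; have two : (2 ^+ d.+2 - 2 : K) != 0.
  rewrite -natrX -natrB ?char0' ?subn_eq0 -?ltnNge.
    by rewrite (@ltn_exp2l 2 1).
  by rewrite (@leq_exp2l 2 1).
by apply: (mulfI two); rewrite !mulrBl -gE -fE !mulr_natl !addrK.
Qed.

Lemma texpD n (x y : That K n) : aug x = 0 -> aug y = 0 -> GRing.comm x y ->
  texp (x + y) = texp x * texp y.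
Proof.
move=> x0 y0 c; have tP := trep_t K n.
apply: hcompP => d; rewrite !hcomp_Ev; congr (pco _ d).
rewrite EvM // !Ev_texp // EvD // pexpD ?Ev_aug0 //.
by rewrite /GRing.comm -!EvM // c.
Qed.

(** Since $t^{1,2}$ commutes with $t^{1,3}+t^{2,3}$, and $t^{2,3}$ with $t^{1,2}+t^{1,3}$, both
    twist factors collapse to the exponential of [l] times the central sum of the generators. *)
Lemma twisted_texp l (X Y : That K 3) :
  twisted (fun d => l ^+ d / d`!%:R) X Y <-> X = Y.
Proof.
have pE n (s : That K n) : pev (fun d => l ^+ d / d`!%:R) s = texp (l *: s).
  rewrite /pev /texp; congr tsum; apply: funext => k.
  by rewrite exprZn scalerA mulrC.
have h0 n (s : That K n) : homog 1 s -> aug (l *: s) = 0.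
  by move=> hs; rewrite -aug_hcomp0 linearZ /= hs scaler0 lie_aug //; apply: lie0.
have hD a b c d : homog 1 (tij K 2 a b + tij K 2 c d) by apply: homogD; apply: homog_tij.
have ht a b := @homog_tij K 2 a b.
have c1 : GRing.comm (l *: tij K 2 1 2) (l *: (tij K 2 1 3 + tij K 2 2 3)).
  exact/comm_scalel/comm_scaler/commr_sym/tij_comm3''.
have c2 : GRing.comm (l *: tij K 2 2 3) (l *: (tij K 2 1 2 + tij K 2 1 3)).
  exact/comm_scalel/comm_scaler/commr_sym/tij_comm3.
rewrite /twisted !pE -(texpD _ _ c1) ?h0 // -(texpD _ _ c2) ?h0 // -!scalerDr.
rewrite addrA [tij K 2 2 3 + _]addrC.
set c := l *: _; have cY : GRing.comm (texp c) Y.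
  rewrite texpE; apply: comm_pev; first by apply: homogZ; apply: homogD.
  exact/comm_scalel/tsum_central.
have cu : texp c \is a GRing.unit.
  by apply/one_plus_unit/one_plusP/aug_texp; rewrite h0 //; apply: homogD.
rewrite cY; split=> [/(mulIr cu)|->] //.
Qed.

End Uniqueness.

(** * Orbits and isotropy groups *)

Section Orbits.
Variable K : fieldType.
Hypothesis char0 : [pchar K] =i pred0.

Lemma twist_eq_of_value F (X Y : That K 3) : one_plus F -> one_plus X ->
  X = twist F Y -> Ev (rep3 1 1 0) X = Ev (rep3 1 1 0) Y :> pser K^o ->
  X = Y /\ exists l : K, F = texp (l *: tij K 1 1 2).
Proof.
move=> F1 X1 XY e; have [f f0 FE] := T2_one_plus F1.
rewrite FE in XY; move/(twist_twisted _ _ f0): XY => tw.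
have fE : f = fun d => f 1%N ^+ d / d`!%:R.
  by apply: funext; apply: twisted_exp tw e.
split; first by apply/(twisted_texp char0 (f 1%N)); rewrite -fE.
exists (f 1%N); rewrite FE {1}fE /pev /texp; congr tsum; apply: funext => k.
by rewrite exprZn scalerA mulrC.
Qed.

(** [C] is any twist-stable class of pentagon solutions. For uniqueness, [X] is the twist of [Y] by
    a quotient $FG^{-1}$, and both take the value 1 at $(1,1,0)$. *)
Lemma unique_lie_in_orbit (C : set (That K 3)) :
  (forall X, C X -> Pent X) ->
  (forall f X Y, f 0%N = 1 -> one_plus X -> twisted f X Y -> C Y -> C X) ->
  forall Phi, C Phi -> exists! Psi, twist_orbit Phi Psi /\ logLie C Psi.
Proof.
move=> CP Ctw Phi CPhi; have [P1 pP] := CP _ CPhi.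
have [f [X [f0 tw X1 pX lX]]] := exists_lie_twist char0 P1 pP.
have F1 : one_plus (pev f (tij K 1 1 2)) by apply: one_plus_pev f0; apply: homog_tij.
exists X; split.
  split; first by exists (pev f (tij K 1 1 2)) => //; apply/esym/twist_twisted.
  by split=> //; apply: Ctw tw CPhi.
move=> Y [[G G1 GY] [CY lY]]; have [Y1 pY] := CP _ CY.
have XE : X = twist (pev f (tij K 1 1 2)) Phi by apply/twist_twisted.
have Gu := one_plus_unit G1.
have e : X = twist (pev f (tij K 1 1 2) * G^-1) Y.
  by rewrite -GY -twist_comp ?divrK //; apply: one_plusM => //; apply: one_plusV.
have vE : Ev (rep3 1 1 0) X = Ev (rep3 1 1 0) Y :> pser K^o by rewrite !lie_value.
by have [] := twist_eq_of_value (one_plusM F1 (one_plusV G1)) X1 e vE.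
Qed.

(** For [F] fixing [Phi], the equality of values required by [twist_eq_of_value] is reflexivity. *)
Lemma isotropyE Phi : Pent Phi ->
  isotropy Phi = [set texp (lambda *: tij K 1 1 2) | lambda in [set: K]]%classic.
Proof.
move=> [P1 pP]; apply/seteqP; split=> [F [F1 FP]|_ [l _ <-]].
  have [_ [l ->]] := twist_eq_of_value F1 P1 (esym FP) erefl.
  by exists l.
have f0 : l ^+ 0 / 0`!%:R = 1 by rewrite expr0 fact0 divr1.
have E : texp (l *: tij K 1 1 2) = pev (fun d => l ^+ d / d`!%:R) (tij K 1 1 2).
  rewrite /pev /texp; congr tsum; apply: funext => k.
  by rewrite exprZn scalerA mulrC.
split; rewrite E.
  by apply: (one_plus_pev _ f0); apply: homog_tij.
by apply/esym/(twist_twisted _ _ f0)/(twisted_texp char0).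
Qed.

(** Twists leave [Alt] unchanged up to degree 2, whatever [c] is; this serves [Assoc] and
    [Assoc_norm] alike. *)
Lemma unique_lie_associator (c : K) Phi : associators c Phi ->
  exists! Psi, twist_orbit Phi Psi /\ logLie (associators c) Psi.
Proof.
apply: unique_lie_in_orbit => [X []|f X Y f0 X1 tw] //.
exact: twisted_associators tw.
Qed.

Lemma unique_lie_dual_associator (c : K) Phi : dual (associators c) Phi ->
  exists! Psi, twist_orbit Phi Psi /\ logLie (dual (associators c)) Psi.
Proof.
apply: unique_lie_in_orbit => [X [[]]|f X Y f0 X1 tw [aY dY]] //.
split; first exact: twisted_associators tw aY.
by have [Y1 _ _ _ _] := aY; apply: twisted_duality tw dY.
Qed.

End Orbits.

Theorem theorem7p1 (K : fieldType) (char0 : [pchar K] =i pred0) :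
  [/\ forall Phi : That K 3, Pent Phi ->
        exists! Psi : That K 3, twist_orbit Phi Psi /\ Pent_Lie Psi,
      forall Phi : That K 3, Assoc Phi ->
        exists! Psi : That K 3, twist_orbit Phi Psi /\ Assoc_Lie Psi,
      forall Phi : That K 3, Assoc0 Phi ->
        exists! Psi : That K 3, twist_orbit Phi Psi /\ Assoc0_Lie Psi &
      forall Phi : That K 3, Pent Phi ->
        isotropy Phi =
          [set texp (lambda *: tij K 1 1 2) | lambda in [set: K]]%classic]
  /\
  (forall Phi : That K 3, Assoc_norm Phi ->
     exists! Psi : That K 3, twist_orbit Phi Psi /\ Assoc_norm_Lie Psi)
  /\
  (forall Phi : That K 3, Assoc0_norm Phi ->
     exists! Psi : That K 3, twist_orbit Phi Psi /\ Assoc0_norm_Lie Psi).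
Proof.
split; [split|split].
- move=> Phi; apply: unique_lie_in_orbit => // f X Y f0 X1 tw [_ pY].
  by split=> //; apply: twisted_pentagon tw pY.
- by move=> Phi; apply: unique_lie_associator.
- by move=> Phi; apply: unique_lie_dual_associator.
- by move=> Phi; apply: isotropyE.
- by move=> Phi; apply: unique_lie_associator.
- by move=> Phi; apply: unique_lie_dual_associator.
Qed.
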